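(* Let $H$ be a Hilbert space, $\mu$ a probability measure on $H$, $\mathcal{H}=L^2(H,\mu)$, $T>0$. Let $(P_t)_{t\ge 0}$ be a strongly continuous semigroup on $\mathcal{H}$ with infinitesimal generator $-N$, such that for some $\omega\in\mathbb{R}$ one has $|P_t\phi|_{\mathcal{H}}\le e^{\omega t}|\phi|_{\mathcal{H}}$ for all $t\ge 0$, $\phi\in\mathcal{H}$. Assume that $P_t$ is positivity preserving (that is, $P_t\varphi\ge 0$ $\mu$-a.e. whenever $\varphi\ge 0$ $\mu$-a.e.), that $g\in W^{1,\infty}([0,T],\mathcal{H})$, and that there is a constant $C$ such that $$\int_0^T|(N_\lambda g(t))^+|_{\mathcal{H}}^2\,dt\le C\qquad\forall\lambda\in(0,\omega^{-1}).$$ Let $\varphi_0\in\mathcal{H}$ with $\varphi_0\ge g(0)$ $\mu$-a.e., and $f\in L^2([0,T],\mathcal{H})$. Then the problem $$\frac{d\varphi}{dt}(t)+N\varphi(t)+\mathcal{N}_{g(t)}(\varphi(t))\ni f(t)\ \text{ on }[0,T],\qquad \varphi(0)=\varphi_0,$$ has a unique mild solution $\varphi\in C([0,T],\mathcal{H})$. Moreover, the map $(\varphi_0,f)\mapsto\varphi$, defined for $\varphi_0\in\mathcal{H}$ with $\varphi_0\ge g(0)$ $\mu$-a.e. and $f\in L^2([0,T],\mathcal{H})$, is Lipschitz from $\mathcal{H}\times L^2([0,T],\mathcal{H})$ to $C([0,T],\mathcal{H})$.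
   Context: For $h\in\mathcal{H}$, $\mathcal{K}_h=\{\phi\in\mathcal{H}:\phi\ge h\ \mu\text{-a.e.}\}$, and for $\phi\in\mathcal{K}_h$, $\mathcal{N}_h(\phi)=\{z\in\mathcal{H}:\int_H z(\phi-\psi)\,d\mu\ge0\ \ \forall\psi\in\mathcal{K}_h\}$ is the normal cone; equivalently, $\mu$-a.e., $z(x)=0$ where $\phi(x)>h(x)$ and $z(x)\le0$ where $\phi(x)=h(x)$. $W^{1,\infty}([0,T],\mathcal{H})$ is the space of absolutely continuous functions $[0,T]\to\mathcal{H}$ with derivative in $L^\infty([0,T],\mathcal{H})$. The Yosida approximation of $N$ is $N_\lambda u=\frac1\lambda(u-(I+\lambda N)^{-1}u)$, $0<\lambda<1/\omega$; if $\omega\le0$ the interval $(0,\omega^{-1})$ is read as $(0,\infty)$. $u^+=\max(u,0)$. We write $e^{-Nt}=P_t$. Mild solution: a function $\varphi\in C([0,T],\mathcal{H})$ is a mild solution of the problem $\frac{d\varphi}{dt}(t)+N\varphi(t)+\mathcal{N}_{g(t)}(\varphi(t))\ni f(t)$ on $[0,T]$ with initial condition $\varphi(0)=\varphi_0$ if $\varphi(t)\ge g(t)$ $\mu$-a.e. for almost all $t\in[0,T]$ and there exists $\eta\in L^2([0,T],\mathcal{H})$ with $\eta(t)\in\mathcal{N}_{g(t)}(\varphi(t))$ for almost all $t\in[0,T]$, such that $$\varphi(t)+\int_0^te^{-N(t-s)}\eta(s)\,ds=e^{-Nt}\varphi_0+\int_0^te^{-N(t-s)}f(s)\,ds\qquad\forall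 t\in[0,T].$$ *)

(* Defs.v *)
From HB Require Import structures.
From mathcomp Require Import all_boot all_order all_algebra.
From mathcomp Require Import all_classical all_reals all_analysis.
From mathcomp Require Import measurable_realfun ess_sup_inf.

Set Implicit Arguments.
Unset Strict Implicit.
Unset Printing Implicit Defensive.

Import Order.TTheory GRing.Theory Num.Theory.
Import numFieldNormedType.Exports.

Local Open Scope classical_set_scope.
Local Open Scope ring_scope.

(* The library provides L^p(mu) only as a quotient type, with no structure. We
   equip it with its structure of normed vector space. *)
Section Lspace_normedModType.
Context d (T : measurableType d) (R : realType).
Variables (mu : {measure set T -> \bar R}) (p : \bar R) (p1 : (1 <= p)%E).

Local Notation L := (LspaceType mu p1).
Implicit Types (f g h : L).

Lemma eq_LnormP (u v : T -> R) : u = v %[ae mu] ->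
  measurable_fun setT u -> measurable_fun setT v ->
  'N[mu]_p[EFin \o u]%E = 'N[mu]_p[EFin \o v]%E.
Proof.
move=> uv mu' mv; rewrite unlock /Lnorm; case: p p1 => [r r1|_|//].
  congr (_ `^ _)%E; apply: ae_eq_integral => //.
  - apply/measurable_EFinP/(@measurableT_comp _ _ _ _ _ _ (@powR R ^~ r)) => //.
    exact: measurableT_comp.
  - apply/measurable_EFinP/(@measurableT_comp _ _ _ _ _ _ (@powR R ^~ r)) => //.
    exact: measurableT_comp.
  - by apply: filterS uv => x /(_ I) + _ => /= ->.
case: ifPn => // _; apply: eq_ess_sup.
by apply: filterS uv => x /(_ I) /= ->.
Qed.

Lemma measurable_aeEqMfun (f : {mfun_ mu, T >-> measurableTypeR R}) :
  measurable_fun setT (f : T -> R).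
Proof. by move=> mT Y mY; exact: (measurable_funP (repr f) mT Y mY). Qed.

Lemma Lspace_Lfun f : (f : T -> R) \in Lfun mu p.
Proof.
apply/andP; split; rewrite inE /=; first exact: measurable_aeEqMfun.
exact: Lebesgue_finite.
Qed.

Section mk.
Variables (u : T -> R) (uL : u \in Lfun mu p).

Let mu_ : measurable_fun setT u.
Proof. by case/andP: uL => /[!inE]. Qed.

Let u1 : T -> measurableTypeR R := u.
HB.instance Definition _ := @isMeasurableFun.Build d _ T (measurableTypeR R) u1 mu_.

Let cls : {mfun_ mu, T >-> measurableTypeR R} :=
  (\pi_({mfun_ mu, T >-> measurableTypeR R}) (u1 : {mfun T >-> measurableTypeR R}))%qT.

Let clsE : (cls : T -> R) = u %[ae mu].
Proof.
have : (repr cls == (u1 : {mfun T >-> _}) %[mod {mfun_ mu, T >-> measurableTypeR R}])%qT.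
  by rewrite reprK.
by rewrite eqmodE => /asboolP.
Qed.

Let cls_fin : finite_norm mu p (cls : T -> R).
Proof.
rewrite /finite_norm (eq_LnormP clsE) //.
  by case/andP: uL => _ /[!inE].
exact: measurable_aeEqMfun.
Qed.

(* the class of a p-integrable function *)
Definition Lspace_mk : L :=
  @LebesgueSpace.Pack _ _ _ _ _ p1 cls
    (LebesgueSpace.Class (isFinLebesgue.Build d T R mu p p1 cls cls_fin)).

Lemma Lspace_mkE : (Lspace_mk : T -> R) = u %[ae mu].
Proof. exact: clsE. Qed.

End mk.

HB.instance Definition _ := gen_eqMixin L.
HB.instance Definition _ := gen_choiceMixin L.

Lemma Lspace_eqP f g : f = g <-> (f : T -> R) = g %[ae mu].
Proof.
split=> [->|]; first exact: aeW.
case: f g => [f [[ff]]] [g [[gg]]] /= fg.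
have E : f = g by apply/eqP; rewrite -[f]reprK -[g]reprK eqmodE; exact/asboolP.
by case: _ / E gg {fg} => gg; rewrite (Prop_irrelevance ff gg).
Qed.

Let zeroP : (cst 0 : T -> R) \in Lfun mu p.
Proof.
apply/andP; split; rewrite inE /=; first exact: measurable_cst.
exact: finite_norm_cst0.
Qed.

Let addP f g : (fun x => f x + g x) \in Lfun mu p.
Proof. exact: (@Lfun_addr_closed _ _ _ mu p p1).2 (Lspace_Lfun f) (Lspace_Lfun g). Qed.

Let oppP f : (fun x => - f x) \in Lfun mu p.
Proof. exact: (@Lfun_oppr_closed _ _ _ mu p) (Lspace_Lfun f). Qed.

Let scaleP (a : R) f : (fun x => a * f x) \in Lfun mu p.
Proof.
have := (@Lfun_submod_closed _ _ _ mu p p1).2 a _ _ (Lspace_Lfun f) zeroP.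
rewrite (_ : a *: _ + _ = fun x => a * f x)//.
by apply/funext => x; rewrite fctE addr0.
Qed.

Definition Lspace_zero : L := Lspace_mk zeroP.
Definition Lspace_add f g : L := Lspace_mk (addP f g).
Definition Lspace_opp f : L := Lspace_mk (oppP f).
Definition Lspace_scale (a : R) f : L := Lspace_mk (scaleP a f).

Let zeroE : (Lspace_zero : T -> R) = cst 0 %[ae mu].
Proof. exact: Lspace_mkE. Qed.

Let addE f g : (Lspace_add f g : T -> R) = (fun x => f x + g x) %[ae mu].
Proof. exact: Lspace_mkE. Qed.

Let oppE f : (Lspace_opp f : T -> R) = (fun x => - f x) %[ae mu].
Proof. exact: Lspace_mkE. Qed.

Let scaleE a f : (Lspace_scale a f : T -> R) = (fun x => a * f x) %[ae mu].
Proof. exact: Lspace_mkE. Qed.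

Let addA : associative Lspace_add.
Proof.
move=> f g h; apply/Lspace_eqP.
apply: filter_app (addE f g). apply: filter_app (addE g h).
apply: filter_app (addE (Lspace_add f g) h).
apply: filter_app (addE f (Lspace_add g h)).
apply: aeW => x + + + + _.
by move=> /(_ I) -> /(_ I) -> /(_ I) -> /(_ I) ->; rewrite addrA.
Qed.

Let addC : commutative Lspace_add.
Proof.
move=> f g; apply/Lspace_eqP.
apply: filter_app (addE g f). apply: filter_app (addE f g).
apply: aeW => x + + _.
by move=> /(_ I) -> /(_ I) ->; rewrite addrC.
Qed.

Let add0 : left_id Lspace_zero Lspace_add.
Proof.
move=> f; apply/Lspace_eqP.
apply: filter_app (zeroE). apply: filter_app (addE Lspace_zero f).
apply: aeW => x + + _.
by move=> /(_ I) -> /(_ I) ->; rewrite add0r.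
Qed.

Let addN : left_inverse Lspace_zero Lspace_opp Lspace_add.
Proof.
move=> f; apply/Lspace_eqP.
apply: filter_app (zeroE). apply: filter_app (oppE f).
apply: filter_app (addE (Lspace_opp f) f).
apply: aeW => x + + + _.
by move=> /(_ I) -> /(_ I) -> /(_ I) ->; rewrite addNr.
Qed.

HB.instance Definition _ := GRing.isZmodule.Build L addA addC add0 addN.

Let scaleA a b f :
  Lspace_scale a (Lspace_scale b f) = Lspace_scale (a * b) f.
Proof.
apply/Lspace_eqP.
apply: filter_app (scaleE (a * b) f). apply: filter_app (scaleE b f).
apply: filter_app (scaleE a (Lspace_scale b f)).
apply: aeW => x + + + _.
by move=> /(_ I) -> /(_ I) -> /(_ I) ->; rewrite mulrA.
Qed.

Let scale1 : left_id 1 Lspace_scale.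
Proof.
move=> f; apply/Lspace_eqP.
apply: filter_app (scaleE 1 f).
by apply: aeW => x + _ => /(_ I) ->; rewrite mul1r.
Qed.

Let scaleDr : right_distributive Lspace_scale +%R.
Proof.
move=> a f g; apply/Lspace_eqP.
apply: filter_app (scaleE a g). apply: filter_app (scaleE a f).
apply: filter_app (addE (Lspace_scale a f) (Lspace_scale a g)).
apply: filter_app (addE f g). apply: filter_app (scaleE a (f + g)).
apply: aeW => x + + + + + _.
move=> /(_ I) -> /(_ I) -> /(_ I) -> /(_ I) -> /(_ I) ->.
by rewrite mulrDr.
Qed.

Let scaleDl f : {morph Lspace_scale^~ f : a b / a + b}.
Proof.
move=> a b; apply/Lspace_eqP.
apply: filter_app (scaleE b f). apply: filter_app (scaleE a f).
apply: filter_app (addE (Lspace_scale a f) (Lspace_scale b f)).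
apply: filter_app (scaleE (a + b) f).
apply: aeW => x + + + + _.
by move=> /(_ I) -> /(_ I) -> /(_ I) -> /(_ I) ->; rewrite mulrDl.
Qed.

HB.instance Definition _ :=
  GRing.Zmodule_isLmodule.Build R L scaleA scale1 scaleDr scaleDl.

Definition Lspace_norm f : R := fine ('N[mu]_p[EFin \o f])%E.

Lemma Lspace_normE f : (Lspace_norm f)%:E = ('N[mu]_p[EFin \o f])%E.
Proof.
rewrite /Lspace_norm fineK// fin_numElt (lt_le_trans ltNy0) ?Lnorm_ge0//=.
exact: Lebesgue_finite.
Qed.

Let normD f g : Lspace_norm (f + g) <= Lspace_norm f + Lspace_norm g.
Proof.
rewrite -lee_fin EFinD !Lspace_normE (eq_LnormP (addE f g)).
- by apply: eminkowski => //; exact: measurable_aeEqMfun.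
- exact: measurable_aeEqMfun.
- by apply: measurable_funD; exact: measurable_aeEqMfun.
Qed.

Let normZ a f : Lspace_norm (a *: f) = `|a| * Lspace_norm f.
Proof.
apply: EFin_inj; rewrite EFinM !Lspace_normE (eq_LnormP (scaleE a f)).
- have := LnormZ (Lfun_Sub p1 (Lspace_Lfun f)) a.
  by rewrite Lfun_valP.
- exact: measurable_aeEqMfun.
- by apply: measurable_funM => //; exact: measurable_aeEqMfun.
Qed.

Let norm_eq0 f : Lspace_norm f = 0 -> f = 0.
Proof.
move=> f0; apply/Lspace_eqP.
have /Lnorm_eq0_eq0 : 'N[mu]_p[EFin \o f]%E = 0%E by rewrite -Lspace_normE f0.
have /measurable_EFinP mf : measurable_fun setT (f : T -> R).
  exact: measurable_aeEqMfun.
move=> /(_ mf (lt_le_trans lte01 p1)) h.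
apply: filter_app (zeroE). apply: filter_app (h).
by apply: aeW => x + + _ => /(_ I) [->] /(_ I) ->.
Qed.

HB.instance Definition _ := Lmodule_isNormed.Build R L normD normZ norm_eq0.

Lemma Lspace_addE f g : (f + g : T -> R) = (fun x => f x + g x) %[ae mu].
Proof. exact: addE. Qed.

Lemma Lspace_oppE f : (- f : T -> R) = (fun x => - f x) %[ae mu].
Proof. exact: oppE. Qed.

Lemma Lspace_scaleE a f : (a *: f : T -> R) = (fun x => a * f x) %[ae mu].
Proof. exact: scaleE. Qed.

Lemma Lspace_0E : ((0 : L) : T -> R) = cst 0 %[ae mu].
Proof. exact: zeroE. Qed.

Let posP f : (fun x => Num.max (f x) 0) \in Lfun mu p.
Proof.
have /andP[+ +] := Lspace_Lfun f; rewrite !inE/= => mf Nf.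
have nf : (fun x => `|f x|) \in Lfun mu p.
  apply/andP; split; rewrite inE/=; first exact: measurableT_comp.
  rewrite /finite_norm; set u := (X in Lnorm _ _ X).
  by have -> : u = abse \o (EFin \o f) by []; rewrite Lnorm_abse.
have := (@Lfun_submod_closed _ _ _ mu p p1).2 2^-1 _ _
  ((@Lfun_addr_closed _ _ _ mu p p1).2 _ _ (Lspace_Lfun f) nf) zeroP.
rewrite (_ : 2^-1 *: _ + _ = fun x => Num.max (f x) 0)//.
apply/funext => x; rewrite !fctE addr0 maxr_absE subr0 addr0.
by rewrite /GRing.scale/= mulrC.
Qed.

Definition Lspace_pos f : L := Lspace_mk (posP f).

End Lspace_normedModType.

Section Bochner.
Context d (X : measurableType d) (R : realType).
Variables (mu : {measure set X -> \bar R}) (V : normedModType R) (D : set X).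

(* Strong measurability and integrability are those of Bochner: approximation by
   functions with finitely many values, each nonzero value being taken on a set of
   finite measure. Convergence is only required almost everywhere, so that a
   function need not be Borel measurable when mu is not complete. *)
Definition is_simple (s : {fimfun X >-> V}) : Prop :=
  forall y, measurable (D `&` s @^-1` [set y]) /\
    (y != 0 -> (mu (D `&` s @^-1` [set y]) < +oo)%E).

Definition simple_integral (s : {fimfun X >-> V}) : V :=
  \sum_(y \in range s) fine (mu (D `&` s @^-1` [set y])) *: y.

Definition simple_approx (s : nat -> {fimfun X >-> V}) (f : X -> V) : Prop :=
  (forall n, is_simple (s n)) /\
  {ae mu, forall x, D x -> s n x @[n --> \oo] --> f x}.

Definition strongly_measurable (f : X -> V) : Prop :=
  exists s, simple_approx s f.

Definition is_bochner_integral (f : X -> V) (v : V) : Prop :=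
  exists s, [/\ simple_approx s f,
    (\int[mu]_(x in D) (`|f x - s n x|)%:E)%E @[n --> \oo] --> 0%E &
    simple_integral (s n) @[n --> \oo] --> v].

(* The value is 0 if f is not Bochner integrable on D. *)
Definition bochner_integral (f : X -> V) : V :=
  xget 0 [set v | is_bochner_integral f v].

Definition bochner_L2 (f : X -> V) : Prop :=
  strongly_measurable f /\
  (\int[mu]_(x in D) (`|f x| ^+ 2)%:E < +oo)%E.

Definition L2norm (f : X -> V) : R :=
  Num.sqrt (\int[mu]_(x in D) (`|f x| ^+ 2)).

Definition bochner_Linfty (f : X -> V) : Prop :=
  strongly_measurable f /\
  exists M : R, {ae mu, forall x, D x -> `|f x| <= M}.

End Bochner.

Section W1infty.
Context (R : realType) (V : normedModType R).
Implicit Types (a b : R) (g : R -> V).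

Definition absolutely_continuous a b g : Prop :=
  forall e : R, 0 < e -> exists2 r : R, 0 < r &
    forall (n : nat) (u v : 'I_n -> R),
      (forall i, a <= u i /\ u i <= v i /\ v i <= b) ->
      trivIset setT (fun i => `]u i, v i[%classic) ->
      \sum_(i < n) (v i - u i) < r ->
      \sum_(i < n) `|g (v i) - g (u i)| < e.

Definition W1infty a b g : Prop :=
  absolutely_continuous a b g /\
  exists2 g' : R -> V, bochner_Linfty lebesgue_measure `[a, b] g' &
    {ae lebesgue_measure, forall t, t \in `[a, b] -> is_derive t 1 g (g' t)}.

End W1infty.

Section Semigroup.
Context (R : realType) (V : normedModType R).

(* Only the operators P t with 0 <= t are meaningful. *)
Definition C0_semigroup (P : R -> {linear V -> V}) : Prop :=
  [/\ forall t, 0 <= t -> continuous (P t),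
      forall u, P 0 u = u,
      forall s t u, 0 <= s -> 0 <= t -> P (s + t) u = P s (P t u) &
      forall u, P t u @[t --> 0^'+] --> u].

(* as a graph, since the generator is only defined on a subspace *)
Definition generator (P : R -> {linear V -> V}) : set (V * V) :=
  [set uw | h^-1 *: (P h uw.1 - uw.1) @[h --> 0^'+] --> uw.2].

(* (I + l N)^-1 u, for the operator N with graph G *)
Definition resolvent (G : set (V * V)) (l : R) (u : V) : V :=
  xget 0 [set v | exists2 w, G (v, w) & v + l *: w = u].

Definition yosida (G : set (V * V)) (l : R) (u : V) : V :=
  l^-1 *: (u - resolvent G l u).

End Semigroup.

Section Obstacle.
Context d (X : measurableType d) (R : realType).
Variable mu : {measure set X -> \bar R}.
Local Notation L2 := (LspaceType2 mu).

Definition Lle (u v : L2) : Prop := {ae mu, forall x, u x <= v x}.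

Definition positivity_preserving (A : L2 -> L2) : Prop :=
  forall u, Lle 0 u -> Lle 0 (A u).

Definition obstacle_set (h : L2) : set L2 := [set phi | Lle h phi].

Definition normal_cone (h phi : L2) : set L2 :=
  [set z | forall psi, obstacle_set h psi ->
     0 <= \int[mu]_x (z x * (phi - psi) x)].

(* P t stands for e^{-N t} *)
Definition mild_solution (P : R -> {linear L2 -> L2}) (T : R)
    (g f : R -> L2) (phi0 : L2) (phi : R -> L2) : Prop :=
  [/\ {within `[0, T], continuous phi},
      {ae lebesgue_measure, forall t : R, t \in `[0, T] ->
         obstacle_set (g t) (phi t)} &
      exists eta : R -> L2,
      [/\ bochner_L2 lebesgue_measure `[0, T] eta,
          {ae lebesgue_measure, forall t : R, t \in `[0, T] ->
             normal_cone (g t) (phi t) (eta t)} &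
          forall t, t \in `[0, T] ->
            phi t +
            bochner_integral lebesgue_measure `[0, t] (fun s => P (t - s) (eta s))
            = P t phi0 +
            bochner_integral lebesgue_measure `[0, t] (fun s => P (t - s) (f s))]].

End Obstacle.

(* Main.v *)
Require Import Defs.
From HB Require Import structures.
From mathcomp Require Import all_boot all_order all_algebra.
From mathcomp Require Import all_classical all_reals all_analysis.
From mathcomp Require Import ring lra measurable_realfun.

Set Implicit Arguments.
Unset Strict Implicit.
Unset Printing Implicit Defensive.

Import Order.TTheory GRing.Theory Num.Theory.
Import numFieldNormedType.Exports.

Local Open Scope classical_set_scope.
Local Open Scope ring_scope.

(* Let Q be the semigroup and let ob be g minus the free evolution, so that ob 0 <= 0. The
   scheme chi_(k+1) = max (Q_tau chi_k) (ob ((k+1) tau)) increases when the step is halved and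
   is bounded, hence converges at dyadic times. Its jumps are bounded by the positive parts of
   g ((k+1) tau) - Q_tau (g (k tau)), whose squares add up to O(tau): on a resolvent J_l g one
   has (v - Q_tau v)^+ <= int_0^tau Q_s (N v)^+ ds, and the bound on (N_l g)^+ survives l -> 0.
   So the densities of the jumps are bounded in L^2, and by Mazur's argument convex
   combinations of them converge strongly to some u >= 0. The averages of the jumps over a cell
   are the averages of chi, so the limit of chi is the evolution driven by u; since the scheme
   touches the obstacle wherever it jumps, and chi converges uniformly, u is orthogonal to the
   distance to the obstacle: - u is the required selection of the normal cone.
   The difference of two mild solutions satisfies the energy inequality
   e^(-2wt) |d t|^2 <= |d 0|^2 + 2 int_0^t e^(-2ws) <d s, h s> ds, obtained by summing over a
   mesh because d is not differentiable; with the monotonicity of the normal cone it gives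
   uniqueness and Lipschitz dependence. *)

(** * Hilbert lattices *)

(** The jump densities get strong limits from Mazur's argument, and the scheme gets norm limits from
    order: on the positive cone an increasing sequence satisfies |u_n - u_m|^2 <= |u_n|^2 - |u_m|^2,
    so a bound on the norms suffices. This is why the free evolution is subtracted: the scheme then
    starts at 0 and stays in the cone. The price is an obstacle less regular in time, but its jumps
    change only by an integral of f over one cell, whose square is at most a multiple of tau times
    the integral of |f|^2 there, so the O(tau) sum persists. In the estimate for g no limit l -> 0
    is taken: for each mesh, l is chosen so small that the resolvent moves g at the finitely many
    nodes by at most tau, and the resulting constant does not depend on that choice. Vector
    integrals are reached only through their pairings with fixed vectors, which are scalar
    integrals; identities and bounds for them follow by duality. *)

(* The lattice axioms are those of an ordered Hilbert space whose positive part is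
   the projection onto a self-dual cone, with its minimality added. Completeness is
   an axiom because LspaceType2 carries no completeNormedModType structure. *)
Record hilbert_lattice (R : realType) (V : normedModType R) := HilbertLattice {
  dot : V -> V -> R;
  dotC : forall u v, dot u v = dot v u;
  dotDl : forall u v w, dot (u + v) w = dot u w + dot v w;
  dotZl : forall a u v, dot (a *: u) v = a * dot u v;
  dot_norm : forall u, dot u u = `|u| ^+ 2;
  hilbert_complete : forall u : nat -> V,
    (forall e : R, 0 < e -> exists n0, forall m n, (n0 <= m)%N -> (n0 <= n)%N ->
       `|u m - u n| <= e) -> exists l : V, u @ \oo --> l;
  ge0 : V -> Prop;
  ge0_0 : ge0 0;
  ge0D : forall u v, ge0 u -> ge0 v -> ge0 (u + v);
  ge0Z : forall a u, 0 <= a -> ge0 u -> ge0 (a *: u);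
  dot_ge0 : forall u v, ge0 u -> ge0 v -> 0 <= dot u v;
  pos : V -> V;
  pos_ge0 : forall u, ge0 (pos u);
  posB_ge0 : forall u, ge0 (pos u - u);
  dot_pos : forall u, dot (pos u) (pos u - u) = 0;
  pos_min : forall u w, ge0 w -> ge0 (w - u) -> ge0 (w - pos u) }.

Section hilbert_lattice_theory.
Context (R : realType) (V : normedModType R) (L : hilbert_lattice V).
Implicit Types (u v w : V) (a : R).
Local Notation dot := (dot L).
Local Notation ge0 := (ge0 L).
Local Notation pos := (pos L).

Lemma dotNl u v : dot (- u) v = - dot u v.
Proof. by rewrite -scaleN1r dotZl mulN1r. Qed.

Lemma dotBl u v w : dot (u - v) w = dot u w - dot v w.
Proof. by rewrite dotDl dotNl. Qed.

Lemma dotDr u v w : dot u (v + w) = dot u v + dot u w.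
Proof. by rewrite dotC dotDl !(dotC L _ u). Qed.

Lemma dotZr a u v : dot u (a *: v) = a * dot u v.
Proof. by rewrite dotC dotZl (dotC L _ u). Qed.

Lemma dotNr u v : dot u (- v) = - dot u v.
Proof. by rewrite dotC dotNl (dotC L _ u). Qed.

Lemma dotBr u v w : dot u (v - w) = dot u v - dot u w.
Proof. by rewrite dotDr dotNr. Qed.

Lemma dot0l u : dot 0 u = 0.
Proof. by rewrite -(scale0r 0) dotZl mul0r. Qed.

Lemma dot0r u : dot u 0 = 0.
Proof. by rewrite dotC dot0l. Qed.

Lemma normD2 u v : `|u + v| ^+ 2 = `|u| ^+ 2 + 2 * dot u v + `|v| ^+ 2.
Proof. by rewrite -!(dot_norm L) dotDl !dotDr (dotC L v u); ring. Qed.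

Lemma normB2 u v : `|u - v| ^+ 2 = `|u| ^+ 2 - 2 * dot u v + `|v| ^+ 2.
Proof. by rewrite normD2 dotNr normrN; ring. Qed.

Lemma cauchy_schwarz u v : dot u v <= `|u| * `|v|.
Proof.
have [->|u0] := eqVneq u 0; first by rewrite dot0l normr0 mul0r.
have [->|v0] := eqVneq v 0; first by rewrite dot0r normr0 mulr0.
have pu : 0 < `|u| by rewrite normr_gt0.
have pv : 0 < `|v| by rewrite normr_gt0.
have := sqr_ge0 `|(`|v| *: u - `|u| *: v)|.
rewrite normB2 dotZl dotZr !normrZ !normr_id.
set x := dot u v => h.
have h2 : 0 <= (2 * (`|u| * `|v|)) * (`|u| * `|v| - x) by nra.
by move: h2; rewrite pmulr_rge0 ?subr_ge0 // mulr_gt0 // mulr_gt0.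
Qed.

Lemma dot_le_norm u v : `|dot u v| <= `|u| * `|v|.
Proof.
rewrite ler_norml cauchy_schwarz andbT lerNl -dotNl.
by apply: le_trans (cauchy_schwarz _ _) _; rewrite normrN.
Qed.

Lemma dot_continuous u : continuous (dot u : V -> R).
Proof.
move=> v; apply/cvgrPdist_lt => e e0; near=> w.
rewrite -dotBr; apply: le_lt_trans (dot_le_norm _ _) _.
have u1 : 0 < `|u| + 1 by rewrite ltr_wpDl.
apply: (@le_lt_trans _ _ ((`|u| + 1) * `|v - w|)).
  by rewrite ler_wpM2r // lerDl.
rewrite mulrC -ltr_pdivlMr //; near: w.
by apply: cvgr_dist_lt => //; rewrite divr_gt0.
Unshelve. all: by end_near. Qed.

(** Reduces identities between vectors to scalar ones, which [ring] closes, and identities between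
    vector integrals to identities between scalar integrals. *)
Lemma dot_inj u v : (forall w, dot w u = dot w v) -> u = v.
Proof.
move=> h; apply/eqP; rewrite -subr_eq0 -normr_eq0 -sqrf_eq0 -(dot_norm L).
by rewrite dotBr h subrr.
Qed.

Lemma norm_le_dot u a : 0 <= a -> (forall w, dot w u <= `|w| * a) -> `|u| <= a.
Proof.
move=> a0 /(_ u); rewrite dot_norm expr2.
have [->|u0] := eqVneq u 0; first by rewrite normr0.
by rewrite ler_pM2l // normr_gt0.
Qed.

(** Self-duality of the cone. The negative part n = pos u - u is orthogonal to [pos u], so dot n u =
    - |n|^2; testing against n forces n = 0. *)
Lemma ge0P u : (forall w, ge0 w -> 0 <= dot w u) -> ge0 u.
Proof.
move=> /(_ _ (posB_ge0 L u)).
have := dot_pos L u.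
set n := pos u - u => pn.
have -> : dot n u = - `|n| ^+ 2.
  have -> : u = pos u - n by rewrite /n opprB addrC subrK.
  by rewrite dotBr (dotC L n) pn dot_norm sub0r.
rewrite oppr_ge0 => h; have n0 : n = 0.
  by apply/eqP; rewrite -normr_eq0 -sqrf_eq0 eq_le h sqr_ge0.
have <- : pos u = u by apply/eqP; rewrite -subr_eq0 -/n n0.
exact: pos_ge0.
Qed.

(** Self-duality writes the cone as an intersection of closed half-spaces. *)
Lemma ge0_cvg (u : nat -> V) v : (forall n, ge0 (u n)) -> u @ \oo --> v -> ge0 v.
Proof.
move=> u0 uv; apply: ge0P => w w0.
have : dot w (u n) @[n --> \oo] --> dot w v.
  by apply: (cvg_comp _ _ uv); exact: dot_continuous.
move=> h; rewrite -(cvg_lim _ h) //; apply: limr_ge; first by apply/cvg_ex; exists (dot w v).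
by apply: nearW => n; exact: dot_ge0.
Qed.

(** Orthogonality gives |pos u|^2 = dot (pos u) u, and w - u in the cone bounds this by dot (pos u)
    w. *)
Lemma norm_pos_le u w : ge0 w -> ge0 (w - u) -> `|pos u| <= `|w|.
Proof.
move=> w0 wu.
have [->|u0] := eqVneq (pos u) 0; first by rewrite normr0.
have pu : 0 < `|pos u| by rewrite normr_gt0.
rewrite -(ler_pM2l pu); apply: le_trans (cauchy_schwarz _ _).
rewrite -expr2 -(dot_norm L).
have := dot_pos L u; rewrite dotBr => /eqP; rewrite subr_eq0 => /eqP ->.
by rewrite -subr_ge0 -dotBr; apply: dot_ge0 => //; exact: pos_ge0.
Qed.

Lemma ge0_norm_le u v : ge0 u -> ge0 (v - u) -> `|u| <= `|v|.
Proof.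
move=> u0 uv.
have v0 : ge0 v by rewrite -(subrK u v); exact: ge0D.
have h := dot_ge0 u0 uv; rewrite dotBr dot_norm subr_ge0 in h.
have [->|un0] := eqVneq u 0; first by rewrite normr0.
rewrite -(@ler_pM2l _ `|u|) ?normr_gt0 // -expr2.
exact: le_trans h (cauchy_schwarz _ _).
Qed.

Lemma posD_ge0 u v : ge0 (pos u + pos v - pos (u + v)).
Proof.
apply: pos_min; first by apply: ge0D; exact: pos_ge0.
by rewrite opprD addrACA; apply: ge0D; exact: posB_ge0.
Qed.

Lemma norm_pos_self u : `|pos u| <= `|u|.
Proof.
have [->|u0] := eqVneq (pos u) 0; first by rewrite normr0.
have pu : 0 < `|pos u| by rewrite normr_gt0.
rewrite -(ler_pM2l pu); apply: le_trans (cauchy_schwarz _ _).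
rewrite -expr2 -(dot_norm L).
by have := dot_pos L u; rewrite dotBr => /eqP; rewrite subr_eq0 => /eqP ->.
Qed.

Lemma norm_posD u v : `|pos (u + v)| <= `|pos u| + `|v|.
Proof.
apply: le_trans (ge0_norm_le (pos_ge0 _ _) (posD_ge0 u v)) _.
by apply: le_trans (ler_normD _ _) _; rewrite lerD2l norm_pos_self.
Qed.

Lemma ge0_sum n (F : nat -> V) : (forall k, (k < n)%N -> ge0 (F k)) ->
  ge0 (\sum_(k < n) F k).
Proof.
elim: n => [|n IH] h; first by rewrite big_ord0; exact: ge0_0.
by rewrite big_ord_recr /=; apply: ge0D; [apply: IH => k kn; apply: h; exact: ltnW|exact: h].
Qed.

(** For 0 <= a <= b one has dot a (b - a) >= 0, hence |b - a|^2 <= |b|^2 - |a|^2. The squared norms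
    increase and are bounded, so the sequence is Cauchy. *)
Lemma ge0_incr_cvg (u : nat -> V) (B : R) :
  (forall n, ge0 (u n)) -> (forall n, ge0 (u n.+1 - u n)) ->
  (forall n, `|u n| <= B) -> exists l : V, u @ \oo --> l.
Proof.
move=> u0 uS uB.
have umn m n : (m <= n)%N -> ge0 (u n - u m).
  elim: n => [|n IH]; first by rewrite leqn0 => /eqP ->; rewrite subrr; exact: ge0_0.
  rewrite leq_eqVlt => /orP[/eqP ->|mn]; first by rewrite subrr; exact: ge0_0.
  by rewrite -(subrKA (u n)); apply: ge0D => //; exact: IH.
pose s : R^nat := fun n => `|u n| ^+ 2.
have sle m n : (m <= n)%N -> `|u n - u m| ^+ 2 <= s n - s m.
  move=> mn; rewrite normB2 /s.
  by have := dot_ge0 (umn _ _ mn) (u0 m); rewrite dotBl dot_norm; lra.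
have snd : nondecreasing_seq s.
  by move=> m n mn; rewrite -subr_ge0; apply: le_trans (sle _ _ mn); exact: sqr_ge0.
have /cvg_ex[/= l sl] : cvgn s.
  apply: nondecreasing_is_cvgn => //; exists (B ^+ 2) => _ [n _ <-].
  by rewrite /s lerXn2r // ?nnegrE //; exact: le_trans (uB n).
apply: (hilbert_complete L) => e e0.
have e2 : 0 < e ^+ 2 / 2 by rewrite divr_gt0 // exprn_gt0.
have [n0 _ hn] : \forall n \near \oo, `|l - s n| < e ^+ 2 / 2.
  by move/cvgrPdist_lt: sl; exact.
exists n0 => m n.
wlog mn : m n / (m <= n)%N.
  move=> H hm hn'; have [/ltnW mn|nm] := ltnP m n; first exact: H.
  by rewrite distrC; apply: H.
move=> nm nn; rewrite distrC.
have := sle _ _ mn; have := hn _ nm; have := hn _ nn.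
rewrite /= !ltr_norml => /andP[h1 h2] /andP[h3 h4] h5.
rewrite -(@ler_pXn2r _ 2) ?nnegrE // ?(ltW e0) //.
by move: h1 h2 h3 h4 h5; set a := `| _ | ^+ 2; set b := e ^+ 2; lra.
Qed.

End hilbert_lattice_theory.

(** * Lower integrals and completeness of L2 *)

Section lower_integral.
Context d (X : measurableType d) (R : realType) (mu : {measure set X -> \bar R}).
Variables (D : set X) (mD : measurable D).
Implicit Types f g : X -> \bar R.
Local Open Scope ereal_scope.

(** The integral of a nonnegative function is a supremum over the simple functions below it, so
    monotonicity requires no measurability. *)
Lemma ge0_le_integral_any f g : (forall x, D x -> 0 <= f x) ->
  (forall x, D x -> f x <= g x) ->
  \int[mu]_(x in D) f x <= \int[mu]_(x in D) g x.
Proof.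
move=> f0 fg; have g0 x : D x -> 0 <= g x by move=> Dx; exact: le_trans (f0 _ Dx) (fg _ Dx).
rewrite !ge0_integralE //; apply: ereal_sup_le => _ [h /= hf <-].
exists h => // x; apply: le_trans (hf x) _.
by rewrite /patch; case: ifP => // /[!inE]; exact: fg.
Qed.

(* f need not be measurable: mu is not assumed complete *)
Lemma ge0_ae_eq_integral_any f g : measurable_fun D g ->
  (forall x, D x -> 0 <= f x) -> (forall x, D x -> 0 <= g x) ->
  {ae mu, forall x, D x -> f x = g x} ->
  \int[mu]_(x in D) f x = \int[mu]_(x in D) g x.
Proof.
move=> mg f0 g0 [N [mN N0 hN]].
have fgN x : D x -> ~ N x -> f x = g x.
  by move=> Dx nN; apply: contrapT => h; apply: nN; apply: hN => /= /(_ Dx).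
have aeN (k : X -> \bar R) : (forall x, ~ N x -> k x = g x) -> ae_eq mu D k g.
  move=> kg; exists N; split => // x /= h; apply: contrapT => nN.
  by apply: h => _; exact: kg.
have i0 x : 0 <= (cst +oo \_ N) x :> \bar R by rewrite /patch; case: ifP => // _; exact: leey.
apply/eqP; rewrite eq_le; apply/andP; split.
  (* Giving [g] the value +oo on the null set yields a measurable majorant of [f]; further down, the
     value 0 there yields a measurable minorant. *)
  pose h x := (cst +oo \_ N) x + g x.
  rewrite -(@ge0_ae_eq_integral _ _ _ mu _ h g) //.
  - apply: ge0_le_integral_any => // x Dx; rewrite /h /patch; case: ifPn => [_|].
      by rewrite addye ?leey // gt_eqF // (lt_le_trans _ (g0 _ Dx)) ?ltNy0.
    by rewrite notin_setE add0e => nN; rewrite fgN.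
  - apply: emeasurable_funD => //; apply/measurable_restrict => //.
  - by move=> x Dx; rewrite adde_ge0 // g0.
  - by apply: aeN => x nN; rewrite /h /patch memNset // add0e.
pose k := g \_ (~` N).
rewrite -(@ge0_ae_eq_integral _ _ _ mu _ k g) //.
- apply: ge0_le_integral_any => x Dx; rewrite /k /patch; case: ifPn.
  + by move=> _; exact: g0.
  + by [].
  + by rewrite inE => nN; rewrite fgN.
  + by move=> _; exact: f0.
- apply/measurable_restrict => //; first exact: measurableC.
  apply: measurable_funS mg => //; exact: subIsetl.
- by move=> x Dx; rewrite /k /patch; case: ifP => // _; exact: g0.
- by apply: aeN => x nN; rewrite /k /patch mem_set.
Qed.

End lower_integral.

Section fast_cauchy.
Context (R : realType) (V : normedModType R).

(** The completeness axiom of [hilbert_lattice] on its own, so that it can be used for the real line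
    and for L2 before its lattice is built. *)
Definition complete_seq := forall u : nat -> V,
  (forall e : R, 0 < e -> exists n0, forall m n, (n0 <= m)%N -> (n0 <= n)%N ->
       `|u m - u n| <= e) -> exists l : V, u @ \oo --> l.

Lemma half_pow_small (e : R) : 0 < e -> exists n0, forall n, (n0 <= n)%N -> 2^-1 ^+ n <= e.
Proof.
move=> e0; have : (2^-1 ^+ n : R) @[n --> \oo] --> 0.
  by apply: cvg_expr; rewrite ger0_norm ?invr_ge0 // invf_lt1 // ltr1n.
move=> /cvgrPdist_le /(_ _ e0) [n0 _ h]; exists n0 => n nn0.
by have := h n nn0; rewrite sub0r normrN ger0_norm // exprn_ge0 // invr_ge0.
Qed.

Lemma fast_dist (u : nat -> V) (c : R) : (forall n, `|u n.+1 - u n| <= c * 2^-1 ^+ n) ->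
  forall m n, (n <= m)%N -> `|u m - u n| <= 2 * c * 2^-1 ^+ n.
Proof.
move=> h m n nm; have c0 : 0 <= c.
  by have := le_trans (normr_ge0 _) (h 0%N); rewrite expr0 mulr1.
suff H : `|u m - u n| <= 2 * c * 2^-1 ^+ n - 2 * c * 2^-1 ^+ m.
  by apply: le_trans H _; rewrite gerBl mulr_ge0 ?mulr_ge0 ?exprn_ge0 ?invr_ge0.
rewrite -(subnK nm); elim: (m - n)%N => [|k IH]; first by rewrite add0n !subrr normr0.
rewrite addSn; rewrite -(subrKA (u (k + n)%N)); apply: le_trans (ler_normD _ _) _.
apply: le_trans (lerD (h _) IH) _; rewrite exprSr; set a := 2^-1 ^+ (k + n).
have -> : 2 * c * (a * 2^-1) = c * a by field.
lra.
Qed.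

Lemma fast_cauchy_cvg (u : nat -> V) (c : R) : complete_seq ->
  (forall n, `|u n.+1 - u n| <= c * 2^-1 ^+ n) -> exists l : V, u @ \oo --> l.
Proof.
move=> cpl h; apply: cpl => e e0; have c0 : 0 <= c.
  by have := le_trans (normr_ge0 _) (h 0%N); rewrite expr0 mulr1.
have e1 : 0 < e / (2 * c + 1) by rewrite divr_gt0 // ltr_wpDl // mulr_ge0.
have [n0 hn] := half_pow_small e1; exists n0.
suff H m n : (n0 <= n)%N -> (n <= m)%N -> `|u m - u n| <= e.
  move=> m n hm hn'; have [mn|/ltnW mn] := leqP n m; first exact: H.
  by rewrite distrC; exact: H.
move=> nn nm; apply: le_trans (fast_dist h nm) _.
apply: (@le_trans _ _ ((2 * c + 1) * 2^-1 ^+ n)).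
  by rewrite ler_wpM2r ?exprn_ge0 ?invr_ge0 // lerDl.
rewrite mulrC -ler_pdivlMr; first exact: hn.
by rewrite ltr_wpDl // mulr_ge0.
Qed.

End fast_cauchy.

(** * Almost everywhere convergence of fast Cauchy sequences in L^2 *)

Section riesz_fischer.
Context d (X : measurableType d) (R : realType) (mu : {measure set X -> \bar R}).
Variables (D : set X) (mD : measurable D) (V : normedModType R).
Variables (cpl : complete_seq V) (y : nat -> X -> V).
Hypothesis my : forall m n, measurable_fun D (fun x => `|y m x - y n x|).

(** With the weights 4^n the squared increments have integrals at most 2^-n, so their sum is finite
    off a null set; there each increment is at most a constant times 2^-n. The indicator makes the
    limit exist at every point. *)
Lemma fast_L2_cvg :
  (forall n, (\int[mu]_(x in D) (`|y n.+1 x - y n x| ^+ 2)%:E <= (8^-1 ^+ n)%:E)%E) ->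
  exists N, [/\ measurable N, mu N = 0%E &
   exists z : X -> V, forall x, \1_(D `\` N) x *: y n x @[n --> \oo] --> z x].
Proof.
move=> fst.
pose f n x := ((4 ^+ n * `|y n.+1 x - y n x| ^+ 2)%:E : \bar R).
pose g x := (\sum_(0 <= n <oo) f n x)%E.
have f0 n x : (0 <= f n x)%E by rewrite lee_fin mulr_ge0 // exprn_ge0.
have mf n : measurable_fun D (f n).
  apply/measurable_EFinP; apply: measurable_funM => //.
  exact: measurable_funX.
have ig : mu.-integrable D g.
  apply/integrableP; split.
    by apply: ge0_emeasurable_sum => // k x Dx; exact: mf.
  rewrite (eq_integral g); last first.
    by move=> x _; rewrite gee0_abs // /g nneseries_ge0.
  rewrite integral_nneseries //.
  have fin n : (\int[mu]_(x in D) f n x <= (1 / (2 ^ (n + 0.+1))%:R *+ 2)%:E)%E.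
    have -> : (\int[mu]_(x in D) f n x =
        (4 ^+ n)%:E * \int[mu]_(x in D) (`|y n.+1 x - y n x| ^+ 2)%:E)%E.
      have q0 x : D x -> (0 <= (`|y n.+1 x - y n x| ^+ 2)%:E :> \bar R)%E.
        by rewrite lee_fin exprn_ge0.
      have p0 : (0 <= (4 ^+ n)%:E :> \bar R)%E by rewrite lee_fin exprn_ge0.
      have mq : measurable_fun D (fun x => (`|y n.+1 x - y n x| ^+ 2)%:E).
        by apply/measurable_EFinP; exact: measurable_funX.
      by rewrite -(ge0_integralZl mu mD mq q0 p0).
    apply: le_trans (lee_wpmul2l _ (fst n)) _; first by rewrite lee_fin exprn_ge0.
    rewrite -EFinM lee_fin natrX addn1 exprS -exprMn.
    have -> : (4 * 8^-1 : R) = 2^-1 by field.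
    have q0 : (2 ^+ n : R) != 0 by rewrite expf_neq0.
    rewrite exprVn; set q := 2 ^+ n in q0 *.
    by have -> : 1 / (2 * q) *+ 2 = q^-1 by field.
  apply: (@le_lt_trans _ _ (\sum_(0 <= n <oo) (2 / (2 ^ (n + 0.+1))%:R)%:E)%E).
    apply: lee_nneseries => [n _ _|n _]; first exact: integral_ge0.
    by apply: le_trans (fin n) _; rewrite lee_fin -mulr_natl mulrA mulr1.
  have := @cvg_geometric_eseries_half R 2 0.
  by move=> /cvg_lim -> //; rewrite ltry.
have [N [mN N0 hN]] := integrable_ae mD ig.
exists N; split => //.
have cv x : exists l : V, \1_(D `\` N) x *: y n x @[n --> \oo] --> l.
  have [|nx] := boolP (x \in D `\` N); last first.
    exists 0; under eq_fun do rewrite indicE (negbTE nx) scale0r; exact: cvg_cst.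
  move=> xD; have e n : \1_(D `\` N) x *: y n x = y n x.
    by rewrite indicE xD; exact: scale1r.
  suff [l yl] : exists l : V, y ^~ x @ \oo --> l by exists l; under eq_fun do rewrite e.
  clear e.
  move: xD; rewrite inE => -[Dx nN].
  have gf : g x \is a fin_num.
    by apply: contrapT => h; apply: nN; apply: hN => /= /(_ Dx).
  have g0 : (0 <= g x)%E by exact: nneseries_ge0.
  set c := fine (g x); have c0 : 0 <= c by exact: fine_ge0.
  apply: (@fast_cauchy_cvg _ _ _ (c + 1)) => // n.
  have : (f n x <= g x)%E.
    rewrite /g (@nneseriesD1 _ _ n) //; first by rewrite leeDl // nneseries_ge0.
  rewrite -(fineK gf) lee_fin -/c => h.
  rewrite -(@ler_pXn2r _ 2) ?nnegrE //; last first.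
    by rewrite mulr_ge0 ?exprn_ge0 ?invr_ge0 // addr_ge0.
  rewrite exprMn -exprM mulnC exprM.
  have -> : (2^-1 ^+ 2 : R) = 4^-1 by field.
  have p0 : 0 < (4 ^+ n : R) by rewrite exprn_gt0.
  rewrite exprVn ler_pdivlMr // mulrC; apply: le_trans h _; nra.
have [z zP] := choice cv.
by exists z.
Qed.

Lemma fatou_L2 (z : X -> V) (c : R) n :
  (forall x, D x -> y m x @[m --> \oo] --> z x) ->
  (forall m, (n <= m)%N -> (\int[mu]_(x in D) (`|y m x - y n x| ^+ 2)%:E <= c%:E)%E) ->
  (\int[mu]_(x in D) (`|z x - y n x| ^+ 2)%:E <= c%:E)%E.
Proof.
move=> yz h.
pose f m x := ((`|y (m + n)%N x - y n x| ^+ 2)%:E : \bar R).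
have fz x : D x -> f m x @[m --> \oo] --> ((`|z x - y n x| ^+ 2)%:E : \bar R).
  move=> Dx; apply: cvg_EFin; first by near=> m.
  have c1 : `|y (m + n)%N x - y n x| @[m --> \oo] --> `|z x - y n x|.
    apply: cvg_norm; apply: cvgB; last exact: cvg_cst.
    by rewrite (@cvg_shiftn n V (y ^~ x)); exact: yz.
  exact: (cvg_comp _ _ c1 (@exprn_continuous R 2 _)).
rewrite (@eq_integral _ _ _ _ _ (fun x => limn_einf (f ^~ x))); last first.
  move=> x; rewrite inE => Dx; have := fz _ Dx => c1.
  by rewrite (is_cvg_limn_einfE (cvgP _ c1)) (cvg_lim _ c1).
apply: le_trans (fatou _ _ _ _) _ => //.
- by move=> m; apply/measurable_EFinP; exact: measurable_funX.
- by move=> m x _; rewrite lee_fin exprn_ge0.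
rewrite limn_einf_lim; apply: lime_le; first exact: is_cvg_einfs.
apply: nearW => m; apply: le_trans (h (m + n)%N (leq_addl _ _)).
by apply: ereal_inf_lbound; exists m => /=.
Unshelve. all: by end_near. Qed.

End riesz_fischer.

Section subsequence.
Context (R : realType) (V : normedModType R).

(** The rate 3^-n is tuned to [fast_L2_cvg]: its square 9^-n lies below 8^-n. *)
Lemma complete_seq_fast : (forall u : nat -> V,
    (forall m n, (n <= m)%N -> `|u m - u n| <= 3^-1 ^+ n) -> exists l : V, u @ \oo --> l) ->
  complete_seq V.
Proof.
move=> H u cu.
have t0 n : 0 < (3^-1 ^+ n : R) by rewrite exprn_gt0 // invr_gt0.
have /choice[k hk] : forall n, exists n0, forall m m', (n0 <= m)%N -> (n0 <= m')%N ->
    `|u m - u m'| <= 3^-1 ^+ n by move=> n; exact: cu.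
(* Partial sums of successors are strictly increasing and dominate each [k n]. *)
pose K n := (\sum_(i < n.+1) (k i).+1)%N.
have kK n : (k n <= K n)%N.
  by rewrite /K big_ord_recr /= addnS leqW // leq_addl.
have KS n : (K n < K n.+1)%N by rewrite /K [in ltnRHS]big_ord_recr /= addnS ltnS leq_addr.
have KK m n : (n <= m)%N -> (K n <= K m)%N.
  move=> /subnK <-; elim: (m - n)%N => [|j IH]; first by [].
  by rewrite addSn (leq_trans IH) // ltnW.
have Kn n : (n <= K n)%N.
  by elim: n => [//|n IH]; apply: leq_ltn_trans (KS n).
have [m n nm|l ul] := H (u \o K).
  by apply: hk; rewrite ?kK //; apply: leq_trans (kK _) _; exact: KK.
exists l; apply/cvgrPdist_le => e e0.
have e2 : 0 < e / 2 by rewrite divr_gt0.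
have [n0 hn0] := cu _ e2.
have [n1 _ hn1] : \forall n \near \oo, `|l - u (K n)| <= e / 2.
  by move/cvgrPdist_le: ul; exact.
exists n0 => // n /= nn.
pose j := maxn n1 n0.
rewrite -(subrKA (u (K j))); apply: le_trans (ler_normD _ _) _.
rewrite [leRHS]splitr lerD //; first by apply: hn1; rewrite /= leq_maxl.
by apply: hn0 => //; apply: leq_trans (Kn _); exact: leq_maxr.
Qed.

End subsequence.

(** * The Hilbert lattice L2(mu) *)

Section L2_hilbert_lattice.
Context d (X : measurableType d) (R : realType) (mu : {measure set X -> \bar R}).
Local Notation L2 := (LspaceType2 mu).
Implicit Types u v w : L2.

Definition L2dot u v : R := \int[mu]_x (u x * v x).

Lemma L2_measurable u : measurable_fun setT (u : X -> R).
Proof. exact: measurable_aeEqMfun. Qed.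

Lemma L2_mul_integrable u v : mu.-integrable setT (EFin \o (fun x => u x * v x)).
Proof.
apply/Lfun1_integrable; apply: (@Lfun2_mul_Lfun1 _ _ _ _ u v); exact: Lspace_Lfun.
Qed.

Lemma ae_eq_Rintegral (f g : X -> R) : measurable_fun setT f -> measurable_fun setT g ->
  f = g %[ae mu] -> \int[mu]_x f x = \int[mu]_x g x.
Proof.
move=> mf mg fg; rewrite /Rintegral; congr fine; apply: ae_eq_integral => //.
- exact/measurable_EFinP.
- exact/measurable_EFinP.
- by apply: filterS fg => x /= h _; rewrite h.
Qed.

Lemma L2dotC u v : L2dot u v = L2dot v u.
Proof. by apply: eq_Rintegral => x _; rewrite mulrC. Qed.

Lemma L2dotDl u v w : L2dot (u + v) w = L2dot u w + L2dot v w.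
Proof.
rewrite /L2dot -RintegralD //; try exact: L2_mul_integrable.
apply: ae_eq_Rintegral.
- by apply: measurable_funM; exact: L2_measurable.
- by apply: measurable_funD; apply: measurable_funM; exact: L2_measurable.
- by apply: filterS (Lspace_addE u v) => x /= /(_ I) -> _; rewrite mulrDl.
Qed.

Lemma L2dotZl a u v : L2dot (a *: u) v = a * L2dot u v.
Proof.
rewrite /L2dot -RintegralZl //; last exact: L2_mul_integrable.
apply: ae_eq_Rintegral.
- by apply: measurable_funM; exact: L2_measurable.
- by apply: measurable_funM => //; apply: measurable_funM; exact: L2_measurable.
- by apply: filterS (Lspace_scaleE a u) => x /= /(_ I) -> _; rewrite mulrA.
Qed.

Lemma measurable_sqr_dist (f g : X -> R) : measurable_fun setT f ->
  measurable_fun setT g -> measurable_fun setT (fun x => (`|f x - g x| ^+ 2)%:E).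
Proof.
move=> mf mg; apply/measurable_EFinP; apply: measurable_funX.
by apply: measurableT_comp => //; exact: measurable_funB.
Qed.

Lemma L2_norm_integral u : ((`|u| ^+ 2)%:E = \int[mu]_x (`|u x| ^+ 2)%:E)%E.
Proof.
have -> : `|u| = Lspace_norm u by [].
rewrite -(@powR_mulrn _ _ 2) ?fine_ge0 ?Lnorm_ge0 // -poweR_EFin Lspace_normE.
rewrite poweR_Lnorm //; apply: eq_integral => x _.
have -> : (`|(EFin \o u) x| = (`|u x|)%:E)%E by [].
by rewrite poweR_EFin powR_mulrn.
Qed.

Lemma L2dot_norm u : L2dot u u = `|u| ^+ 2.
Proof.
rewrite /L2dot /Rintegral -[RHS]/(fine (`|u| ^+ 2)%:E) L2_norm_integral.
by congr fine; apply: eq_integral => x _; rewrite real_normK ?num_real // expr2.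
Qed.

Lemma L2_dist_integral u v :
  ((`|u - v| ^+ 2)%:E = \int[mu]_x (`|u x - v x| ^+ 2)%:E)%E.
Proof.
rewrite L2_norm_integral; apply: ae_eq_integral => //.
- apply/measurable_EFinP; apply: measurable_funX; apply: measurableT_comp => //.
  exact: L2_measurable.
- apply/measurable_EFinP; apply: measurable_funX; apply: measurableT_comp => //.
  by apply: measurable_funB; exact: L2_measurable.
- apply: filter_app (Lspace_addE u (- v)); apply: filterS (Lspace_oppE v).
  by move=> x /= /(_ I) h1 /(_ I) h2 _; rewrite h2 h1.
Qed.

Lemma R_complete : complete_seq (GRing.regular R).
Proof.
move=> u hu; have : cauchy (u @ \oo).
  apply/cauchyP => e e0; have e2 : 0 < e / 2 by rewrite divr_gt0.
  have [n0 hn] := hu _ e2; exists (u n0); exists n0 => // n /= nn.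
  rewrite /ball /=; apply: le_lt_trans (hn _ _ _ nn) _ => //.
  by rewrite ltr_pdivrMr // mulr_natr mulr2n ltrDl.
by move=> /cauchy_cvgP /cvg_ex[l ul]; exists l.
Qed.

Lemma L2_complete : complete_seq L2.
Proof.
apply: complete_seq_fast => u hu.
pose y n : X -> R := u n.
have my m n : measurable_fun setT (fun x => `|y m x - y n x|).
  by apply: measurableT_comp => //; apply: measurable_funB; exact: L2_measurable.
have yfast m n : (n <= m)%N ->
    (\int[mu]_x (`|y m x - y n x| ^+ 2)%:E <= (9^-1 ^+ n)%:E)%E.
  move=> nm; rewrite -L2_dist_integral lee_fin.
  have -> : (9^-1 : R) = 3^-1 ^+ 2 by rewrite expr2 -invfM; congr _^-1; ring.
  by rewrite -exprM mulnC exprM lerXn2r ?nnegrE ?exprn_ge0 ?invr_ge0 //; exact: hu.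
have [N [mN N0 [z yz]]] : exists N, [/\ measurable N, mu N = 0%E &
   exists z : X -> R, forall x, \1_(setT `\` N) x *: y n x @[n --> \oo] --> z x].
  apply: (@fast_L2_cvg _ _ _ mu setT measurableT _ R_complete y my) => n.
  apply: le_trans (yfast _ _ (leqnSn n)) _; rewrite lee_fin lerXn2r ?nnegrE ?invr_ge0 //.
  by rewrite lef_pV2 ?posrE // ler_nat.
pose y' n x := \1_(setT `\` N) x * y n x : R.
have my' n : measurable_fun setT (y' n).
  by apply: measurable_funM; [exact: measurable_indic (measurableD _ _)|exact: L2_measurable].
have yy' n : {ae mu, forall x, y' n x = y n x}.
  exists N; split => // x /= h; apply: contrapT => nN; apply: h.
  by rewrite /y' indicE mem_set ?mul1r.
have mz : measurable_fun setT z.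
  by apply: (@measurable_fun_cvg _ _ _ setT y' z) => // x _; exact: yz.
have my'd m n : measurable_fun setT (fun x => `|y' m x - y' n x|).
  by apply: measurableT_comp => //; exact: measurable_funB.
have zd n : (\int[mu]_x (`|z x - y n x| ^+ 2)%:E <= (9^-1 ^+ n)%:E)%E.
  have myn : measurable_fun setT (y n) by exact: L2_measurable.
  have := @fatou_L2 _ _ _ mu setT measurableT (GRing.regular R) y' my'd z (9^-1 ^+ n) n
    (fun x _ => yz x).
  have -> : (\int[mu]_x (`|(z x : GRing.regular R) - y' n x| ^+ 2)%:E =
     \int[mu]_x (`|z x - y n x| ^+ 2)%:E)%E.
    apply: ae_eq_integral => //; try exact: measurable_sqr_dist.
    by apply: filterS (yy' n) => x /= -> _.
  apply => m nm; apply: le_trans (yfast m n nm).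
  have mym : measurable_fun setT (y m) by exact: L2_measurable.
  have -> : (\int[mu]_x (`|(y' m x : GRing.regular R) - y' n x| ^+ 2)%:E =
     \int[mu]_x (`|y m x - y n x| ^+ 2)%:E)%E => //.
  apply: ae_eq_integral => //; try exact: measurable_sqr_dist.
  by apply: filter_app (yy' m); apply: filterS (yy' n) => x /= -> -> _.
have my0 n : measurable_fun setT (y n) by exact: L2_measurable.
(* Fatou bounds only the difference between the pointwise limit and [y 0]; adding the class [u 0]
   back gives the limit in L2. *)
have zmy0 : (fun x => z x - y 0%N x) \in Lfun mu 2%:E.
  apply/andP; split; rewrite inE /=; first exact: measurable_funB.
  rewrite /finite_norm /=; apply/(@lty_poweRy _ _ 2) => //.
  rewrite poweR_Lnorm //; apply: le_lt_trans (ltry (9^-1 ^+ 0)).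
  apply: le_trans (zd 0%N); apply: ge0_le_integral_any => [x _|x _]; first exact: poweR_ge0.
  rewrite [X in (X `^ _)%E](_ : _ = (`|z x - y 0%N x|%R)%:E)%E //.
  by rewrite poweR_EFin powR_mulrn.
pose Z : L2 := Lspace_mk (lee1n 2) zmy0 + u 0%N.
have Zz : (Z : X -> R) = z %[ae mu].
  apply: filter_app (Lspace_addE (Lspace_mk (lee1n 2) zmy0) (u 0%N)).
  apply: filterS (Lspace_mkE (lee1n 2) zmy0) => x /= /(_ I) h /(_ I) + _.
  by rewrite h subrK.
have Zd n : `|Z - u n| <= 3^-1 ^+ n.
  rewrite -(@ler_pXn2r _ 2) ?nnegrE ?exprn_ge0 ?invr_ge0 //.
  rewrite -exprM mulnC exprM.
  have <- : (9^-1 : R) = 3^-1 ^+ 2 by rewrite expr2 -invfM; congr _^-1; ring.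
  rewrite -lee_fin L2_dist_integral; apply: le_trans (zd n).
  have -> : (\int[mu]_x (`|Z x - u n x| ^+ 2)%:E =
     \int[mu]_x (`|z x - y n x| ^+ 2)%:E)%E => //.
  apply: ae_eq_integral => //; try exact: measurable_sqr_dist.
    by apply: measurable_sqr_dist => //; exact: L2_measurable.
  by apply: filterS Zz => x /= h _; rewrite h.
exists Z; apply/cvgrPdist_le => e e0.
have [n0 hn] := half_pow_small e0; exists n0 => // n /= nn.
apply: le_trans (Zd n) _; apply: le_trans (hn _ nn).
by rewrite lerXn2r ?nnegrE ?invr_ge0 // lef_pV2 ?posrE // ler_nat.
Qed.

Definition L2ge0 u : Prop := {ae mu, forall x, 0 <= u x}.

(** [Lle 0 u] compares with the representative of the class 0, which vanishes only almost
    everywhere. *)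
Lemma L2ge0_Lle u : L2ge0 u <-> Lle 0 u.
Proof.
split=> h; apply: filter_app h; apply: filterS (@Lspace_0E _ _ _ mu _ (lee1n 2)) => x.
  by move=> /= /(_ I) ->.
by move=> /= /(_ I) ->.
Qed.

Lemma L2ge0B u v : L2ge0 (v - u) <-> Lle u v.
Proof.
have e : {ae mu, forall x, (v - u) x = v x - u x}.
  apply: filter_app (Lspace_addE v (- u)); apply: filterS (Lspace_oppE u).
  by move=> x /= /(_ I) h1 /(_ I) h2; rewrite h2 h1.
split=> h; apply: filter_app h; apply: filterS e => x ->; by rewrite subr_ge0.
Qed.

Lemma L2ge0_0 : L2ge0 0.
Proof.
by apply: filterS (@Lspace_0E _ _ _ mu _ (lee1n 2)) => x /= /(_ I) ->.
Qed.

Lemma L2ge0D u v : L2ge0 u -> L2ge0 v -> L2ge0 (u + v).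
Proof.
move=> u0 v0; apply: filter_app u0; apply: filter_app v0.
by apply: filterS (Lspace_addE u v) => x /= /(_ I) -> *; exact: addr_ge0.
Qed.

Lemma L2ge0Z a u : 0 <= a -> L2ge0 u -> L2ge0 (a *: u).
Proof.
move=> a0 u0; apply: filter_app u0.
by apply: filterS (Lspace_scaleE a u) => x /= /(_ I) -> *; exact: mulr_ge0.
Qed.

Lemma L2dot_ge0 u v : L2ge0 u -> L2ge0 v -> 0 <= L2dot u v.
Proof.
move=> u0 v0; have -> : L2dot u v = \int[mu]_x `|u x * v x|.
  apply: ae_eq_Rintegral.
  - by apply: measurable_funM; exact: L2_measurable.
  - apply: measurableT_comp => //.
    by apply: measurable_funM; exact: L2_measurable.
  - apply: filter_app u0; apply: filterS v0 => x v0 u0 _.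
    by rewrite ger0_norm // mulr_ge0.
by apply: Rintegral_ge0 => x _.
Qed.

Lemma L2posE u : {ae mu, forall x, Lspace_pos u x = Num.max (u x) 0}.
Proof.
by apply: filterS (@Lspace_mkE _ _ _ mu _ (lee1n 2) _ (Defs.posP_subproof u)) => x /= /(_ I).
Qed.

Lemma L2pos_ge0 u : L2ge0 (Lspace_pos u).
Proof. by apply: filterS (L2posE u) => x ->; rewrite le_max lexx orbT. Qed.

Lemma L2posB_ge0 u : L2ge0 (Lspace_pos u - u).
Proof.
by apply/L2ge0B; apply: filterS (L2posE u) => x ->; rewrite le_max lexx.
Qed.

Lemma L2dot_pos u : L2dot (Lspace_pos u) (Lspace_pos u - u) = 0.
Proof.
have -> : L2dot (Lspace_pos u) (Lspace_pos u - u) = \int[mu]_(x in setT) 0.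
  apply: ae_eq_Rintegral => //.
  - by apply: measurable_funM; exact: L2_measurable.
  - apply: filter_app (L2posE u); apply: filter_app (Lspace_addE (Lspace_pos u) (- u)).
    apply: filterS (Lspace_oppE u) => x /= /(_ I) h1 /(_ I) -> h3 _; rewrite h1 h3.
    by case: (leP (u x) 0) => h; rewrite ?mul0r ?subrr ?mulr0.
by rewrite /Rintegral integral0_eq.
Qed.

Lemma L2pos_min u w : L2ge0 w -> L2ge0 (w - u) -> L2ge0 (w - Lspace_pos u).
Proof.
move=> w0 /L2ge0B uw; apply/L2ge0B.
apply: filter_app w0; apply: filter_app uw; apply: filterS (L2posE u) => x -> h1 h2.
by rewrite ge_max h1 h2.
Qed.

Definition L2_hilbert_lattice : hilbert_lattice L2 :=
  HilbertLattice L2dotC L2dotDl L2dotZl L2dot_norm L2_complete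
    L2ge0_0 L2ge0D L2ge0Z L2dot_ge0 L2pos_ge0 L2posB_ge0 L2dot_pos L2pos_min.

End L2_hilbert_lattice.

(** * Pointwise limits of finitely valued functions *)

Section simple_functions.
Import HBSimple.
Context d (X : measurableType d).

(** The codomain carries no measurable structure: since all fibres are measurable and finitely many,
    composition with an arbitrary map stays in the class. *)
Definition sfun (A : Type) (u : X -> A) : Prop :=
  finite_set (range u) /\ forall y, measurable (u @^-1` [set y]).

Lemma sfun_preimage A (u : X -> A) (B : set A) : sfun u -> measurable (u @^-1` B).
Proof.
move=> [fu mu]; rewrite (_ : _ @^-1` _ = \bigcup_(y in range u `&` B) u @^-1` [set y]).
  by apply: fin_bigcup_measurable => //; exact: finite_setIl.
apply/seteqP; split=> [x Bx|x [y [_ By] /= uy]]; last by rewrite /preimage /= uy.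
by exists (u x) => //; split => //; exists x.
Qed.

Lemma sfun_comp A B (F : A -> B) (u : X -> A) : sfun u -> sfun (F \o u).
Proof.
move=> su; split; last by move=> y; rewrite comp_preimage; exact: sfun_preimage.
have -> : range (F \o u) = F @` range u by rewrite image_comp.
by apply: finite_image; case: su.
Qed.

Lemma sfun_pair A B (u : X -> A) (v : X -> B) : sfun u -> sfun v ->
  sfun (fun x => (u x, v x)).
Proof.
move=> [fu mu] [fv mv]; split.
  apply: sub_finite_set (finite_setX fu fv) => _ [x _ <-].
  by split => /=; exists x.
move=> [a b]; rewrite (_ : _ @^-1` _ = u @^-1` [set a] `&` v @^-1` [set b]).
  exact: measurableI.
by apply/seteqP; split=> x /= [-> ->].
Qed.

Lemma sfun_comp2 A B C (F : A -> B -> C) (u : X -> A) (v : X -> B) :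
  sfun u -> sfun v -> sfun (fun x => F (u x) (v x)).
Proof.
by move=> su sv; have := sfun_comp (fun p => F p.1 p.2) (sfun_pair su sv).
Qed.

Lemma sfun_cst A (a : A) : sfun (fun _ : X => a).
Proof.
split.
  apply: (@sub_finite_set _ _ [set a]); last exact: finite_set1.
  by move=> _ [x _ <-].
move=> y; have [->|ya] := pselect (a = y).
  by rewrite (_ : _ @^-1` _ = setT) //; apply/seteqP; split.
by rewrite (_ : _ @^-1` _ = set0) //; apply/seteqP; split.
Qed.

Lemma sfun_mem (A : set X) : measurable A -> sfun (fun x => x \in A).
Proof.
move=> mA; split; first exact: finite_finset.
case.
  by rewrite (_ : _ @^-1` _ = A) //; apply/seteqP; split=> x /=; [move/set_mem|move/mem_set].
rewrite (_ : _ @^-1` _ = ~` A); first exact: measurableC.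
by apply/seteqP; split=> x /=; [move/negbT; rewrite notin_setE|move=> h; apply/negbTE; rewrite notin_setE].
Qed.

Lemma sfun_if A (b : X -> bool) (u v : X -> A) : sfun b -> sfun u -> sfun v ->
  sfun (fun x => if b x then u x else v x).
Proof.
move=> sb su sv.
exact: (sfun_comp2 (fun c p => if c then p.1 else p.2) sb (sfun_pair su sv)).
Qed.

Context (R : realType).

Lemma sfun_measurable (u : X -> R) : sfun u -> measurable_fun setT u.
Proof. by move=> su _ Y _; rewrite setTI; exact: sfun_preimage. Qed.

(** Strong measurability with convergence at every point. It is stable under continuous operations,
    and the scalar functions obtained from it are measurable even when the measure is not
    complete. *)
Definition good (V : normedModType R) (F : X -> V) : Prop :=
  exists s : nat -> X -> V, (forall n, sfun (s n)) /\
    forall x, s n x @[n --> \oo] --> F x.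

Lemma sfun_good (V : normedModType R) (u : X -> V) : sfun u -> good u.
Proof. by move=> su; exists (fun _ => u); split => // x; exact: cvg_cst. Qed.

Lemma good_comp2 (A B C : normedModType R) (K : A -> B -> C) F G :
  (forall x, {for (F x, G x), continuous (fun p : A * B => K p.1 p.2)}) ->
  good F -> good G -> good (fun x => K (F x) (G x)).
Proof.
move=> cK [s [ss sF]] [t [st tG]]; exists (fun n x => K (s n x) (t n x)).
by split=> [n|x]; [exact: sfun_comp2|apply: continuous2_cvg (sF x) (tG x); exact: cK].
Qed.

Lemma good_comp (A B : normedModType R) (K : A -> B) F :
  continuous K -> good F -> good (fun x => K (F x)).
Proof.
move=> cK [s [ss sF]]; exists (fun n x => K (s n x)).
by split=> [n|x]; [exact: sfun_comp|apply: (cvg_comp _ _ (sF x)); exact: cK].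
Qed.

Lemma good_measurable (u : X -> GRing.regular R) : good u -> measurable_fun setT (u : X -> R).
Proof.
move=> [s [ss su]]; apply: (@measurable_fun_cvg _ _ _ setT s) => // n.
exact: sfun_measurable.
Qed.

Lemma measurable_good (u : X -> R) : measurable_fun setT u -> good (u : X -> GRing.regular R).
Proof.
move=> mu; have mEu : measurable_fun setT (EFin \o u) by exact/measurable_EFinP.
have [g gu] := approximation_sfun measurableT mEu.
exists (fun n x => g n x); split=> [n|x].
  split; first exact: fimfunP.
  by move=> y; rewrite -[X in measurable X]setTI; exact: (measurable_funP (g n)).
by have /fine_cvgP[_] := gu x I.
Qed.

Section good_normed.
Variable V : normedModType R.
Implicit Types F G : X -> V.

Lemma good_norm F : good F -> measurable_fun setT (fun x => `|F x|).
Proof.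
move=> gF; apply: good_measurable; apply: (good_comp (K := fun v : V => `|v| : GRing.regular R)) => //.
exact: norm_continuous.
Qed.

Lemma goodD F G : good F -> good G -> good (fun x => F x + G x).
Proof.
apply: (@good_comp2 V V V +%R) => x; exact: add_continuous.
Qed.

Lemma goodZ (h : X -> R) F : measurable_fun setT h -> good F -> good (fun x => h x *: F x).
Proof.
move=> /measurable_good gh gF.
by apply: (@good_comp2 (GRing.regular R) V V (fun a v => a *: v)) gh gF => x; exact: scale_continuous.
Qed.

Lemma good_cst (v : V) : good (fun _ => v).
Proof. exact/sfun_good/sfun_cst. Qed.

Lemma goodN F : good F -> good (fun x => - F x).
Proof. by apply: good_comp; exact: opp_continuous. Qed.

Lemma goodB F G : good F -> good G -> good (fun x => F x - G x).
Proof. by move=> gF gG; apply: goodD gF (goodN gG). Qed.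

Lemma good_dot (L : hilbert_lattice V) F G : good F -> good G ->
  measurable_fun setT (fun x => dot L (F x) (G x)).
Proof.
move=> gF gG.
(* Polarisation reduces the pairing to norms, whose measurability is [good_norm]. *)
have -> : (fun x => dot L (F x) (G x)) =
    (fun x => 2^-1 * (`|F x + G x| ^+ 2 - `|F x| ^+ 2 - `|G x| ^+ 2)).
  by apply/funext => x; rewrite (normD2 L); field.
have gFG := goodD gF gG.
apply: measurable_funM => //; apply: measurable_funB; first apply: measurable_funB.
- by apply: measurable_funX; exact: good_norm gFG.
- by apply: measurable_funX; exact: good_norm.
- by apply: measurable_funX; exact: good_norm.
Qed.

End good_normed.
End simple_functions.

(** * Bochner integrals *)

Section bochner.
Context d (X : measurableType d) (R : realType) (mu : {measure set X -> \bar R}).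
Variables (D : set X) (mD : measurable D) (finD : (mu D < +oo)%E).
Variables (V : normedModType R) (L : hilbert_lattice V).
Local Notation dot := (dot L).

(** Bounded linear forms. Besides [dot w] they include [dot w] composed with a semigroup operator,
    which is how operators are moved under the integral. *)
Definition lin_form (l : V -> R) := (forall a u v, l (a *: u + v) = a * l u + l v) /\
  exists C, forall u, `|l u| <= C * `|u|.

Lemma lin_form_dot w : lin_form (dot w).
Proof.
split; first by move=> a u v; rewrite dotDr dotZr.
by exists `|w| => u; exact: dot_le_norm.
Qed.

Lemma lin_formD l u v : lin_form l -> l (u + v) = l u + l v.
Proof. by move=> [ll _]; rewrite -[u]scale1r ll mul1r scale1r. Qed.

Lemma lin_form0 l : lin_form l -> l 0 = 0.
Proof. by move=> hl; apply: (addrI (l 0)); rewrite -lin_formD // !addr0. Qed.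

Lemma lin_formZ l a u : lin_form l -> l (a *: u) = a * l u.
Proof. by move=> hl; rewrite -[a *: u]addr0; case: (hl) => -> _; rewrite lin_form0 // addr0. Qed.

Lemma lin_formB l u v : lin_form l -> l (u - v) = l u - l v.
Proof. by move=> hl; rewrite -scaleN1r lin_formD // lin_formZ // mulN1r. Qed.

Lemma lin_form_continuous l : lin_form l -> continuous (l : V -> GRing.regular R).
Proof.
move=> hl; have [_ [C lC]] := hl; move=> v; apply/cvgrPdist_lt => e e0; near=> w.
rewrite -lin_formB //.
apply: le_lt_trans (lC _) _.
have C1 : 0 < `|C| + 1 by rewrite ltr_wpDl.
apply: (@le_lt_trans _ _ ((`|C| + 1) * `|v - w|)).
  by rewrite ler_wpM2r // (le_trans (ler_norm C)) // lerDl.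
rewrite mulrC -ltr_pdivlMr //; near: w.
by apply: cvgr_dist_lt => //; rewrite divr_gt0.
Unshelve. all: by end_near. Qed.

Lemma lin_form_sum l (I : Type) (r : seq I) (F : I -> V) : lin_form l ->
  l (\sum_(i <- r) F i) = \sum_(i <- r) l (F i).
Proof.
move=> hl; apply: (big_morph l (id1 := 0) (op1 := +%R)); last exact: lin_form0.
by move=> u v; exact: lin_formD.
Qed.

Lemma integrable_bound (f g : X -> R) : measurable_fun D f ->
  mu.-integrable D (EFin \o g) -> (forall x, D x -> `|f x| <= g x) ->
  mu.-integrable D (EFin \o f).
Proof.
move=> mf ig fg; apply: (le_integrable mD _ _ ig); first exact/measurable_EFinP.
by move=> x Dx; rewrite /= lee_fin; apply: le_trans (fg _ Dx) (ler_norm _).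
Qed.

Lemma integrable_normr (f : X -> R) : mu.-integrable D (EFin \o f) ->
  mu.-integrable D (EFin \o (fun x => `|f x|)).
Proof.
move=> fi; apply: (le_integrable mD _ _ fi); last by move=> x _; rewrite /= normr_id.
apply/measurable_EFinP; apply: measurableT_comp => //.
by apply/measurable_EFinP; case/integrableP: fi.
Qed.

Lemma integrable_const (c : R) : mu.-integrable D (EFin \o (fun _ => c)).
Proof.
apply/integrableP; split; first exact/measurable_EFinP.
by rewrite /= (integral_cst mu mD `|c|%:E) lte_mul_pinfty // lee_fin.
Qed.

Lemma Rintegral_sum_seq (I : Type) (r : seq I) (F : I -> X -> R) :
  (forall i, mu.-integrable D (EFin \o F i)) ->
  mu.-integrable D (EFin \o (fun x => \sum_(i <- r) F i x)) /\
  \int[mu]_(x in D) (\sum_(i <- r) F i x) = \sum_(i <- r) \int[mu]_(x in D) F i x.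
Proof.
move=> iF; elim: r => [|i r [IH1 IH2]].
  rewrite big_nil (_ : (fun x => _) = (fun _ => 0)); last first.
    by apply/funext => x; rewrite big_nil.
  by split; [exact: integrable_const|rewrite /Rintegral integral0_eq].
rewrite (_ : (fun x => _) = (fun x => F i x + \sum_(j <- r) F j x)); last first.
  by apply/funext => x; rewrite big_cons.
split; first exact: (integrableD mD (iF i) IH1).
by rewrite RintegralD // big_cons IH2.
Qed.

Lemma simple_integral_form l (s : {fimfun X >-> V}) : is_simple mu D s -> lin_form l ->
  l (simple_integral mu D s) = \int[mu]_(x in D) l (s x).
Proof.
move=> ss hl; have fr := fimfunP s.
set r := finmap.enum_fset (fset_set (range s)).
pose E y := D `&` s @^-1` [set y].
have mE y : measurable (E y) by have [] := ss y.
have i1 y : mu.-integrable D (EFin \o \1_(E y)).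
  apply: (integrable_bound (g := fun _ => 1)).
  - exact: measurable_indic.
  - exact: integrable_const.
  - by move=> x _; rewrite indicE; case: (_ \in _); rewrite /= ?normr1 ?normr0.
have iE y : mu.-integrable D (EFin \o (fun x => l y * \1_(E y) x)).
  have := integrableZl mD (l y) (i1 y).
  by congr (mu.-integrable D _); apply/funext => x; rewrite /= EFinM.
have es x : D x -> l (s x) = \sum_(y <- r) l y * \1_(E y) x.
  move=> Dx; have xr : s x \in r.
    by rewrite in_fset_set // inE; exists x.
  rewrite (big_rem (s x)) //= big1_seq => [|y /andP[_ yr]]; last first.
    rewrite indicE memNset ?mulr0 // => -[_ /= h]; move: yr.
    by rewrite mem_rem_uniq ?finmap.fset_uniq // inE h eqxx.
  by rewrite addr0 indicE mem_set ?mulr1.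
have [_ e2] := Rintegral_sum_seq r iE.
have -> : \int[mu]_(x in D) l (s x) = \int[mu]_(x in D) (\sum_(y <- r) l y * \1_(E y) x).
  by apply: eq_Rintegral => x /set_mem /es.
rewrite e2 /simple_integral fsbig_finite // lin_form_sum //; apply: eq_bigr => y _.
rewrite lin_formZ // (@RintegralZl _ _ _ mu D _ (l y) mD (i1 y)).
rewrite mulrC; congr (_ * fine _).
by rewrite integral_indic // (setIC (E y)) /E setIA setIid.
Qed.

(** [is_simple] controls [s] on [D] only, hence the value 0 elsewhere. *)
Lemma simple_sfun (s : {fimfun X >-> V}) : is_simple mu D s ->
  sfun (fun x => if x \in D then s x else 0).
Proof.
move=> ss; split.
  apply: (@sub_finite_set _ _ (range s `|` [set 0])).
    by move=> _ [x _ <-]; case: ifP => _; [left; exists x|right].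
  by rewrite finite_setU; split; [exact: fimfunP|exact: finite_set1].
move=> y; have [->|y0] := eqVneq y 0.
  rewrite (_ : _ @^-1` _ = (D `&` s @^-1` [set 0]) `|` ~` D).
    by apply: measurableU; [have [] := ss 0|exact: measurableC].
  apply/seteqP; split=> x /=.
    by case: ifPn => [/set_mem xD sx|]; [left|rewrite notin_setE; right].
  by move=> [[xD sx]|xD]; [rewrite mem_set|rewrite memNset].
rewrite (_ : _ @^-1` _ = D `&` s @^-1` [set y]); first by have [] := ss y.
apply/seteqP; split=> x /=.
  case: ifPn => [/set_mem xD sx //|_ y0']; by rewrite y0' eqxx in y0.
by move=> [xD sx]; rewrite mem_set.
Qed.

Lemma sfun_bounded (s : X -> V) : sfun s -> exists B, forall x, `|s x| <= B.
Proof.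
move=> [/finite_seqP[r hr] _]; exists (\sum_(y <- r) `|y|) => x.
have xr : s x \in r.
  by have : range s (s x) by [exists x]; rewrite hr.
by rewrite (big_rem (s x)) //= lerDl sumr_ge0.
Qed.

Lemma good_integrable_form l F : lin_form l -> good F ->
  mu.-integrable D (EFin \o (fun x => `|F x|)) -> mu.-integrable D (EFin \o (l \o F)).
Proof.
move=> hl gF iF; have [_ [C lC]] := hl.
apply: (integrable_bound (g := fun x => C * `|F x|)) => //.
  apply: measurable_funTS; apply: (@good_measurable _ _ _ (l \o F)).
  by apply: good_comp => //; exact: lin_form_continuous.
  have := integrableZl mD C iF.
  by congr (mu.-integrable D _); apply/funext => x; rewrite /= EFinM.
by move=> x _; exact: lC.
Qed.

Section value.
Variables (f F : X -> V).
Hypotheses (gF : good F) (iF : mu.-integrable D (EFin \o (fun x => `|F x|))).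
Hypothesis fF : {ae mu, forall x, D x -> f x = F x}.

Lemma integrable_dist (s : {fimfun X >-> V}) : is_simple mu D s ->
  mu.-integrable D (EFin \o (fun x => `|F x - s x|)).
Proof.
move=> ss; have ss' := simple_sfun ss; have [B sB] := sfun_bounded ss'.
apply: (integrable_bound (g := fun x => `|F x| + B)).
- apply: (@eq_measurable_fun _ _ _ _ D (fun x => `|F x - (if x \in D then s x else 0)|)).
    by move=> x ->.
  by apply: measurable_funTS; apply: good_norm; apply: goodB => //; exact: sfun_good.
- exact: (integrableD mD iF (integrable_const B)).
- move=> x Dx; rewrite normr_id; apply: le_trans (ler_normB _ _) _; rewrite lerD2l.
  by have := sB x; rewrite mem_set.
Qed.

Lemma simple_form_dist l C (s : {fimfun X >-> V}) : is_simple mu D s -> lin_form l ->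
  (forall u, `|l u| <= C * `|u|) ->
  `|\int[mu]_(x in D) l (F x) - l (simple_integral mu D s)| <=
    C * \int[mu]_(x in D) `|F x - s x|.
Proof.
move=> ss hl lC; rewrite simple_integral_form //; have id := integrable_dist ss.
have ilF := good_integrable_form hl gF iF.
have ils : mu.-integrable D (EFin \o (fun x => l (s x))).
  have [B sB] := sfun_bounded (simple_sfun ss).
  have gs := sfun_good (simple_sfun ss).
  have := @good_integrable_form l _ hl gs.
  have -> : mu.-integrable D (EFin \o (fun x => `|if x \in D then s x else 0|)).
    apply: (integrable_bound (g := fun _ => B)); last by move=> x _; rewrite normr_id.
      exact/measurable_funTS/good_norm.
    exact: integrable_const.
  move=> /(_ isT); apply: eq_integrable => // x xD.
  by rewrite /= xD.
rewrite -RintegralB //.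
have iB : mu.-integrable D (EFin \o (fun x => l (F x) - l (s x))) by exact: (integrableB mD ilF ils).
apply: le_trans (le_normr_Rintegral mD iB) _.
rewrite -RintegralZl //; apply: le_Rintegral => //.
- exact: integrable_normr iB.
- have := integrableZl mD C id.
  by congr (mu.-integrable D _); apply/funext => x; rewrite /= EFinM.
- by move=> x Dx; rewrite -lin_formB.
Qed.

Lemma lower_dist (s : {fimfun X >-> V}) : is_simple mu D s ->
  (\int[mu]_(x in D) (`|f x - s x|)%:E = \int[mu]_(x in D) (`|F x - s x|)%:E)%E.
Proof.
move=> ss; apply: ge0_ae_eq_integral_any => //.
- by case/integrableP: (integrable_dist ss).
- by apply: filterS fF => x h /h ->.
Qed.

(** Here [F] is a good representative of [f]: the defining limit involves integrals of the possibly
    nonmeasurable |f - s n|, which [lower_dist] replaces by those of |F - s n|. A bounded form then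
    passes to the limit. *)
Lemma bochner_value l v : is_bochner_integral mu D f v -> lin_form l ->
  l v = \int[mu]_(x in D) l (F x).
Proof.
move=> [s [[ss _] sF sv]] hl; have [_ [C lC]] := hl.
have h1 : l (simple_integral mu D (s n)) @[n --> \oo] --> l v.
  by apply: (cvg_comp _ _ sv); exact: lin_form_continuous.
have h2 : l (simple_integral mu D (s n)) @[n --> \oo] --> \int[mu]_(x in D) l (F x).
  have /fine_cvgP[_ h0] : (\int[mu]_(x in D) (`|F x - s n x|)%:E)%E @[n --> \oo] --> 0%E.
    by under eq_fun do rewrite -lower_dist //.
  apply/cvgrPdist_le => e e0.
  have C1 : 0 < `|C| + 1 by rewrite ltr_wpDl.
  have /cvgrPdist_le/(_ (e / (`|C| + 1))) [|n0 _ hn] := h0; first by rewrite divr_gt0.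
  exists n0 => // n /= nn; apply: le_trans (simple_form_dist (ss n) hl lC) _.
  have := hn _ nn; rewrite sub0r normrN /= -/(Rintegral _ _ _) => h.
  have I0 : 0 <= \int[mu]_(x in D) `|F x - s n x| by exact: Rintegral_ge0.
  rewrite (ger0_norm I0) in h.
  apply: (@le_trans _ _ ((`|C| + 1) * \int[mu]_(x in D) `|F x - s n x|)).
    by rewrite ler_wpM2r // (le_trans (ler_norm C)) // lerDl.
  by rewrite mulrC -ler_pdivlMr.
exact: (cvg_unique _ h1 h2).
Qed.

(** The approximants are kept only where |t n| <= 2 |F| and set to 0 elsewhere: the errors are then
    dominated by 3 |F|, and convergence survives, as the condition eventually holds where F is
    nonzero while F = 0 forces the value 0. The simple integrals are Cauchy by duality. *)
Lemma bochner_exists : exists v, is_bochner_integral mu D f v.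
Proof.
have [t [st tF]] := gF.
pose A n := D `&` [set x | `|t n x| <= 2 * `|F x|].
have mA n : measurable (A n).
  rewrite /A; apply: measurable_fun_le => //.
    exact/measurable_funTS/good_norm/sfun_good.
  by apply/measurable_funTS; apply: measurable_funM => //; exact: good_norm.
pose u n x := if x \in A n then t n x else 0.
have su n : sfun (u n) by apply: sfun_if => //; [exact: sfun_mem|exact: sfun_cst].
have uP n : u n \in fimfun by rewrite inE; case: (su n).
pose s n : {fimfun X >-> V} := fimfun_Sub (uP n).
have suf n : (s n : X -> V) = u n by exact: fimfun_valP.
have suE n x : s n x = u n x by rewrite suf.
have ss n : is_simple mu D (s n).
  move=> y; have mDy : measurable (D `&` s n @^-1` [set y]).
    by apply: measurableI => //; rewrite suf; case: (su n).
  split=> // _; apply: le_lt_trans finD.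
  by apply: le_measure; rewrite ?inE //; exact: subIsetl.
have ub n x : D x -> `|F x - s n x| <= 3 * `|F x|.
  move=> Dx; rewrite suE /u; case: ifPn => [|_].
    rewrite inE => -[_ /= h]; apply: le_trans (ler_normB _ _) _.
    by move: h; set a := `|t n x|; set b := `|F x|; lra.
  by rewrite subr0 ler_peMl // ler1n.
have uF x : D x -> s n x @[n --> \oo] --> F x.
  move=> Dx; rewrite (_ : (fun n => _) = u ^~ x); last by apply/funext => n; rewrite suE.
  have [F0|F0] := eqVneq (F x) 0.
    rewrite (_ : u ^~ x = (fun _ => 0)); first by rewrite F0; exact: cvg_cst.
    apply/funext => n; rewrite /u; case: ifP => //; rewrite inE => -[_ /=].
    by rewrite F0 normr0 mulr0 normr_le0 => /eqP.
  apply: cvg_trans (tF x); apply: near_eq_cvg.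
  have [n0 _ hn] : \forall n \near \oo, `|t n x| < 2 * `|F x|.
    apply: (cvgr_lt `|F x|); first by apply: cvg_norm; exact: tF.
    by rewrite ltr_pMl ?normr_gt0 // ltr1n.
  exists n0 => // n /= nn.
  by rewrite /u mem_set //; split => //=; exact/ltW/(hn _ nn).
have cv : (\int[mu]_(x in D) (`|F x - s n x|)%:E)%E @[n --> \oo] --> 0%E.
  have -> : 0%E = (\int[mu]_(x in D) (cst 0%E x))%E by rewrite integral0.
  apply: (@dominated_cvg _ _ _ mu D mD _ _ (fun x => (3 * `|F x|)%:E)) => //.
  - by move=> n; case/integrableP: (integrable_dist (ss n)).
  - move=> x Dx; apply: cvg_EFin; first exact: nearW.
    rewrite [X in _ --> X](_ : _ = `|F x - F x|); last by rewrite subrr normr0.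
    by apply: cvg_norm; apply: cvgB; [exact: cvg_cst|exact: uF].
  - have := integrableZl mD 3 iF.
    by congr (mu.-integrable D _); apply/funext => x; rewrite /= EFinM.
  - by move=> n x Dx; rewrite /= lee_fin normr_id ub.
have /fine_cvgP[_ h0] := cv.
have [v Iv] : exists v : V, simple_integral mu D (s n) @[n --> \oo] --> v.
  apply: (hilbert_complete L) => e e0; have e2 : 0 < e / 2 by rewrite divr_gt0.
  have /cvgrPdist_le/(_ (e / 2)) [//|n0 _ hn] := h0; exists n0 => m n hm hn'.
  apply: (@norm_le_dot _ _ L); first exact: ltW.
  move=> w; have hw := lin_form_dot w.
  have db k : (n0 <= k)%N -> `|\int[mu]_(x in D) dot w (F x) -
      dot w (simple_integral mu D (s k))| <= `|w| * (e / 2).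
    move=> kn; apply: le_trans (simple_form_dist (ss k) hw (dot_le_norm L w)) _.
    rewrite ler_wpM2l //; apply: le_trans (hn _ kn).
    by rewrite sub0r normrN /= ler_norm.
  have := db _ hm; have := db _ hn'; rewrite dotBr !ler_norml.
  move=> /andP[h1 h2] /andP[h3 h4].
  by rewrite [X in _ <= _ * X](splitr e) mulrDr; lra.
exists v, s; split => //.
- split => //; apply: filterS fF => x h Dx; rewrite (h Dx); exact: uF.
- by under eq_fun do rewrite lower_dist //.
Qed.

(** A value exists, so [xget] returns one, and [bochner_value] evaluates any form on it. *)
Lemma bochner_integral_form l : lin_form l ->
  l (bochner_integral mu D f) = \int[mu]_(x in D) l (F x).
Proof.
move=> hl; have [v hv] := bochner_exists; apply: bochner_value => //.
by rewrite /bochner_integral; case: xgetP => [y -> //|/(_ v)].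
Qed.

End value.
End bochner.

(** * Integrals over an interval *)

Section rint.
Context (R : realType).
Local Notation mu := (@lebesgue_measure R).
Implicit Types (a b c : R) (f g : R -> R).

Definition rint a b f : R := \int[mu]_(x in `[a, b]) f x.
Definition rintegrable a b f : Prop := mu.-integrable `[a, b] (EFin \o f).

Lemma itv_finite a b : (mu `[a, b] < +oo)%E.
Proof. by rewrite lebesgue_measure_itv /=; case: ifP => _; rewrite -?EFinB ltry. Qed.

Lemma rintegrableS a b a' b' f : a <= a' -> b' <= b -> rintegrable a b f ->
  rintegrable a' b' f.
Proof.
move=> aa bb; apply: integrableS => //.
by apply: subset_itv; rewrite bnd_simp.
Qed.

Lemma rintegrable_bound a b f g : measurable_fun setT f -> rintegrable a b g ->
  (forall x, a <= x <= b -> `|f x| <= g x) -> rintegrable a b f.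
Proof.
move=> mf ig fg; apply: (integrable_bound _ _ ig) => //; exact: measurable_funTS.
Qed.

Lemma rintegrable_const a b c : rintegrable a b (fun _ => c).
Proof. by apply: integrable_const => //; exact: itv_finite. Qed.

Lemma rintegrableD a b f g : rintegrable a b f -> rintegrable a b g ->
  rintegrable a b (fun x => f x + g x).
Proof. by move=> fi gi; exact: (integrableD _ fi gi). Qed.

Lemma rintegrableZ a b c f : rintegrable a b f -> rintegrable a b (fun x => c * f x).
Proof.
move=> fi; have := (fun m => integrableZl m c fi) (measurable_itv _).
by congr (_.-integrable _ _); apply/funext => x; rewrite /= EFinM.
Qed.

Lemma rintegrableB a b f g : rintegrable a b f -> rintegrable a b g ->
  rintegrable a b (fun x => f x - g x).
Proof. by move=> fi gi; exact: (integrableB _ fi gi). Qed.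

Lemma rintD a b f g : rintegrable a b f -> rintegrable a b g ->
  rint a b (fun x => f x + g x) = rint a b f + rint a b g.
Proof. by move=> fi gi; exact: RintegralD. Qed.

Lemma rintB a b f g : rintegrable a b f -> rintegrable a b g ->
  rint a b (fun x => f x - g x) = rint a b f - rint a b g.
Proof. by move=> fi gi; exact: RintegralB. Qed.

Lemma rintZ a b c f : rintegrable a b f -> rint a b (fun x => c * f x) = c * rint a b f.
Proof. by move=> fi; exact: RintegralZl. Qed.

Lemma rint_const a b c : a <= b -> rint a b (fun _ => c) = c * (b - a).
Proof.
move=> ab.
have -> : rint a b (fun _ => c) = c * fine (mu `[a, b]) by exact: Rintegral_cst.
rewrite lebesgue_measure_itv /=.
move: ab; rewrite le_eqVlt => /predU1P[->|ab]; first by rewrite lte_fin ltxx subrr.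
by rewrite lte_fin ab.
Qed.

Lemma rint_le a b f g : rintegrable a b f -> rintegrable a b g ->
  (forall x, a <= x <= b -> f x <= g x) -> rint a b f <= rint a b g.
Proof.
move=> fi gi fg; apply: le_Rintegral => // x /=; rewrite in_itv /=; exact: fg.
Qed.

Lemma rint_ge0 a b f : (forall x, a <= x <= b -> 0 <= f x) -> 0 <= rint a b f.
Proof. by move=> f0; apply: Rintegral_ge0 => x /=; rewrite in_itv /=; exact: f0. Qed.

Lemma rint_eq a b f g : (forall x, a <= x <= b -> f x = g x) -> rint a b f = rint a b g.
Proof.
by move=> fg; apply: eq_Rintegral => x /set_mem /=; rewrite in_itv /=; exact: fg.
Qed.

Lemma rintegrable_eq a b f g : (forall x, a <= x <= b -> f x = g x) ->
  rintegrable a b f -> rintegrable a b g.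
Proof.
move=> fg; apply: eq_integrable => // x /set_mem /=; rewrite in_itv /= => /fg ->.
by [].
Qed.

Lemma rintegrable_norm a b f : rintegrable a b f -> rintegrable a b (fun x => `|f x|).
Proof. by move=> fi; exact: integrable_normr. Qed.

Lemma rint_split a b c f : a <= b -> b <= c -> rintegrable a c f ->
  rint a c f = rint a b f + rint b c f.
Proof.
move=> ab bc fi; rewrite /rint.
have -> : [set` `[a, c]] = [set` `[a, b]] `|` [set` `]b, c]].
  by rewrite -itv_bndbnd_setU // bnd_simp.
rewrite Rintegral_setU //.
- congr (_ + _); apply: Rintegral_itv_obnd_cbnd.
  by apply: integrableS fi => //; apply: subset_itv; rewrite bnd_simp.
- by rewrite -itv_bndbnd_setU // bnd_simp.
- apply/disj_setPRL => x /= xbc; rewrite !in_itv /= in xbc *.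
  by move: xbc => /andP[bx _] /andP[_ xb]; have := lt_le_trans bx xb; rewrite ltxx.
Qed.

(** Mesh cells are open on the left; their left end is a null set. *)
Lemma rint_eq_oc a b f g : rintegrable a b f -> rintegrable a b g ->
  (forall x, a < x <= b -> f x = g x) -> rint a b f = rint a b g.
Proof.
move=> fi gi fg.
have oc (k : R -> R) : rintegrable a b k -> rint a b k = \int[mu]_(x in `]a, b]) k x.
  move=> ki; apply/esym; apply: Rintegral_itv_obnd_cbnd.
  by apply: integrableS ki => //; apply: subset_itv; rewrite bnd_simp.
rewrite !oc //; apply: eq_Rintegral => x /set_mem /=; rewrite in_itv /=; exact: fg.
Qed.

Lemma rint_point a f : rint a a f = 0.
Proof. by rewrite /rint set_itv1 Rintegral_set1. Qed.

Lemma rint_mono a b a' b' f : a <= a' -> a' <= b' -> b' <= b -> rintegrable a b f ->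
  (forall x, 0 <= f x) -> rint a' b' f <= rint a b f.
Proof.
move=> aa ab bb fi f0.
rewrite (rint_split aa (le_trans ab bb) fi).
rewrite (rint_split ab bb (rintegrableS aa (lexx _) fi)).
have h1 := @rint_ge0 a a' f (fun x _ => f0 x).
have h2 := @rint_ge0 b' b f (fun x _ => f0 x).
lra.
Qed.

(* AM-GM with a free weight, optimised at the end *)
Lemma rint_cauchy_schwarz a b f : a <= b -> (forall x, 0 <= f x) ->
  rintegrable a b f -> rintegrable a b (fun x => f x ^+ 2) ->
  rint a b f ^+ 2 <= (b - a) * rint a b (fun x => f x ^+ 2).
Proof.
move=> ab f0 fi f2; set A := rint a b f; set B := rint a b _.
have A0 : 0 <= A by apply: rint_ge0.
have B0 : 0 <= B by apply: rint_ge0 => x _; exact: sqr_ge0.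
have H c : 2 * c * A <= c ^+ 2 * (b - a) + B.
  rewrite /A /B -rint_const // -rintZ // -rintD //; last exact: rintegrable_const.
  apply: rint_le; first exact: rintegrableZ.
    by apply: rintegrableD => //; exact: rintegrable_const.
  by move=> x _; have := sqr_ge0 (c - f x); rewrite sqrrB -mulr_natl; lra.
have [ba|] := eqVneq (b - a) 0.
  suff -> : A = 0 by rewrite expr0n ba mul0r.
  have [//|An0] := eqVneq A 0; exfalso.
  by have := H ((B + 1) / A); rewrite ba mulr0 add0r -mulrA divfK //; lra.
move=> ba; have ba0 : 0 < b - a by rewrite lt_neqAle eq_sym ba subr_ge0.
have := H (A / (b - a)); rewrite -(ler_pM2l ba0).
have -> : (b - a) * (2 * (A / (b - a)) * A) = 2 * A ^+ 2 by field; exact: ba.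
have -> : (b - a) * ((A / (b - a)) ^+ 2 * (b - a) + B) = A ^+ 2 + (b - a) * B.
  by field; exact: ba.
lra.
Qed.

Lemma rintegrable_sqr a b f : measurable_fun setT f ->
  rintegrable a b (fun x => f x ^+ 2) -> rintegrable a b f.
Proof.
move=> mf f2; apply: (rintegrable_bound mf (rintegrableD (rintegrable_const a b 1) f2)).
move=> x _; have := sqr_ge0 (`|f x| - 1); rewrite sqrrB1 real_normK ?num_real //.
have := normr_ge0 (f x); lra.
Qed.

Lemma rint_dominated a b (f_ : nat -> R -> R) f g :
  (forall n, measurable_fun setT (f_ n)) -> rintegrable a b g ->
  (forall x, a <= x <= b -> f_ n x @[n --> \oo] --> f x) ->
  (forall n x, a <= x <= b -> `|f_ n x| <= g x) ->
  rint a b (f_ n) @[n --> \oo] --> rint a b f.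
Proof.
move=> mf gi ff fg.
have fi n : rintegrable a b (f_ n) by exact: rintegrable_bound (gi) (fg n).
have mfD : measurable_fun `[a, b] f.
  by apply: (@measurable_fun_cvg _ _ _ `[a, b]%classic f_) => // n; exact: measurable_funTS.
have fg0 x : a <= x <= b -> `|f x| <= g x.
  move=> xab; have h : `|f_ n x| @[n --> \oo] --> `|f x| by apply: cvg_norm; exact: ff.
  rewrite -(cvg_lim _ h) //.
  apply: limr_le; last by apply: nearW => n; exact: fg.
  by apply/cvg_ex; exists (`|f x|).
have fi0 : rintegrable a b f by apply: (integrable_bound _ _ gi).
apply: fine_cvg; rewrite fineK; last exact: integrable_fin_num.
apply: (@dominated_cvg _ _ _ mu `[a, b]%classic (measurable_itv _)
  (fun n => EFin \o f_ n) (EFin \o f) (EFin \o g)) => //.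
- by move=> n; case/integrableP: (fi n).
- move=> x xab; apply: cvg_EFin; first exact: nearW.
  exact: ff.
Qed.

End rint.

(** * Mild solutions *)

(** Negative times are sent to the identity: orbits are then continuous on the whole line, and s ->
    Q (b - s) (h s) is defined for all s. *)
Record growth_semigroup (R : realType) (V : normedModType R) (w : R)
    (Q : R -> {linear V -> V}) : Prop := {
  sg_id : forall t u, t <= 0 -> Q t u = u;
  sgD : forall s t u, 0 <= s -> 0 <= t -> Q (s + t) u = Q s (Q t u);
  sg_bound : forall t u, 0 <= t -> `|Q t u| <= expR (w * t) * `|u|;
  sg_cont : forall u, continuous (fun t => Q t u) }.

Section mild.
Context (R : realType) (V : normedModType R) (L : hilbert_lattice V).
Variables (w : R) (Q : R -> {linear V -> V}) (hQ : growth_semigroup w Q).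
Variables (T : R).
Hypotheses (w0 : 0 < w) (T0 : 0 < T).
Local Notation dot := (dot L).
Implicit Types (h : R -> V) (a b t : R) (u v : V).

Definition sgM : R := expR (w * T).
Local Notation M := sgM.

Lemma sgM_ge1 : 1 <= M.
Proof. by rewrite -expR0 ler_expR mulr_ge0 // ltW. Qed.

Lemma sgM_gt0 : 0 < M.
Proof. exact: expR_gt0. Qed.

Lemma sg_le t u : t <= T -> `|Q t u| <= M * `|u|.
Proof.
move=> tT; have [t0|/ltW t0] := leP 0 t.
  apply: le_trans (sg_bound hQ u t0) _; rewrite ler_wpM2r // ler_expR.
  by rewrite ler_pM2l.
by rewrite (sg_id hQ) // ler_peMl // sgM_ge1.
Qed.

Lemma sg_cvg u t : Q s u @[s --> t] --> Q t u.
Proof. by case: hQ => _ _ _ c; exact: c. Qed.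

(** Strong continuity together with a locally uniform operator bound gives joint continuity; this
    makes s -> Q (r s) (h s) good. *)
Lemma sg_continuous2 t u : {for (t, u), continuous (fun p : R * V => Q p.1 p.2)}.
Proof.
apply/cvgrPdist_lt => e e0.
pose K := expR (w * (`|t| + 1)).
have K0 : 0 < K by exact: expR_gt0.
have c1 : p.1 @[p --> (t, u)] --> t by exact: cvg_fst.
have c2 : p.2 @[p --> (t, u)] --> u by exact: cvg_snd.
have c3 : Q p.1 u @[p --> (t, u)] --> Q t u by exact: (cvg_comp _ _ c1 (@sg_cvg u t)).
have e2 : 0 < e / 2 by rewrite divr_gt0.
near=> p.
have -> : Q (t, u).1 (t, u).2 - Q p.1 p.2 = (Q t u - Q p.1 u) + Q p.1 (u - p.2).
  by rewrite linearB /= subrKA.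
apply: le_lt_trans (ler_normD _ _) _; rewrite [ltRHS]splitr; apply: ltrD.
  by near: p; move/cvgrPdist_lt : c3; exact.
have bd : `|Q p.1 (u - p.2)| <= K * `|u - p.2|.
  have [t0|/ltW t0] := leP 0 p.1.
    apply: le_trans (sg_bound hQ _ t0) _; rewrite ler_wpM2r // ler_expR ler_pM2l //.
    apply: ltW; near: p; apply: (cvgr_lt t) => //.
    by rewrite (le_lt_trans (ler_norm t)) // ltrDl.
  by rewrite (sg_id hQ) // ler_peMl // -expR0 ler_expR mulr_ge0 ?addr_ge0 // ltW.
apply: le_lt_trans bd _; rewrite mulrC -ltr_pdivlMr //.
by near: p; move/cvgrPdist_lt : c2; apply; rewrite divr_gt0.
Unshelve. all: by end_near. Qed.

(* A square-integrable function with a fixed representative, defined everywhere as a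
   pointwise limit of finitely valued functions. *)
Definition hL2 h := good h /\ rintegrable 0 T (fun s => `|h s| ^+ 2).

Lemma hL2_good h : hL2 h -> good h. Proof. by case. Qed.

Lemma hL2_L1 h : hL2 h -> rintegrable 0 T (fun s => `|h s|).
Proof. by move=> [gh h2]; apply: rintegrable_sqr => //; exact: good_norm. Qed.

Lemma orb_good (r : R -> R) h : measurable_fun setT r -> good h ->
  good (fun s : R => Q (r s) (h s)).
Proof.
move=> /measurable_good gr gh.
apply: (@good_comp2 _ _ _ (GRing.regular R) V V (fun t v => Q t v) r h) => // x.
exact: sg_continuous2.
Qed.

Lemma orb_good_sub b h : good h -> good (fun s : R => Q (b - s) (h s)).
Proof. by apply: orb_good; apply: measurable_funB. Qed.

Lemma orb_integrable a b h : 0 <= a -> b <= T -> hL2 h ->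
  rintegrable a b (fun s => `|Q (b - s) (h s)|).
Proof.
move=> a0 bT hh; have [gh _] := hh.
apply: (rintegrable_bound (g := fun s => M * `|h s|)).
- exact/good_norm/orb_good_sub.
- by apply/rintegrableZ/(rintegrableS a0 bT)/hL2_L1.
- move=> s /andP[aS _]; rewrite normr_id; apply: sg_le.
  by rewrite lerBlDr; apply: le_trans bT _; rewrite lerDl (le_trans a0).
Qed.

Lemma orb_form_integrable a b h l : 0 <= a -> b <= T -> hL2 h -> lin_form l ->
  rintegrable a b (fun s => l (Q (b - s) (h s))).
Proof.
move=> a0 bT hh hl; apply: good_integrable_form => //; last exact: orb_integrable.
by case: hh => gh _; exact: orb_good_sub.
Qed.

(** The Duhamel integral with final time [b]. It is locked so that conversion never opens the
    Bochner integral; everything known about it comes from [J_form]. *)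
Definition J a b h : V :=
  locked (bochner_integral (@lebesgue_measure R) `[a, b] (fun s => Q (b - s) (h s))).

Lemma J_form a b h l : 0 <= a -> b <= T -> hL2 h -> lin_form l ->
  l (J a b h) = rint a b (fun s => l (Q (b - s) (h s))).
Proof.
move=> a0 bT hh hl; have [gh _] := hh; rewrite /J -lock.
apply: (@bochner_integral_form _ _ _ (@lebesgue_measure R) `[a, b]%classic _ _ V L _
  (fun s => Q (b - s) (h s))) => //.
- exact: itv_finite.
- exact: orb_good_sub.
- exact: orb_integrable.
- by apply: aeW => x _.
Qed.

Lemma J_dot a b h v : 0 <= a -> b <= T -> hL2 h ->
  dot v (J a b h) = rint a b (fun s => dot v (Q (b - s) (h s))).
Proof. by move=> a0 bT hh; apply: J_form => //; exact: lin_form_dot. Qed.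

Lemma dot_orb_integrable a b h v : 0 <= a -> b <= T -> hL2 h ->
  rintegrable a b (fun s => dot v (Q (b - s) (h s))).
Proof. by move=> a0 bT hh; apply: orb_form_integrable => //; exact: lin_form_dot. Qed.

Lemma lin_form_sg l t : lin_form l -> lin_form (fun u => l (Q t u)).
Proof.
move=> [ll [C lC]]; split; first by move=> a u v; rewrite linearP ll.
exists (`|C| * expR (w * `|t|)) => u; apply: le_trans (lC _) _.
apply: le_trans (ler_wpM2r (normr_ge0 _) (ler_norm C)) _.
rewrite -mulrA ler_wpM2l //; have [t0|/ltW t0] := leP 0 t.
  by apply: le_trans (sg_bound hQ _ t0) _; rewrite ger0_norm.
by rewrite (sg_id hQ) // ler_peMl // -expR0 ler_expR mulr_ge0 // ltW.
Qed.

Lemma hL2_bound h k : good h -> hL2 k -> forall c, (forall s, 0 <= s <= T -> `|h s| <= c * `|k s|) -> hL2 h.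
Proof.
move=> gh [gk k2] c hk; split => //.
apply: (rintegrable_bound (g := fun s => c ^+ 2 * `|k s| ^+ 2)).
- by apply: measurable_funX; exact: good_norm.
- exact: rintegrableZ.
- move=> s hs; rewrite ger0_norm ?exprn_ge0 // -exprMn lerXn2r ?nnegrE //; last exact: hk.
  exact: le_trans (hk _ hs).
Qed.

Lemma hL2D h k : hL2 h -> hL2 k -> hL2 (fun s => h s + k s).
Proof.
move=> [gh h2] [gk k2]; split; first exact: goodD.
apply: (rintegrable_bound (g := fun s => 2 * (`|h s| ^+ 2 + `|k s| ^+ 2))).
- by apply: measurable_funX; apply: good_norm; exact: goodD.
- exact/rintegrableZ/rintegrableD.
- move=> s hs; rewrite ger0_norm ?exprn_ge0 //.
  have l1 : `|h s + k s| ^+ 2 <= (`|h s| + `|k s|) ^+ 2.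
    by rewrite lerXn2r ?nnegrE ?addr_ge0 // ler_normD.
  apply: le_trans l1 _; rewrite -subr_ge0.
  rewrite (_ : _ - _ = (`|h s| - `|k s|) ^+ 2) ?sqr_ge0 //; ring.
Qed.

Lemma hL2Z c h : hL2 h -> hL2 (fun s => c *: h s).
Proof.
move=> hh; apply: (@hL2_bound _ h _ hh `|c|).
  by apply: (goodZ (h := fun _ => c)) => //; case: hh.
by move=> s _; rewrite normrZ.
Qed.

Lemma hL2N h : hL2 h -> hL2 (fun s => - h s).
Proof.
move=> hh; apply: (@hL2_bound _ h _ hh 1); first by apply: goodN; case: hh.
by move=> s _; rewrite normrN mul1r.
Qed.

Lemma hL2B h k : hL2 h -> hL2 k -> hL2 (fun s => h s - k s).
Proof. by move=> hh hk; apply: hL2D hh (hL2N hk). Qed.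

Lemma JD a b h k : 0 <= a -> b <= T -> hL2 h -> hL2 k ->
  J a b (fun s => h s + k s) = J a b h + J a b k.
Proof.
move=> a0 bT hh hk; apply: (dot_inj (L := L)) => v.
rewrite dotDr (J_dot v a0 bT hh) (J_dot v a0 bT hk) (J_dot v a0 bT (hL2D hh hk)).
rewrite -rintD; [|exact: dot_orb_integrable..].
by apply: rint_eq => s _; rewrite linearD dotDr.
Qed.

Lemma JZ a b c h : 0 <= a -> b <= T -> hL2 h ->
  J a b (fun s => c *: h s) = c *: J a b h.
Proof.
move=> a0 bT hh; apply: (dot_inj (L := L)) => v.
rewrite dotZr (J_dot v a0 bT hh) (J_dot v a0 bT (hL2Z c hh)).
rewrite -rintZ; last exact: dot_orb_integrable.
by apply: rint_eq => s _; rewrite linearZ /= dotZr.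
Qed.

Lemma JB a b h k : 0 <= a -> b <= T -> hL2 h -> hL2 k ->
  J a b (fun s => h s - k s) = J a b h - J a b k.
Proof.
move=> a0 bT hh hk; apply: (dot_inj (L := L)) => v.
rewrite dotBr (J_dot v a0 bT hh) (J_dot v a0 bT hk) (J_dot v a0 bT (hL2B hh hk)).
rewrite -rintB; [|exact: dot_orb_integrable..].
by apply: rint_eq => s _; rewrite linearB /= dotBr.
Qed.

Lemma J_norm a b h : 0 <= a -> a <= b -> b <= T -> hL2 h ->
  `|J a b h| <= M * rint a b (fun s => `|h s|).
Proof.
move=> a0 ab bT hh; have i1 : rintegrable a b (fun s => `|h s|).
  by apply: (rintegrableS a0 bT); exact: hL2_L1.
apply: (norm_le_dot (L := L)) => [|v].
  by rewrite mulr_ge0 // ?(ltW sgM_gt0) // rint_ge0.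
rewrite J_dot // mulrA -rintZ //; apply: rint_le.
- exact: dot_orb_integrable.
- exact: rintegrableZ.
- move=> s /andP[aS _]; apply: le_trans (cauchy_schwarz _ _ _) _.
  rewrite -mulrA ler_wpM2l // sg_le // lerBlDr.
  by apply: le_trans bT _; rewrite lerDl (le_trans a0).
Qed.

Lemma J_sqr a b h : 0 <= a -> a <= b -> b <= T -> hL2 h ->
  `|J a b h| ^+ 2 <= M ^+ 2 * (b - a) * rint a b (fun s => `|h s| ^+ 2).
Proof.
move=> a0 ab bT hh; have [_ h2] := hh.
apply: (@le_trans _ _ ((M * rint a b (fun s => `|h s|)) ^+ 2)).
  by rewrite lerXn2r ?nnegrE ?mulr_ge0 ?(ltW sgM_gt0) ?rint_ge0 //; exact: J_norm.
rewrite exprMn -mulrA ler_wpM2l ?exprn_ge0 ?(ltW sgM_gt0) //.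
apply: rint_cauchy_schwarz => //; last exact: (rintegrableS a0 bT).
by apply: (rintegrableS a0 bT); exact: hL2_L1.
Qed.

(** The form u -> dot v (Q (c - b) u) is bounded, so [J_form] carries Q (c - b) under the integral,
    where the semigroup law applies. *)
Lemma J_split a b c h : 0 <= a -> a <= b -> b <= c -> c <= T -> hL2 h ->
  J a c h = Q (c - b) (J a b h) + J b c h.
Proof.
move=> a0 ab bc cT hh; apply: (dot_inj (L := L)) => v.
have b0 := le_trans a0 ab; have bT := le_trans bc cT.
rewrite dotDr (J_dot v a0 cT hh) (J_dot v b0 cT hh) (rint_split ab bc); last exact: dot_orb_integrable.
congr (_ + _).
rewrite (@J_form a b h (fun u => dot v (Q (c - b) u))) //; last first.
  exact: (lin_form_sg _ (lin_form_dot _ _)).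
apply: rint_eq => s /andP[_ sb]; rewrite -(sgD hQ) ?subr_ge0 //.
by congr (dot v (Q _ _)); ring.
Qed.

Lemma J_sg a d h : 0 <= a -> a <= T -> 0 <= d -> hL2 h ->
  Q d (J 0 a h) - J 0 a h = J 0 a (fun s => Q d (h s) - h s).
Proof.
move=> a0 aT d0 hh; have [gh _] := hh.
have hd : hL2 (fun s => Q d (h s)).
  apply: (@hL2_bound _ h _ hh (expR (w * d))).
    by apply: (orb_good (r := fun _ => d)).
  by move=> s _; exact: (sg_bound hQ).
rewrite JB //; congr (_ - _); apply: (dot_inj (L := L)) => v.
rewrite (@J_form 0 a h (fun u => dot v (Q d u))) //; last first.
  exact: (lin_form_sg _ (lin_form_dot _ _)).
rewrite J_dot //; apply: rint_eq => s /andP[_ sa].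
by rewrite -!(sgD hQ) ?subr_ge0 // addrC.
Qed.

(** The L^1 modulus of strong continuity of the semigroup along [h]. *)
Definition kappa h d := rint 0 T (fun s => `|Q d (h s) - h s|).

Lemma kappa_small h : hL2 h -> forall e, 0 < e ->
  exists2 d, 0 < d & forall t, 0 <= t <= d -> kappa h t <= e.
Proof.
move=> hh e e0; have [gh _] := hh.
apply: contrapT => nH.
have /choice[r rP] : forall n, exists t, 0 <= t <= n.+1%:R^-1 /\ e < kappa h t.
  move=> n; apply: contrapT => nt; apply: nH; exists n.+1%:R^-1; first by rewrite invr_gt0.
  by move=> t ht; rewrite leNgt; apply/negP => et; apply: nt; exists t.
have r0 : r n @[n --> \oo] --> 0.
  apply: (@squeeze_cvgr _ _ _ _ (fun _ => 0) (fun n => n.+1%:R^-1)).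
  - by apply: nearW => n; case: (rP n).
  - exact: cvg_cst.
  - exact: cvg_harmonic.
have gk t : good (fun s => Q t (h s) - h s).
  by apply: goodB => //; apply: (orb_good (r := fun _ => t)).
(* Times are cut at T so that (M + 1) |h s| dominates for every n; as the times tend to 0 the cut is
   eventually void. *)
have : rint 0 T (fun s => `|Q (Num.min (r n) T) (h s) - h s|) @[n --> \oo] -->
    rint 0 T (fun s => `|Q 0 (h s) - h s|).
  apply: (rint_dominated (g := fun s => (M + 1) * `|h s|)).
  - by move=> n; exact/good_norm/gk.
  - exact/rintegrableZ/hL2_L1.
  - move=> s _; apply: cvg_norm; apply: cvgB; last exact: cvg_cst.
    apply: (@cvg_comp _ _ _ (fun n => Num.min (r n) T) (fun t => Q t (h s))); last exact: sg_cvg.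
    have r0' := r0; apply: cvg_trans r0'; apply: near_eq_cvg.
    have [n0 _ hn] := cvgr_lt _ r0 _ T0; exists n0 => // n /= nn.
    by rewrite min_l // ltW //; exact: hn.
  - move=> n s _; rewrite normr_id; apply: le_trans (ler_normB _ _) _.
    by rewrite mulrDl mul1r lerD2r sg_le // ge_min lexx orbT.
rewrite [X in _ --> X](_ : _ = 0); last first.
  rewrite (rint_eq (g := fun _ => 0)) ?rint_const ?(ltW T0) ?mul0r //.
  by move=> s _; rewrite (sg_id hQ) // subrr normr0.
move=> /cvgrPdist_lt /(_ _ e0) [n0 _ hn].
move/cvgrPdist_lt: r0 => /(_ _ T0) [n1 _ hn1].
pose n := maxn n0 n1.
have := hn n (leq_maxl _ _); have := hn1 n (leq_maxr _ _).
have [/andP[rn0 _] ern] := rP n.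
rewrite /= !sub0r !normrN (ger0_norm rn0) => /ltW rT.
rewrite min_l // => /(le_lt_trans (ler_norm _)) /(lt_trans ern).
by rewrite ltxx.
Qed.

Definition traj u0 h t : V := Q t u0 + J 0 t h.

Lemma traj_flow u0 h a b : 0 <= a -> a <= b -> b <= T -> hL2 h ->
  traj u0 h b = Q (b - a) (traj u0 h a) + J a b h.
Proof.
move=> a0 ab bT hh.
have e : Q b u0 = Q (b - a) (Q a u0) by rewrite -(sgD hQ) ?subr_ge0 // subrK.
have l : Q (b - a) (Q a u0 + J 0 a h) = Q (b - a) (Q a u0) + Q (b - a) (J 0 a h).
  exact: linearD.
by rewrite /traj (J_split (lexx 0) a0 ab bT hh) e l addrA.
Qed.

(** The increment splits into Q_a (Q_(b-a) u0 - u0), (Q_(b-a) - I) J(0, a) and J(a, b). They are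
    controlled by strong continuity at u0, by [kappa], and by Cauchy-Schwarz on [a, b]; none of the
    bounds depends on a. *)
Lemma traj_modulus u0 h : hL2 h -> forall e, 0 < e -> exists2 d, 0 < d &
  forall a b, 0 <= a -> a <= b -> b <= T -> b - a <= d ->
    `|traj u0 h b - traj u0 h a| <= e.
Proof.
move=> hh e e0; have M0 := sgM_gt0.
have e3 : 0 < e / (3 * M) by rewrite divr_gt0 // mulr_gt0.
have [d1 d10 hd1] := kappa_small hh e3.
have := @sg_cvg u0 0; move/cvgrPdist_le => /(_ _ e3)[d2 /= d20 hd2].
set n2 := rint 0 T (fun s => `|h s| ^+ 2).
have n20 : 0 <= n2 by apply: rint_ge0 => s _; exact: exprn_ge0.
have p0 : 0 < M ^+ 2 * n2 + 1 by rewrite ltr_wpDl // mulr_ge0 // exprn_ge0 // ltW.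
pose d3 := (e / 3) ^+ 2 / (M ^+ 2 * n2 + 1).
have d30 : 0 < d3 by rewrite divr_gt0 // exprn_gt0 // divr_gt0.
exists (Num.min d1 (Num.min (d2 / 2) d3)); first by rewrite !lt_min d10 d30 divr_gt0.
move=> a b a0 ab bT; rewrite !le_min => /and3P[b1 b2 b3].
have ba0 : 0 <= b - a by rewrite subr_ge0.
have aT := le_trans ab bT.
rewrite (traj_flow u0 a0 ab bT hh) {1 2}/traj.
have -> : Q (b - a) (Q a u0 + J 0 a h) + J a b h - (Q a u0 + J 0 a h) =
   Q a (Q (b - a) u0 - u0) + (Q (b - a) (J 0 a h) - J 0 a h) + J a b h.
  rewrite linearD linearB /= -!(sgD hQ) // (addrC a) opprD.
  by rewrite (AC (3*2) ((1*4)*(2*5)*3)).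
have l1 : `|Q a (Q (b - a) u0 - u0)| <= e / 3.
  apply: le_trans (sg_le _ aT) _; rewrite mulrC -ler_pdivlMr // -mulrA -invfM.
  have := hd2 (b - a); rewrite (sg_id hQ u0 (lexx 0)) distrC; apply.
  rewrite /= sub0r normrN ger0_norm //; apply: le_lt_trans b2 _.
  by rewrite ltr_pdivrMr // ltr_pMr // ltr1n.
have l2 : `|Q (b - a) (J 0 a h) - J 0 a h| <= e / 3.
  rewrite J_sg //.
  have hd : hL2 (fun s => Q (b - a) (h s) - h s).
    apply: hL2B => //; apply: (@hL2_bound _ h _ hh (expR (w * (b - a)))).
      by apply: (orb_good (r := fun _ => b - a)) => //; case: hh.
    by move=> s _; exact: (sg_bound hQ).
  apply: le_trans (J_norm _ a0 aT hd) _ => //.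
  rewrite mulrC -ler_pdivlMr // -mulrA -invfM.
  apply: (@le_trans _ _ (kappa h (b - a))); last by apply: hd1; rewrite ba0.
  by apply: rint_mono => //; exact: hL2_L1.
have l3 : `|J a b h| <= e / 3.
  rewrite -(@ler_pXn2r _ 2) ?nnegrE ?divr_ge0 ?(ltW e0) //.
  apply: le_trans (J_sqr a0 ab bT hh) _.
  have : rint a b (fun s => `|h s| ^+ 2) <= n2.
    by apply: rint_mono => //; case: hh.
  move: b3; rewrite /d3 ler_pdivlMr // => b3 hn.
  apply: le_trans b3; rewrite [leRHS]mulrDr mulr1.
  apply: (@le_trans _ _ ((b - a) * (M ^+ 2 * n2))); last by rewrite lerDl.
  rewrite -mulrA mulrCA ler_wpM2l // ler_wpM2l // exprn_ge0 // ltW //.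
apply: le_trans (ler_normD _ _) _; apply: le_trans (lerD (ler_normD _ _) (lexx _)) _.
lra.
Qed.

End mild.

(** * The energy inequality *)

Section cells.
Context (R : realType).
Implicit Types (tau s : R).

(* the right end of the cell ]k tau, (k+1) tau] that contains s *)
Definition cellup tau s : R := tau * (Num.ceil (s / tau))%:~R.

Lemma ceil_cell tau s k : 0 < tau -> k%:R * tau < s <= k.+1%:R * tau ->
  Num.ceil (s / tau) = k.+1%:Z.
Proof.
move=> t0 /andP[ks sk]; apply: ceil_def.
rewrite ltr_pdivlMr // ler_pdivrMr // intrD.
by rewrite (_ : k.+1%:~R = k.+1%:R :> R) // sk andbT -natr1 addrK.
Qed.

Lemma cellup_cell tau s k : 0 < tau -> k%:R * tau < s <= k.+1%:R * tau ->
  cellup tau s = k.+1%:R * tau.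
Proof. by move=> t0 h; rewrite /cellup (ceil_cell t0 h) mulrC. Qed.

Lemma cellup_ge tau s : 0 < tau -> s <= cellup tau s.
Proof. by move=> t0; rewrite /cellup mulrC -ler_pdivrMr // ceil_ge. Qed.

Lemma cellup_le tau s : 0 < tau -> cellup tau s <= s + tau.
Proof.
move=> t0; have /andP[h _] := ceil_itv (s / tau).
move: h; rewrite ltr_pdivlMr // intrD mulrDl mulN1r => /ltW h.
by rewrite /cellup mulrC -lerBlDr.
Qed.

Lemma measurable_cellup tau : 0 < tau -> measurable_fun setT (cellup tau).
Proof.
move=> t0; apply: nondecreasing_measurable => // x y xy.
rewrite /cellup ler_pM2l // ler_int; apply: le_ceil.
by rewrite ler_pM2r // invr_gt0.
Qed.

Lemma cellup_cvg (tau : nat -> R) s : (forall n, 0 < tau n) ->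
  tau n @[n --> \oo] --> 0 -> cellup (tau n) s @[n --> \oo] --> s.
Proof.
move=> t0 /cvgrPdist_le tc; apply/cvgrPdist_le => e e0.
have [n0 _ hn] := tc e e0; exists n0 => // n /= nn.
have := hn n nn; rewrite /= sub0r normrN (gtr0_norm (t0 n)) => te.
rewrite distrC ger0_norm ?subr_ge0 ?cellup_ge // lerBlDl.
by apply: le_trans (cellup_le _ (t0 n)) _; rewrite lerD2l.
Qed.

Lemma ae_imply (P Q : R -> Prop) : {ae @lebesgue_measure R, forall x, P x} ->
  (forall x, P x -> Q x) -> {ae @lebesgue_measure R, forall x, Q x}.
Proof.
move=> [N [mN N0 hN]] PQ; exists N; split => // x /= nQ; apply: hN => /= Px.
by apply: nQ; exact: PQ.
Qed.

Lemma ae_and (P Q : R -> Prop) : {ae @lebesgue_measure R, forall x, P x} ->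
  {ae @lebesgue_measure R, forall x, Q x} ->
  {ae @lebesgue_measure R, forall x, P x /\ Q x}.
Proof.
move=> [N [mN N0 hN]] [K [mK K0 hK]]; exists (N `|` K); split.
- exact: measurableU.
- exact: null_set_setU.
- move=> x /= nPQ; have [Px|] := pselect (P x); last by left; apply: hN.
  have [Qx|] := pselect (Q x); last by right; apply: hK.
  by exfalso; exact: nPQ.
Qed.

Lemma rint_ge0_ae (a b : R) (f : R -> R) : rintegrable a b f ->
  {ae @lebesgue_measure R, forall x, a <= x <= b -> 0 <= f x} -> 0 <= rint a b f.
Proof.
move=> fi f0; suff -> : rint a b f = rint a b (fun x => `|f x|).
  by apply: rint_ge0.
have [mf _] := integrableP _ _ _ fi.
have [mnf _] := integrableP _ _ _ (rintegrable_norm fi).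
rewrite /rint /Rintegral; congr fine; apply: ae_eq_integral => //.
apply: (@ae_imply _ (fun x => x \in `[a, b] -> (f x)%:E = (`|f x|)%:E) f0) => x h.
by rewrite in_itv /= => /h h0; rewrite ger0_norm.
Qed.

End cells.

(** * Extension from [0, T] by constants *)

Section clamp.
Context (R : realType) (V : normedModType R).
Variable T : R.
Hypothesis T0 : 0 < T.
Implicit Types (a b t : R) (f : R -> V).

(** Composing with [clamp] turns uniform continuity on [0, T] into continuity on the line, with no
    change of values on [0, T]. *)
Definition clamp t : R := Num.max 0 (Num.min t T).

Lemma clamp_itv t : 0 <= clamp t <= T.
Proof. by rewrite /clamp le_max lexx /= ge_max ge_min lexx orbT (ltW T0). Qed.

Lemma clamp_id t : 0 <= t <= T -> clamp t = t.
Proof. by move=> /andP[h1 h2]; rewrite /clamp min_l // max_r. Qed.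

Lemma clamp_mono a b : a <= b -> clamp a <= clamp b /\ clamp b - clamp a <= b - a.
Proof.
move=> ab; rewrite /clamp.
case: (leP a T) => aT; case: (leP b T) => bT; case: (leP 0 a) => a0;
  case: (leP 0 b) => b0; case: (leP 0 T) => ?; split; lra.
Qed.

Definition modulus f := forall e, 0 < e -> exists2 d, 0 < d &
  forall a b, 0 <= a -> a <= b -> b <= T -> b - a <= d -> `|f b - f a| <= e.

Lemma lipschitz_modulus f K : 0 <= K ->
  (forall a b, 0 <= a -> a <= b -> b <= T -> `|f b - f a| <= K * (b - a)) -> modulus f.
Proof.
move=> K0 fK e e0; have K1 : 0 < K + 1 by rewrite ltr_wpDl.
exists (e / (K + 1)); first by rewrite divr_gt0.
move=> a b a0 ab bT ba; apply: le_trans (fK a b a0 ab bT) _.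
apply: (@le_trans _ _ ((K + 1) * (e / (K + 1)))).
  by apply: ler_pM; rewrite ?subr_ge0 // lerDl.
by rewrite mulrC divfK // gt_eqF.
Qed.

Lemma modulus_clamp_cont f : modulus f -> continuous (fun t => f (clamp t)).
Proof.
move=> mf t; apply/cvgrPdist_le => e e0.
have [d d0 hd] := mf _ e0.
exists d => //= s; rewrite /ball_ /= => st.
wlog ts : s t st / t <= s.
  move=> H; have [ts|/ltW ts] := leP t s; first exact: H.
  by rewrite distrC; apply: H => //; rewrite distrC.
have [h1 h2] := clamp_mono ts; rewrite distrC; apply: hd => //.
- by case/andP: (clamp_itv t).
- by case/andP: (clamp_itv s).
- by apply: le_trans h2 _; apply: le_trans (ltW st); rewrite distrC; exact: ler_norm.
Qed.

End clamp.

Section energy.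
Context (R : realType) (V : normedModType R) (L : hilbert_lattice V).
Variables (w : R) (Q : R -> {linear V -> V}) (hQ : growth_semigroup w Q).
Variables (T : R).
Hypotheses (w0 : 0 < w) (T0 : 0 < T).
Local Notation dot := (dot L).
Local Notation M := (sgM w T).
Local Notation hL2 := (hL2 T).
Local Notation traj := (traj Q).
Local Notation clamp := (clamp T).
Implicit Types (h : R -> V) (a b t : R) (u v : V).

Lemma traj_clamp_cont u0 h : hL2 h -> continuous (fun t => traj u0 h (clamp t)).
Proof.
move=> hh; apply: (modulus_clamp_cont T0) => e e0.
exact: (traj_modulus L hQ w0 T0 u0 hh e0).
Qed.

Lemma traj_bound u0 h t : hL2 h -> 0 <= t <= T ->
  `|traj u0 h t| <= M * (`|u0| + rint 0 T (fun s => `|h s|)).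
Proof.
move=> hh /andP[t0 tT]; rewrite /traj; apply: le_trans (ler_normD _ _) _.
rewrite mulrDr; apply: lerD; first exact: (sg_le hQ w0 T0).
apply: le_trans (J_norm L hQ w0 T0 (lexx 0) t0 tT hh) _.
by rewrite ler_wpM2l ?(ltW (sgM_gt0 _ _)) //; apply: rint_mono => //; exact: hL2_L1.
Qed.

Let wt t : R := expR (- (2 * w * t)).

Let wt_gt0 t : 0 < wt t. Proof. exact: expR_gt0. Qed.

Let wt_le1 t : 0 <= t -> wt t <= 1.
Proof. by move=> t0; rewrite -expR0 ler_expR oppr_le0 mulr_ge0 // mulr_ge0 // ltW. Qed.

Let wt_cont : continuous wt.
Proof.
move=> t; apply: (@cvg_comp _ _ _ (fun t => - (2 * w * t)) expR); last exact: continuous_expR.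
by apply: cvgN; apply: cvgM; [exact: cvg_cst|exact: cvg_id].
Qed.

(** Expand |d b - J|^2 = |Q_(b-a) d a|^2 <= e^(2w(b-a)) |d a|^2 and drop the nonpositive term -
    |J|^2; the weight absorbs the growth factor. The pairing involves the trajectory at the right
    end b, which is why [cellup] rounds upwards. *)
Lemma energy_step u0 h a b : hL2 h -> 0 <= a -> a <= b -> b <= T ->
  wt b * `|traj u0 h b| ^+ 2 <= wt a * `|traj u0 h a| ^+ 2 +
    2 * (wt b * dot (traj u0 h b) (J Q a b h)).
Proof.
move=> hh a0 ab bT; have ba : 0 <= b - a by rewrite subr_ge0.
have := traj_flow L hQ w0 T0 u0 a0 ab bT hh.
set db := traj u0 h b; set da := traj u0 h a; set K := J Q a b h => e.
have e1 : db - K = Q (b - a) da by rewrite e addrK.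
have := normB2 L db K; rewrite e1 => e2.
have b1 : `|Q (b - a) da| ^+ 2 <= expR (2 * w * (b - a)) * `|da| ^+ 2.
  apply: (@le_trans _ _ ((expR (w * (b - a)) * `|da|) ^+ 2)).
    by rewrite lerXn2r ?nnegrE ?mulr_ge0 ?expR_ge0 //; exact: (sg_bound hQ).
  by rewrite exprMn -expRM_natl mulrA.
have b2 : wt b * `|Q (b - a) da| ^+ 2 <= wt a * `|da| ^+ 2.
  apply: le_trans (ler_wpM2l (ltW (wt_gt0 b)) b1) _.
  rewrite mulrA /wt -expRD (_ : _ + _ = - (2 * w * a)) //; ring.
have K0 := exprn_ge0 2 (normr_ge0 K).
have -> : `|db| ^+ 2 = `|Q (b - a) da| ^+ 2 + 2 * dot db K - `|K| ^+ 2.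
  by rewrite e2; ring.
have := mulr_ge0 (ltW (wt_gt0 b)) K0.
by rewrite mulrBr mulrDr; lra.
Qed.

Lemma energy u0 h t : hL2 h -> 0 < t -> t <= T ->
  wt t * `|traj u0 h t| ^+ 2 <= `|u0| ^+ 2 +
    2 * rint 0 t (fun s => wt s * dot (traj u0 h s) (h s)).
Proof.
move=> hh t0 tT; have [gh _] := hh.
pose D s := traj u0 h (clamp s).
have cD : continuous D by exact: traj_clamp_cont.
pose tau n : R := t / n.+1%:R.
have tau0 n : 0 < tau n by rewrite divr_gt0.
have tau_cvg : tau n @[n --> \oo] --> 0.
  by rewrite -(mulr0 t); apply: cvgM; [exact: cvg_cst|exact: cvg_harmonic].
have tauT n : tau n <= T.
  apply: le_trans tT; rewrite ler_pdivrMr // ler_peMr ?ler1n //; exact: ltW.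
pose p s := wt s *: D s.
have cp : continuous p.
  by move=> s; apply: cvgZ; [exact: wt_cont|exact: cD].
(* On a cell with right end b this is dot (p b) (Q (b - s) (h s)), whose integral over the cell is
   the pairing of [p b] with [J]. It converges pointwise as the mesh is refined. *)
pose psi n s := dot (p (cellup (tau n) s)) (Q (cellup (tau n) s - s) (h s)).
have mpsi n : measurable_fun setT (psi n).
  have mc := measurable_cellup (tau0 n).
  apply: good_dot.
    apply: (@good_comp _ _ _ (GRing.regular R) V p (cellup (tau n))) => //.
    exact: measurable_good.
  by apply: (orb_good hQ w0) => //; exact: measurable_funB.
pose B := M * (`|u0| + rint 0 T (fun s => `|h s|)).
have B0 : 0 <= B.
  rewrite mulr_ge0 ?(ltW (sgM_gt0 _ _)) // addr_ge0 //; exact: rint_ge0.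
have pB s : 0 <= s -> `|p s| <= B.
  move=> s0; rewrite /p normrZ gtr0_norm //.
  apply: (@le_trans _ _ (1 * B)); last by rewrite mul1r.
  apply: ler_pM => //; [exact: ltW|exact: wt_le1|].
  by apply: traj_bound => //; exact: clamp_itv.
have psiB n s : 0 <= s <= t -> `|psi n s| <= B * (M * `|h s|).
  move=> /andP[s0 st]; apply: le_trans (dot_le_norm _ _ _) _; apply: ler_pM => //.
    by apply: pB; apply: le_trans s0 _; exact: cellup_ge.
  apply: (sg_le hQ w0 T0); rewrite lerBlDl; apply: le_trans (cellup_le _ (tau0 n)) _.
  by rewrite lerD2l.
have gi : rintegrable 0 t (fun s => B * (M * `|h s|)).
  by do 2 apply: rintegrableZ; apply: (rintegrableS (lexx 0) tT); exact: hL2_L1.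
have psii n : rintegrable 0 t (psi n) by exact: rintegrable_bound gi (psiB n).
have step n k : (k <= n.+1)%N -> wt (k%:R * tau n) * `|traj u0 h (k%:R * tau n)| ^+ 2 <=
    `|u0| ^+ 2 + 2 * rint 0 (k%:R * tau n) (psi n).
  elim: k => [_|k IH kn].
    rewrite mul0r rint_point mulr0 addr0 /wt mulr0 oppr0 expR0 mul1r.
    have J0 : J Q 0 0 h = 0.
      apply/eqP; rewrite -normr_eq0 eq_le normr_ge0 andbT.
      apply: le_trans (J_norm L hQ w0 T0 (lexx 0) (lexx 0) (ltW T0) hh) _.
      by rewrite rint_point mulr0.
    by rewrite /traj J0 addr0 (sg_id hQ).
  set a := k%:R * tau n in IH *; set b := k.+1%:R * tau n.
  have a0 : 0 <= a by rewrite mulr_ge0 // ltW.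
  have ab : a <= b by rewrite ler_pM2r // ler_nat.
  have bt : b <= t.
    by rewrite /b /tau mulrCA ger_pMr // ler_pdivrMr // mul1r ler_nat.
  have bT := le_trans bt tT.
  apply: le_trans (energy_step u0 hh a0 ab bT) _.
  rewrite (rint_split a0 ab (rintegrableS (lexx 0) bt (psii n))) mulrDr addrA.
  apply: lerD; first exact: IH (ltnW kn).
  have -> : wt b * dot (traj u0 h b) (J Q a b h) = dot (p b) (J Q a b h).
    by rewrite /p /D clamp_id ?dotZl // bT (le_trans a0 ab).
  rewrite (J_dot L hQ w0 T0 _ a0 bT hh) ler_pM2l // le_eqVlt; apply/orP; left; apply/eqP.
  apply: rint_eq_oc.
  - exact: (dot_orb_integrable L hQ w0 T0).
  - exact: (rintegrableS a0 bt).
  - by move=> s sab; rewrite /psi (cellup_cell (tau0 n) sab).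
have cv : `|u0| ^+ 2 + 2 * rint 0 t (psi n) @[n --> \oo] -->
    `|u0| ^+ 2 + 2 * rint 0 t (fun s => wt s * dot (traj u0 h s) (h s)).
  apply: cvgD; first exact: cvg_cst.
  apply: cvgM; first exact: cvg_cst.
  apply: (rint_dominated mpsi gi) => // s /andP[s0 st].
  have -> : wt s * dot (traj u0 h s) (h s) = dot (p s) (Q 0 (h s)).
    by rewrite (sg_id hQ) // /p /D clamp_id ?dotZl // s0 (le_trans st).
  have c1 := @cellup_cvg _ tau s tau0 tau_cvg.
  have c2 : p (cellup (tau n) s) @[n --> \oo] --> p s by exact: (cvg_comp _ _ c1 (cp s)).
  have c3 : Q (cellup (tau n) s - s) (h s) @[n --> \oo] --> Q 0 (h s).
    apply: (@cvg_comp _ _ _ (fun n => cellup (tau n) s - s) (fun t => Q t (h s))); last first.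
      exact: (@sg_cvg _ _ _ _ hQ).
    by rewrite -(subrr s); apply: cvgB => //; exact: cvg_cst.
  have dE x y : dot x y = 2^-1 * (`|x + y| ^+ 2 - `|x| ^+ 2 - `|y| ^+ 2).
    by rewrite (normD2 L); field.
  have nE (x : nat -> V) y : x n @[n --> \oo] --> y -> `|x n| ^+ 2 @[n --> \oo] --> `|y| ^+ 2.
    move=> xy; have c : `|x n| @[n --> \oo] --> `|y| by exact: cvg_norm.
    exact: (cvg_comp _ _ c (@exprn_continuous R 2 _)).
  have dc (x y : nat -> V) u v : x n @[n --> \oo] --> u -> y n @[n --> \oo] --> v ->
      dot (x n) (y n) @[n --> \oo] --> dot u v.
    move=> xu yv; rewrite dE; under eq_fun do rewrite dE.
    apply: cvgM; first exact: cvg_cst.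
    by apply: cvgB; [apply: cvgB; apply: nE => //; exact: cvgD|exact: nE].
  exact: dc c2 c3.
rewrite -(cvg_lim _ cv) //; apply: limr_ge; first by apply/cvg_ex; eexists; exact: cv.
apply: nearW => n; have := step n n.+1 (leqnn _).
by rewrite (_ : n.+1%:R * tau n = t) // /tau mulrC divfK.
Qed.

(* The hypothesis on e expresses the monotonicity of the constraint force: it does not
   increase the energy. *)
Lemma energy_bound u0 h k e : hL2 h -> hL2 k -> hL2 e -> (forall s, h s = k s - e s) ->
  {ae @lebesgue_measure R, forall s, 0 <= s <= T -> 0 <= dot (traj u0 h s) (e s)} ->
  forall t, 0 <= t <= T ->
  `|traj u0 h t| <= M * (`|u0| + 2 * rint 0 T (fun s => `|k s|)).
Proof.
move=> hh hk he hE de.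
set N := rint 0 T _; have N0 : 0 <= N by exact: rint_ge0.
pose D s := traj u0 h (clamp s).
have cD : continuous D by exact: traj_clamp_cont.
pose m s := expR (- (w * s)) * `|D s|.
have cm : continuous m.
  move=> s; apply: cvgM; last by apply: cvg_norm; exact: cD.
  apply: (@cvg_comp _ _ _ (fun t => - (w * t)) expR); last exact: continuous_expR.
  by apply: cvgN; apply: cvgM; [exact: cvg_cst|exact: cvg_id].
have m0 s : 0 <= m s by apply: mulr_ge0 => //; exact: expR_ge0.
have m2 s : m s ^+ 2 = wt s * `|D s| ^+ 2.
  by rewrite exprMn -expRM_natl /wt; congr (expR _ * _); ring.
have wm s : 0 <= s -> wt s * `|D s| <= m s.
  move=> s0; apply: ler_wpM2r => //; rewrite /wt ler_expR lerN2.
  by rewrite -mulrA ler_peMl ?ler1n // mulr_ge0 // ltW.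
have mD s : `|D s| = expR (w * s) * m s by rewrite /m mulrA -expRD subrr expR0 mul1r.
clearbody m.
(* The maximum S of the weighted norm satisfies S^2 <= |u0|^2 + 2 S N, hence S <= |u0| + 2 N; no
   Gronwall argument is involved. *)
have [c cT mc] := @EVT_max R m 0 T (ltW T0) (continuous_subspaceT cm).
set S := m c in mc.
have S0 : 0 <= S by exact: m0.
have DE s : 0 <= s <= T -> D s = traj u0 h s by move=> hs; rewrite /D clamp_id.
have mt t : 0 <= t <= T -> m t ^+ 2 <= `|u0| ^+ 2 + 2 * (S * N).
  move=> /andP[t0 tT]; have [->|tn0] := eqVneq t 0.
    have := traj_bound; rewrite m2 DE ?lexx ?(ltW T0) // /wt mulr0 oppr0 expR0 mul1r.
    have J0 : J Q 0 0 h = 0.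
      apply/eqP; rewrite -normr_eq0 eq_le normr_ge0 andbT.
      apply: le_trans (J_norm L hQ w0 T0 (lexx 0) (lexx 0) (ltW T0) hh) _.
      by rewrite rint_point mulr0.
    by rewrite /traj J0 addr0 (sg_id hQ) // lerDl mulr_ge0 // mulr_ge0.
  have tp : 0 < t by rewrite lt_neqAle eq_sym tn0.
  rewrite m2 DE ?t0 //; apply: le_trans (energy u0 hh tp tT) _.
  rewrite lerD2l ler_pM2l //.
  have gD : good D.
    apply: (@good_comp _ _ _ (GRing.regular R) V D id) => //.
    by apply: measurable_good; exact: measurable_id.
  have mwt : measurable_fun setT wt by exact: continuous_measurable_fun.
  have DB s : `|D s| <= M * (`|u0| + rint 0 T (fun s => `|h s|)).
    by apply: traj_bound => //; exact: clamp_itv.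
  have ig (f : R -> V) : hL2 f -> rintegrable 0 t (fun s => wt s * dot (D s) (f s)).
    move=> [gf f2]; pose B := M * (`|u0| + rint 0 T (fun s => `|h s|)).
    apply: (rintegrable_bound (g := fun s => B * `|f s|)).
    - by apply: measurable_funM => //; exact: good_dot.
    - by apply: rintegrableZ; apply: (rintegrableS (lexx 0) tT); apply: hL2_L1; split.
    - move=> s /andP[s0 _]; rewrite normrM gtr0_norm //.
      apply: (@le_trans _ _ (1 * (`|D s| * `|f s|))).
        by apply: ler_pM => //; [exact: ltW|exact: wt_le1|exact: dot_le_norm].
      by rewrite mul1r ler_wpM2r // DB.
  rewrite (rint_eq (g := fun s => wt s * dot (D s) (k s) - wt s * dot (D s) (e s))); last first.
    move=> s /andP[s0 st]; rewrite DE ?s0 ?(le_trans st) // -mulrBr -dotBr.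
    by rewrite hE.
  rewrite rintB; [|exact: ig..].
  have e0 : 0 <= rint 0 t (fun s => wt s * dot (D s) (e s)).
    apply: rint_ge0_ae; first exact: ig.
    apply: (@ae_imply _ _ (fun s => 0 <= s <= t -> 0 <= wt s * dot (D s) (e s)) de) => s hs /andP[s0 st];
    have sT : 0 <= s <= T by rewrite s0 (le_trans st).
    by apply: mulr_ge0; [exact: ltW|rewrite DE // hs].
  apply: (@le_trans _ _ (rint 0 t (fun s => wt s * dot (D s) (k s)))); first by rewrite gerBl.
  have ik : rintegrable 0 t (fun s => S * `|k s|).
    by apply: rintegrableZ; apply: (rintegrableS (lexx 0) tT); exact: hL2_L1.
  apply: (@le_trans _ _ (rint 0 t (fun s => S * `|k s|))).
    apply: rint_le => //; first exact: ig.
    move=> s /andP[s0 st]; have sT : s \in `[0, T] by rewrite in_itv /= s0 (le_trans st).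
    apply: (@le_trans _ _ (wt s * (`|D s| * `|k s|))).
      by rewrite ler_pM2l // cauchy_schwarz.
    rewrite mulrA; apply: (ler_wpM2r (normr_ge0 _)).
    exact: (le_trans (wm s s0) (mc s sT)).
  rewrite rintZ; last by apply: (rintegrableS (lexx 0) tT); exact: hL2_L1.
  by rewrite ler_wpM2l //; apply: rint_mono => //; exact: hL2_L1.
have cT' : 0 <= c <= T by move: cT; rewrite in_itv.
have SS : S <= `|u0| + 2 * N.
  have := mt c cT'; rewrite -/S => h2; rewrite leNgt; apply/negP => hS.
  have u00 := normr_ge0 u0.
  have : `|u0| ^+ 2 <= `|u0| * S by rewrite expr2 ler_wpM2l //; apply: le_trans (ltW hS); lra.
  have : (`|u0| + 2 * N) * S < S ^+ 2 by rewrite expr2 ltr_pM2r //; lra.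
  by rewrite mulrDl -mulrA (mulrC N); lra.
move=> t ht; have /andP[t0 tT] := ht; rewrite -DE //.
rewrite mD; apply: (ler_pM (expR_ge0 _) (m0 t)); first by rewrite ler_expR ler_pM2l.
by apply: le_trans SS; apply: mc; rewrite in_itv.
Qed.

End energy.

(** * Generator and resolvent *)

Lemma rint_shift (R : realType) (a b : R) (f : R -> R) : 0 <= b -> continuous f ->
  rint a (a + b) f = rint 0 b (fun s => f (s + a)).
Proof.
rewrite le_eqVlt => /predU1P[<- _|b0 cf]; first by rewrite addr0 !rint_point.
pose F (s : R) := s + a.
have dF : (F^`() : R -> R)%classic = cst 1.
  by apply/funext => s; rewrite derive1E deriveD // derive_id derive_cst addr0.
have cF : continuous F by move=> s; apply: cvgD; [exact: cvg_id|exact: cvg_cst].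
have := @integration_by_substitution_increasing R F f 0 b (ltW b0).
have F0 : F 0 = a by rewrite /F add0r.
have Fb : F b = a + b by rewrite /F addrC.
rewrite dF F0 Fb => H; rewrite /rint /Rintegral; congr fine.
rewrite H //.
- by apply: eq_integral => s _; rewrite /= mulr1.
- by move=> x y _ _ xy; rewrite /F ltrD2r.
- by move=> x _; exact: cst_continuous.
- exact: is_cvg_cst.
- exact: is_cvg_cst.
- split; first by move=> x _; exact: derivableD.
    by apply: cvg_at_right_filter; exact: cF.
  by apply: cvg_at_left_filter; exact: cF.
- exact: continuous_subspaceT.
Qed.

Section resolvent.
Context (R : realType) (V : normedModType R) (L : hilbert_lattice V).
Variables (w : R) (Q : R -> {linear V -> V}) (hQ : growth_semigroup w Q).
Variables (T : R).
Hypotheses (w0 : 0 < w) (T0 : 0 < T).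
Local Notation dot := (dot L).
Local Notation M := (sgM w T).
Local Notation J := (J Q).
Implicit Types (a b h t k : R) (u v z : V).

(* v is in the domain of -N and N v = z *)
Definition gen v z := forall e, 0 < e -> exists2 d, 0 < d &
  forall h, 0 < h -> h <= d -> `|Q h v - v + h *: z| <= e * h.

Lemma genE v z : gen v z <-> generator Q (v, - z).
Proof.
have key h : 0 < h -> `|h^-1 *: (Q h v - v) + z| = h^-1 * `|Q h v - v + h *: z|.
  move=> h0.
  have -> : h^-1 *: (Q h v - v) + z = h^-1 *: (Q h v - v + h *: z).
    by rewrite [RHS]scalerDr scalerA mulVf ?gt_eqF // scale1r.
  by rewrite normrZ gtr0_norm ?invr_gt0.
split=> [g|/cvgrPdist_le g e e0].
  apply/cvgrPdist_le => e e0; have [d d0 hd] := g _ e0.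
  exists d => //= h; rewrite /ball_ /= sub0r normrN => hd' h0.
  rewrite -opprD normrN addrC key // mulrC ler_pdivrMr //; apply: hd => //.
  by rewrite gtr0_norm // in hd'; exact: ltW.
have [d /= d0 hd] := g _ e0; exists (d / 2); first by rewrite divr_gt0.
move=> h h0 hd2; have := hd h; rewrite /= sub0r normrN gtr0_norm // -opprD normrN.
rewrite addrC key // mulrC ler_pdivrMr // mulrC; apply => //.
by apply: le_lt_trans hd2 _; rewrite ltr_pdivrMr // ltr_pMr // ltr1n.
Qed.

Lemma gen_lin c v z v' z' : gen v z -> gen v' z' -> gen (v + c *: v') (z + c *: z').
Proof.
move=> g g' e e0; have c0 : 0 < `|c| + 1 by rewrite ltr_wpDl.
have e2 : 0 < e / 2 by rewrite divr_gt0.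
have e3 : 0 < e / 2 / (`|c| + 1) by rewrite divr_gt0.
have [d d0 hd] := g _ e2; have [d' d0' hd'] := g' _ e3.
exists (Num.min d d'); first by rewrite lt_min d0.
move=> h h0; rewrite le_min => /andP[h1 h2].
have -> : Q h (v + c *: v') - (v + c *: v') + h *: (z + c *: z') =
    (Q h v - v + h *: z) + c *: (Q h v' - v' + h *: z').
  rewrite linearD linearZ /= !scalerDr scalerN !scalerA (mulrC h) opprD.
  by rewrite [LHS](AC (2*2*2) ((1*3*5)*(2*4*6))).
apply: le_trans (ler_normD _ _) _; rewrite normrZ.
have l1 := hd h h0 h1; have l2 := hd' h h0 h2.
have l3 : `|c| * `|Q h v' - v' + h *: z'| <= e / 2 * h.
  apply: (@le_trans _ _ ((`|c| + 1) * (e / 2 / (`|c| + 1) * h))).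
    by apply: ler_pM => //; rewrite lerDl.
  rewrite le_eqVlt; apply/orP; left; apply/eqP.
  by field; rewrite gt_eqF.
by apply: le_trans (lerD l1 l3) _; lra.
Qed.

Lemma expR_sub1 (x : R) : 0 <= x -> x <= 2^-1 -> 0 <= expR x - 1 - x <= 2 * x ^+ 2.
Proof.
move=> x0 x2; have h1 := expR_ge1Dx x; have h2 := expR_ge1Dx (- x).
have ep := expR_gt0 x.
have : expR x * (1 - x) <= 1 by rewrite -[leRHS](expRxMexpNx_1 x) ler_pM2l.
by rewrite expr2 => h3; apply/andP; split; nra.
Qed.

(** Compare dot (Q_h v) v = |v|^2 - h dot z v + o(h) with the bound e^(wh) |v|^2. The factor 2 in 2
    w comes from the crude estimate e^x <= 1 + 2 x on [0, 1/2]. *)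
Lemma gen_dissipative v z : gen v z -> - (2 * w * `|v| ^+ 2) <= dot z v.
Proof.
move=> g; apply/ler_addgt0Pr => e e0.
have v1 : 0 < `|v| + 1 by rewrite ltr_wpDl.
have e1 : 0 < e / (`|v| + 1) by rewrite divr_gt0.
have [d d0 hd] := g _ e1.
pose h := Num.min d (2^-1 / w).
have h0 : 0 < h by rewrite lt_min d0 divr_gt0 // invr_gt0.
have hdd : h <= d by rewrite ge_min lexx.
have wh : w * h <= 2^-1 by rewrite mulrC -ler_pdivlMr // ge_min lexx orbT.
have := hd h h0 hdd; set r := _ - _ + _ => rh.
have E : dot (Q h v) v = `|v| ^+ 2 - h * dot z v + dot r v.
  by rewrite /r dotDl dotBl dotZl dot_norm; ring.
have b1 : dot (Q h v) v <= expR (w * h) * `|v| ^+ 2.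
  apply: le_trans (cauchy_schwarz _ _ _) _; rewrite expr2 mulrA ler_wpM2r //.
  exact/(sg_bound hQ)/ltW.
have /andP[_ b2] := expR_sub1 (mulr_ge0 (ltW w0) (ltW h0)) wh.
have b3 : - dot r v <= e * h.
  rewrite -dotNl; apply: le_trans (cauchy_schwarz _ _ _) _; rewrite normrN.
  apply: (@le_trans _ _ (e / (`|v| + 1) * h * (`|v| + 1))).
    by apply: ler_pM => //; rewrite lerDl.
  by rewrite mulrAC divfK // gt_eqF.
have n0 : 0 <= `|v| ^+ 2 by exact: exprn_ge0.
rewrite -subr_ge0 -(pmulr_rge0 _ h0).
move: E b1 b2 b3 wh n0; set N := `|v| ^+ 2; set D := dot z v; set r' := dot r v.
move=> E b1 b2 b3 wh n0.
have b4 : expR (w * h) * N <= (1 + 2 * (w * h)) * N.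
  rewrite ler_wpM2r //; have : 2 * (w * h) ^+ 2 <= w * h; last lra.
  by rewrite expr2 mulrA ler_piMl ?mulr_ge0 ?(ltW w0) ?(ltW h0) //; lra.
have -> : h * (D + e - - (2 * w * N)) = h * D + e * h + 2 * (w * h) * N by ring.
by move: b1; rewrite E; lra.
Qed.

Section positive.
Hypothesis Qpos : forall t u, 0 <= t -> ge0 L u -> ge0 L (Q t u).

(** Discrete form of v - Q_t v = int_0^t Q_s z ds: write v - Q_((j+1)h) v = Q_(jh) (v - Q_h v) + (v
    - Q_(jh) v), where v - Q_h v = h z - r with r small. Positive parts are subadditive, and
    positivity of Q gives (Q_s z)^+ <= Q_s z^+. *)
Lemma gen_pos_decay v z t : gen v z -> 0 <= t -> t <= T ->
  `|pos L (v - Q t v)| <= t * M * `|pos L z|.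
Proof.
move=> g t0 tT; have [->|tn0] := eqVneq t 0.
  rewrite (sg_id hQ) // subrr !mul0r; apply: le_trans (norm_pos_self _ _) _.
  by rewrite normr0.
have tp : 0 < t by rewrite lt_neqAle eq_sym tn0.
have M0 := sgM_gt0 w T.
(* Each of the n + 1 steps of length h = t / (n + 1) leaves a remainder of at most M (e / (t M)) h;
   together they make e. *)
apply/ler_addgt0Pr => e e0; have e1 : 0 < e / (t * M) by rewrite divr_gt0 // mulr_gt0.
have [d d0 hd] := g _ e1.
have [n hn] : exists n : nat, t / n.+1%:R <= d.
  have : (fun n => t * n.+1%:R^-1) @ \oo --> t * 0.
    by apply: cvgM; [exact: cvg_cst|exact: cvg_harmonic].
  rewrite mulr0 => /cvgrPdist_le /(_ _ d0) [n _ /(_ n (leqnn n))] /=.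
  by rewrite sub0r normrN => /(le_trans (ler_norm _)); exists n.
set h := t / n.+1%:R in hn.
have h0 : 0 < h by rewrite divr_gt0.
have := hd h h0 hn; set r := _ - _ + _ => rh.
have vE : v - Q h v = h *: z - r by rewrite /r opprD addrCA subrr addr0 opprB.
clearbody r.
have H j : (j <= n.+1)%N -> `|pos L (v - Q (j%:R * h) v)| <=
    j%:R * (h * M * `|pos L z| + M * (e / (t * M) * h)).
  elim: j => [_|j IH jn].
    rewrite !mul0r (sg_id hQ) // subrr; apply: le_trans (norm_pos_self _ _) _.
    by rewrite normr0.
  have jh0 : 0 <= j%:R * h by rewrite mulr_ge0 // ltW.
  have jhT : j%:R * h <= T.
    apply: le_trans tT; rewrite /h mulrCA ger_pMr // ler_pdivrMr // mul1r ler_nat ltnW //.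
  have -> : v - Q (j.+1%:R * h) v = Q (j%:R * h) (h *: z) +
      ((v - Q (j%:R * h) v) - Q (j%:R * h) r).
    rewrite -natr1 mulrDl mul1r (sgD hQ) ?(ltW h0) //.
    have -> : Q h v = v - (h *: z - r) by rewrite -vE subKr.
    have lin x y : Q (j%:R * h) (x - y) = Q (j%:R * h) x - Q (j%:R * h) y by exact: linearB.
    by rewrite !lin; apply: (dot_inj (L := L)) => x; rewrite !(dotDr, dotBr, dotNr); ring.
  apply: le_trans (ge0_norm_le (pos_ge0 _ _) (posD_ge0 _ _ _)) _.
  apply: le_trans (ler_normD _ _) _.
  have p1 : `|pos L (Q (j%:R * h) (h *: z))| <= h * M * `|pos L z|.
    apply: (@le_trans _ _ `|Q (j%:R * h) (h *: pos L z)|).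
      apply: norm_pos_le; first by apply: Qpos => //; apply: ge0Z; [exact: ltW|exact: pos_ge0].
      rewrite -linearB /= -scalerBr; apply: Qpos => //.
      by apply: ge0Z; [exact: ltW|exact: posB_ge0].
    apply: le_trans (sg_le hQ w0 T0 _ jhT) _.
    by rewrite normrZ gtr0_norm // mulrCA mulrA.
  have p2 : `|pos L ((v - Q (j%:R * h) v) - Q (j%:R * h) r)| <=
     `|pos L (v - Q (j%:R * h) v)| + M * (e / (t * M) * h).
    apply: le_trans (norm_posD _ _ _) _; rewrite lerD2l normrN.
    by apply: le_trans (sg_le hQ w0 T0 _ jhT) _; rewrite ler_pM2l.
  apply: le_trans (lerD p1 p2) _; have := IH (ltnW jn).
  by rewrite -natr1 [_ * M]mulrC; set A := M * h * _; set B := M * _; lra.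
have := H n.+1 (leqnn _).
have -> : n.+1%:R * h = t by rewrite /h mulrC divfK.
move=> /le_trans; apply.
have hn1 : n.+1%:R * h = t by rewrite /h mulrC divfK.
set p := `|pos L z|; set E := e / _.
have -> : n.+1%:R * (h * M * p + M * (E * h)) =
   (n.+1%:R * h) * M * p + M * E * (n.+1%:R * h) by ring.
rewrite hn1 lerD2l /E le_eqVlt; apply/orP; left; apply/eqP.
by field; rewrite !gt_eqF.
Qed.

End positive.

Variable k : R.
Hypothesis k0 : 0 <= k.

(* G b u is the integral over [0, b] of e^{-k s} Q_s u *)
Definition G b u : V := J 0 b (fun s => expR (- (k * (b - s))) *: u).
Definition Rk t u : V := expR (- (k * t)) *: Q t u.

Lemma G_arg_hL2 b u : b <= T -> hL2 T (fun s => expR (- (k * (b - s))) *: u).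
Proof.
move=> bT.
have cf : continuous (fun s : R => expR (- (k * (b - s)))).
  move=> s; apply: (@cvg_comp _ _ _ (fun s => - (k * (b - s))) expR); last exact: continuous_expR.
  by apply: cvgN; apply: cvgM; [exact: cvg_cst|apply: cvgB; [exact: cvg_cst|exact: cvg_id]].
have gf : good (fun s : R => expR (- (k * (b - s))) *: u).
  apply: (@goodZ _ _ _ _ (fun s : R => expR (- (k * (b - s)))) (fun _ => u)).
    exact: continuous_measurable_fun.
  exact: good_cst.
split=> //; apply: (rintegrable_bound (g := fun _ => (expR (k * (T + `|b|)) * `|u|) ^+ 2)).
- by apply: measurable_funX; exact: good_norm.
- exact: rintegrable_const.
- move=> s /andP[s0 sT]; rewrite ger0_norm ?exprn_ge0 // lerXn2r ?nnegrE ?mulr_ge0 ?expR_ge0 //.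
  rewrite normrZ gtr0_norm ?expR_gt0 // ler_wpM2r // ler_expR -mulrN ler_wpM2l // opprB.
  by rewrite lerD // -normrN ler_norm.
Qed.

Lemma Rk_cvg u t : Rk s u @[s --> t] --> Rk t u.
Proof.
apply: cvgZ; last exact: (@sg_cvg _ _ _ _ hQ).
apply: (@cvg_comp _ _ _ (fun s => - (k * s)) expR); last exact: continuous_expR.
by apply: cvgN; apply: cvgM; [exact: cvg_cst|exact: cvg_id].
Qed.

Lemma G_dot b u v : b <= T -> dot v (G b u) = rint 0 b (fun s => dot v (Rk (b - s) u)).
Proof.
move=> bT; rewrite (J_dot L hQ w0 T0) //; last exact: G_arg_hL2.
by apply: rint_eq => s _; rewrite linearZ.
Qed.

Lemma G_add a b u : 0 <= a -> 0 <= b -> a + b <= T ->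
  G (a + b) u = Rk b (G a u) + G b u.
Proof.
move=> a0 b0 abT.
have aT : a <= T by apply: le_trans abT; rewrite lerDl.
have bT : b <= T by apply: le_trans abT; rewrite lerDr.
have hf := G_arg_hL2 u abT.
have aab : a <= a + b by rewrite lerDl.
rewrite {1}/G (J_split L hQ w0 T0 (lexx 0) a0 aab abT hf).
have -> : a + b - a = b by rewrite addrC addKr.
congr (_ + _); apply: (dot_inj (L := L)) => v.
  have hl := lin_form_sg hQ w0 b (lin_form_dot L v).
  rewrite (J_form L hQ w0 T0 (lexx 0) aT hf hl) /Rk /G -linearZ /= -(JZ L hQ w0 T0) //; last first.
    exact: G_arg_hL2.
  have hf2 : hL2 T (fun s => expR (- (k * b)) *: (expR (- (k * (a - s))) *: u)).
    by apply: hL2Z; exact: G_arg_hL2.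
  rewrite (J_form L hQ w0 T0 (lexx 0) aT hf2 hl); apply: rint_eq => s _.
  by rewrite scalerA -expRD; congr (dot v (Q _ (Q _ (expR _ *: _)))); ring.
rewrite (J_dot L hQ w0 T0 _ a0 abT hf) G_dot // rint_shift //; last first.
  move=> s; rewrite (_ : (fun s => _) = (fun s => dot v (Rk (a + b - s) u))); last first.
    by apply/funext => s'; rewrite linearZ.
  apply: (@cvg_comp _ _ _ (fun s => Rk (a + b - s) u) (dot v)); last exact: dot_continuous.
  apply: (@cvg_comp _ _ _ (fun s => a + b - s) (Rk ^~ u)); last exact: Rk_cvg.
  by apply: cvgB; [exact: cvg_cst|exact: cvg_id].
apply: rint_eq => s _; rewrite linearZ /= -/(Rk _ _).
have -> : a + b - (s + a) = b - s by ring.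
by [].
Qed.

(** Split G (a + b) u in the two possible orders. This exchanges R_h - I acting on a long integral
    for R_a - I acting on a short one, which is what differentiating G requires. *)
Lemma G_comm a b u : 0 <= a -> 0 <= b -> a + b <= T ->
  Rk b (G a u) - G a u = Rk a (G b u) - G b u.
Proof.
move=> a0 b0 abT; have baT : b + a <= T by rewrite addrC.
have := G_add u b0 a0 baT; rewrite (addrC b a) (G_add u a0 b0 abT).
move: (G a u) (G b u) (Rk b _) (Rk a _) => p q x y e.
by rewrite -(addrK q x) e (addrAC y p) addrK.
Qed.

Lemma RkZ t c u : Rk t (c *: u) = c *: Rk t u.
Proof.
have e : Q t (c *: u) = c *: Q t u by exact: linearZ.
by rewrite /Rk e scalerA (mulrC _ c) -scalerA.
Qed.

Lemma RkD t u v : Rk t (u + v) = Rk t u + Rk t v.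
Proof. by rewrite /Rk linearD scalerDr. Qed.

Lemma RkB t u v : Rk t (u - v) = Rk t u - Rk t v.
Proof. by rewrite RkD -scaleN1r RkZ scaleN1r. Qed.

Lemma Rk_norm t u : 0 <= t -> t <= T -> `|Rk t u| <= M * `|u|.
Proof.
move=> t0 tT; rewrite normrZ gtr0_norm ?expR_gt0 //.
apply: le_trans (sg_le hQ w0 T0 _ tT); by rewrite ler_piMl // -expR0 ler_expR oppr_le0 mulr_ge0.
Qed.

Lemma G_small u e : 0 < e -> exists2 d, 0 < d & forall h, 0 < h -> h <= d ->
  h <= T /\ `|G h u - h *: u| <= e * h.
Proof.
move=> e0; have := @Rk_cvg u 0; rewrite {2}/Rk (sg_id hQ) // mulr0 oppr0 expR0 scale1r.
move=> /cvgrPdist_le /(_ _ e0)[d /= d0 hd].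
exists (Num.min (d / 2) T); first by rewrite lt_min T0 divr_gt0.
move=> h h0; rewrite le_min => /andP[h1 hT]; split => //.
apply: (norm_le_dot (L := L)) => [|v]; first by rewrite mulr_ge0 // ltW.
have ii : rintegrable 0 h (fun s => dot v (Rk (h - s) u)).
  apply: rintegrable_eq (dot_orb_integrable L hQ w0 T0 v (lexx 0) hT (G_arg_hL2 u hT)).
  by move=> s _; rewrite linearZ.
have -> : dot v (G h u - h *: u) = rint 0 h (fun s => dot v (Rk (h - s) u) - dot v u).
  rewrite rintB //; last exact: rintegrable_const.
  by rewrite dotBr G_dot // dotZr rint_const ?(ltW h0) // subr0 mulrC.
apply: (@le_trans _ _ (rint 0 h (fun _ => `|v| * e))); last first.
  by rewrite rint_const ?(ltW h0) // subr0 mulrA.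
apply: rint_le; [apply: rintegrableB => //; exact: rintegrable_const|exact: rintegrable_const|].
move=> s /andP[s0 sh]; rewrite -dotBr; apply: le_trans (cauchy_schwarz _ _ _) _.
rewrite ler_wpM2l // distrC; apply: hd.
rewrite /= sub0r normrN ger0_norm ?subr_ge0 //; apply: (@le_lt_trans _ _ h).
  by rewrite gerBl.
by apply: le_lt_trans h1 _; rewrite ltr_pdivrMr // ltr_pMr // ltr1n.
Qed.

(** The damped semigroup e^(-kt) Q_t has generator - (N + k): if its derivative at v is - y, then N
    v = y - k v. *)
Lemma gen_of_Rk v y : 0 < k -> (forall e, 0 < e -> exists2 d, 0 < d &
  forall h, 0 < h -> h <= d -> `|Rk h v - v + h *: y| <= e * h) ->
  gen v (y - k *: v).
Proof.
move=> kp H e e0; have e4 : 0 < e / 4 by rewrite divr_gt0.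
have [d d0 hd] := H _ e4.
(* The second-order terms are at most 2 k^2 |v| h^2, from e^(kh) - 1 - kh, and 2 k |y| h^2, from
   (e^(kh) - 1) h. *)
pose c := 2 * k ^+ 2 * `|v| + 2 * k * `|y| + 1.
have c0 : 0 < c by rewrite ltr_wpDl // addr_ge0 // !mulr_ge0 ?exprn_ge0 // ltW.
exists (Num.min d (Num.min (2^-1 / k) (e / 2 / c))).
  by rewrite !lt_min d0 !divr_gt0 // invr_gt0.
move=> h h0; rewrite !le_min => /and3P[h1 h2 h3].
have kh : k * h <= 2^-1 by rewrite mulrC -ler_pdivlMr.
have kh0 : 0 <= k * h by rewrite mulr_ge0 // ltW.
have /andP[x1 x2] := expR_sub1 kh0 kh.
set x := expR (k * h) in x1 x2 *.
have x0 : 0 < x by exact: expR_gt0.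
have xs : x - 1 <= 2 * (k * h).
  have : 2 * (k * h) ^+ 2 <= k * h; last by move: x2; lra.
  by rewrite expr2 mulrA ler_piMl //; lra.
have QE : Q h v = x *: Rk h v.
  by rewrite /Rk scalerA -expRD subrr expR0 scale1r.
have alg (r : V) : x *: r - v + h *: (y - k *: v) =
    x *: (r - v + h *: y) + (x - 1 - k * h) *: v - ((x - 1) * h) *: y.
  apply: (dot_inj (L := L)) => u.
  by rewrite !(dotDr, dotBr, dotNr, dotZr, dotDl); ring.
rewrite QE alg.
apply: le_trans (ler_normB _ _) _; apply: le_trans (lerD (ler_normD _ _) (lexx _)) _.
have xh0 : 0 <= (x - 1) * h by rewrite mulr_ge0 ?(ltW h0) //; move: x1; lra.
rewrite (normrZ x) (normrZ (x - 1 - k * h)) (normrZ ((x - 1) * h)).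
rewrite (gtr0_norm x0) (ger0_norm x1) (ger0_norm xh0).
have t1 : x * `|Rk h v - v + h *: y| <= 2 * (e / 4 * h).
  apply: ler_pM => //; [exact: ltW| |exact: hd].
  by move: xs kh; lra.
have t2 : (x - 1 - k * h) * `|v| <= 2 * k ^+ 2 * `|v| * h * h.
  apply: le_trans (ler_wpM2r (normr_ge0 v) x2) _.
  by rewrite le_eqVlt; apply/orP; left; apply/eqP; ring.
have t3 : (x - 1) * h * `|y| <= 2 * k * `|y| * h * h.
  apply: (@le_trans _ _ (2 * (k * h) * h * `|y|)); last first.
    by rewrite le_eqVlt; apply/orP; left; apply/eqP; ring.
  by rewrite ler_wpM2r // ler_wpM2r // ltW.
have t4 : c * h <= e / 2 by rewrite mulrC -ler_pdivlMr.
have t5 : c * h * h <= e / 2 * h by rewrite ler_wpM2r // ltW.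
move: t1 t2 t3 t5; rewrite /c.
set a1 := x * _; set a2 := (_ - k * h) * _; set a3 := _ * h * `|y|.
have hh := mulr_ge0 (ltW h0) (ltW h0).
rewrite !mulrDl mul1r; lra.
Qed.

End resolvent.

(** * Density of the domain and existence of the resolvent *)

Section resolvent_existence.
Context (R : realType) (V : normedModType R) (L : hilbert_lattice V).
Variables (w : R) (Q : R -> {linear V -> V}) (hQ : growth_semigroup w Q).
Variables (T : R).
Hypotheses (w0 : 0 < w) (T0 : 0 < T).
Local Notation dot := (dot L).
Local Notation M := (sgM w T).
Local Notation gen := (gen Q).
Implicit Types (a b h t k : R) (u v z : V).

(** Means of the damped orbit over short intervals lie in the domain: by [G_comm], R_h - I applied
    to G_b u is R_b - I applied to G_h u, that is h (R_b u - u) + o(h). Damping by k = 1 allows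
    [gen_of_Rk], stated for k > 0. *)
Lemma gen_dense u e : 0 < e -> exists v z, gen v z /\ `|v - u| <= e.
Proof.
move=> e0; have M0 := sgM_gt0 w T.
have k0 : 0 < (1 : R) by exact: ltr01.
have [d d0 hd] := G_small L hQ w0 T0 (ltW k0) u e0.
pose b := Num.min d (T / 2).
have b0 : 0 < b by rewrite lt_min d0 divr_gt0.
have bd : b <= d by rewrite ge_min lexx.
have bT2 : b <= T / 2 by rewrite ge_min lexx orbT.
have bT : b <= T by move: bT2 T0; lra.
have [_ gb] := hd b b0 bd.
exists (b^-1 *: G Q 1 b u), (- (b^-1 *: (Rk Q 1 b u - u)) - 1 *: (b^-1 *: G Q 1 b u)); split; last first.
  have -> : b^-1 *: G Q 1 b u - u = b^-1 *: (G Q 1 b u - b *: u).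
    by rewrite scalerBr scalerA mulVf ?gt_eqF // scale1r.
  by rewrite normrZ gtr0_norm ?invr_gt0 // mulrC ler_pdivrMr.
apply: (gen_of_Rk L (ltW k0) k0) => e1 e10.
have e2 : 0 < e1 * b / (M + 1) by rewrite divr_gt0 ?mulr_gt0 // ltr_wpDl // ltW.
have [d' d'0 hd'] := G_small L hQ w0 T0 (ltW k0) u e2.
exists (Num.min d' (T / 2)); first by rewrite lt_min d'0 divr_gt0.
move=> h h0; rewrite le_min => /andP[h1 h2].
have [_ gh] := hd' h h0 h1.
have bh : b + h <= T by move: bT2 h2; lra.
have hT : h <= T by move: h2 T0; lra.
have -> : Rk Q 1 h (b^-1 *: G Q 1 b u) - b^-1 *: G Q 1 b u + h *: - (b^-1 *: (Rk Q 1 b u - u)) =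
    b^-1 *: (Rk Q 1 b (G Q 1 h u - h *: u) - (G Q 1 h u - h *: u)).
  rewrite RkZ RkB RkZ.
  have := G_comm L hQ w0 T0 (ltW k0) u (ltW b0) (ltW h0) bh.
  set x1 := Rk Q 1 h _; set x2 := Rk Q 1 b _; set x3 := Rk Q 1 b u.
  set y1 := G Q 1 b u; set y2 := G Q 1 h u => cm.
  clearbody x1 x2 x3 y1 y2; have -> : x1 = x2 - y2 + y1 by rewrite -cm subrK.
  by apply: (dot_inj (L := L)) => x; rewrite !(dotDr, dotBr, dotNr, dotZr, dotDl); ring.
rewrite normrZ gtr0_norm ?invr_gt0 // mulrC ler_pdivrMr //.
apply: le_trans (ler_normB _ _) _.
have l1 := Rk_norm hQ w0 T0 (ltW k0) (G Q 1 h u - h *: u) (ltW b0) bT.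
apply: le_trans (lerD l1 (lexx _)) _.
apply: (@le_trans _ _ ((M + 1) * (e1 * b / (M + 1) * h))).
  by rewrite mulrDl mul1r lerD // ler_pM2l.
rewrite le_eqVlt; apply/orP; left; apply/eqP; field.
by rewrite gt_eqF // ltr_wpDl // ltW.
Qed.

(** For k above this value, (k - w) T / 2 >= 1, so the damped semigroup at time T / 2 contracts by
    1/2 ([gen_surjective]); for l below its inverse, 4 w l <= 1, which absorbs the dissipation
    defect ([gen_norm]). *)
Definition resolvent_bound : R := 4 * w + 2 / T + 1.

Lemma resolvent_bound_gt0 : 0 < resolvent_bound.
Proof.
have h : 0 < 2 / T by rewrite divr_gt0.
by rewrite /resolvent_bound; move: w0; lra.
Qed.

(* v = k G_a u + R_a v with |R_a| <= 1/2, solved by iteration, where a = T / 2 *)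
Lemma gen_surjective k u : resolvent_bound <= k -> exists v, gen v (k *: (u - v)).
Proof.
move=> kb; have k0 : 0 < k := lt_le_trans resolvent_bound_gt0 kb.
pose a := T / 2; have a0 : 0 < a by rewrite divr_gt0.
have aT : a <= T by rewrite /a; move: T0; lra.
have R2 x : `|Rk Q k a x| <= 2^-1 * `|x|.
  rewrite normrZ gtr0_norm ?expR_gt0 //.
  apply: le_trans (ler_wpM2l (expR_ge0 _) (sg_bound hQ _ (ltW a0))) _.
  rewrite mulrA ler_wpM2r // -expRD.
  have : 1 <= k * a - w * a.
    rewrite -mulrBl; apply: (@le_trans _ _ (2 / T * a)).
      by rewrite /a mulrA divfK // ?divff // gt_eqF.
    rewrite ler_pM2r //; move: kb w0; rewrite /resolvent_bound; lra.
  set x' := _ - _ => x1; have -> : - (k * a) + w * a = - x' by rewrite /x'; ring.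
  rewrite expRN lef_pV2 ?posrE ?expR_gt0 //.
  by apply: le_trans (expR_ge1Dx _); move: x1; lra.
(* The fixed point is k int_0^oo e^(-ks) Q_s u ds, summed over blocks of length a. *)
pose it := fix it n : V := if n is n'.+1 then k *: G Q k a u + Rk Q k a (it n') else 0.
have itS n : it n.+1 = k *: G Q k a u + Rk Q k a (it n) by [].
have itd n : `|it n.+1 - it n| <= `|it 1%N - it 0%N| * 2^-1 ^+ n.
  elim: n => [|n IH]; first by rewrite expr0 mulr1.
  have -> : it n.+2 - it n.+1 = Rk Q k a (it n.+1 - it n).
    by rewrite RkB itS [in X in _ - X]itS opprD addrACA subrr add0r.
  apply: le_trans (R2 _) _; rewrite exprS mulrCA ler_pM2l ?invr_gt0 //.
have [v iv] := fast_cauchy_cvg (@hilbert_complete _ _ L) itd.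
have cR : Rk Q k a (it n) @[n --> \oo] --> Rk Q k a v.
  apply/cvgrPdist_le => e e0; move/cvgrPdist_le: iv => /(_ _ e0)[n0 _ hn].
  exists n0 => // n /= nn; rewrite -RkB; apply: le_trans (R2 _) _.
  apply: le_trans (hn n nn); by rewrite ler_piMl // invf_le1 ?ler1n.
have vE : v = k *: G Q k a u + Rk Q k a v.
  have c1 : it n.+1 @[n --> \oo] --> k *: G Q k a u + Rk Q k a v.
    by apply: cvgD; [exact: cvg_cst|exact: cR].
  have c2 : it n.+1 @[n --> \oo] --> v.
    by have := iv; rewrite -(@cvg_shiftS V it).
  by apply: (cvg_unique _ c2 c1).
exists v.
have Rv h : 0 < h -> h <= a -> Rk Q k h v - v = - (k *: G Q k h u).
  move=> h0 ha; have ahT : a + h <= T by rewrite /a in ha *; lra.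
  (* By commutation y is fixed by R_a, a contraction, so it vanishes. *)
  set y := Rk Q k h v - v + k *: G Q k h u.
  suff : y = 0 by move/eqP; rewrite addr_eq0 => /eqP.
  have Rc x : Rk Q k a (Rk Q k h x) = Rk Q k h (Rk Q k a x).
    rewrite /Rk !linearZ /= !scalerA -(sgD hQ) ?(ltW a0) ?(ltW h0) //.
    by rewrite addrC (sgD hQ) ?(ltW a0) ?(ltW h0) // mulrC.
  have yE : y = Rk Q k a y.
    rewrite /y RkD RkB Rc [Rk Q k a (k *: _)]RkZ.
    have e1 : Rk Q k a v = v - k *: G Q k a u by rewrite {2}vE addrC addKr.
    rewrite e1 RkB [Rk Q k h (k *: _)]RkZ.
    have := G_comm L hQ w0 T0 (ltW k0) u (ltW a0) (ltW h0) ahT.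
    set x1 := Rk Q k h (G _ _ _ _); set x2 := Rk Q k a (G _ _ _ _).
    set x3 := Rk Q k h v; set x4 := G Q k a u; set x5 := G Q k h u => cm.
    clearbody x1 x2 x3 x4 x5; have -> : x1 = x2 - x5 + x4 by rewrite -cm subrK.
    by apply: (dot_inj (L := L)) => x; rewrite !(dotDr, dotBr, dotNr, dotZr, dotDl); ring.
  apply/eqP; rewrite -normr_le0; have := R2 y; rewrite -yE; have := normr_ge0 y; lra.
have -> : k *: (u - v) = k *: u - k *: v by rewrite scalerBr.
apply: (gen_of_Rk L (ltW k0) k0) => e e0.
have e1 : 0 < e / k by rewrite divr_gt0.
have [d d0 hd] := G_small L hQ w0 T0 (ltW k0) u e1.
exists (Num.min d a); first by rewrite lt_min d0.
move=> h h0; rewrite le_min => /andP[h1 h2].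
have [_ gh] := hd h h0 h1.
have -> : Rk Q k h v - v + h *: (k *: u) = - (k *: (G Q k h u - h *: u)).
  by rewrite Rv // scalerBr opprB addrC !scalerA (mulrC h).
by rewrite normrN normrZ gtr0_norm // mulrC -ler_pdivlMr // mulrAC.
Qed.

(** Pairing v + l z = u with v and using dissipativity gives (1 - 2 w l) |v|^2 <= |u| |v|, and 2 w l
    <= 1/2. *)
Lemma gen_norm l v z u : gen v z -> 0 < l -> l <= resolvent_bound^-1 ->
  v + l *: z = u -> `|v| <= 2 * `|u|.
Proof.
move=> g l0 lb uE; have rb := resolvent_bound_gt0.
have wl : 4 * w * l <= 1.
  apply: (@le_trans _ _ (resolvent_bound * l)); last first.
    by rewrite mulrC -ler_pdivlMr // div1r.
  rewrite ler_pM2r // /resolvent_bound; have h : 0 < 2 / T by rewrite divr_gt0.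
  by move: h; lra.
have := cauchy_schwarz L u v; rewrite -{1}uE dotDl dotZl dot_norm.
have := gen_dissipative L hQ w0 g; set D := dot z v; set N := `|v| ^+ 2 => h1 h2.
have [->|vn0] := eqVneq v 0; first by rewrite normr0 mulr_ge0.
have v0 : 0 < `|v| by rewrite normr_gt0.
rewrite -(ler_pM2r v0) -expr2 -/N.
have N0 : 0 <= N by exact: exprn_ge0.
have h3 : l * - (2 * w * N) <= l * D by rewrite ler_pM2l.
have h4 : 4 * w * l * N <= 1 * N by rewrite ler_wpM2r.
rewrite -[leRHS]mulrA.
by move: h2 h3 h4; set a := `|u| * `|v|; lra.
Qed.

Lemma gen_dist l v z u v' z' u' : gen v z -> gen v' z' -> 0 < l -> l <= resolvent_bound^-1 ->
  v + l *: z = u -> v' + l *: z' = u' -> `|v - v'| <= 2 * `|u - u'|.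
Proof.
move=> g g' l0 lb <- <-.
have := gen_norm (gen_lin (-1) g g') l0 lb erefl.
rewrite !scaleN1r; congr (_ <= 2 * `|_|).
by rewrite scalerDr scalerN addrACA opprD.
Qed.

Variable N : set (V * V).
Hypothesis hN : forall u z, N (u, z) <-> gen u z.

(** Surjectivity with k = 1/l shows that [xget] returns a genuine solution rather than its default
    0. *)
Lemma resolventP l u : 0 < l -> l <= resolvent_bound^-1 ->
  gen (resolvent N l u) (yosida N l u) /\ resolvent N l u + l *: yosida N l u = u.
Proof.
move=> l0 lb; have rb := resolvent_bound_gt0.
have eY : resolvent N l u + l *: yosida N l u = u.
  by rewrite /yosida scalerA divff ?gt_eqF // scale1r addrC subrK.
split => //.
have lk : resolvent_bound <= l^-1 by rewrite -(invrK resolvent_bound) lef_pV2 ?posrE ?invr_gt0.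
have [v gv] := gen_surjective u lk.
have : [set v | exists2 z, N (v, z) & v + l *: z = u] v.
  exists (l^-1 *: (u - v)); first exact/hN.
  by rewrite scalerA divff ?gt_eqF // scale1r addrC subrK.
move=> Pv; have [z Nz e] := xgetPex 0 (ex_intro _ v Pv).
have <- : z = yosida N l u.
  rewrite /yosida -{1}e /resolvent [X in X - _]addrC addrK scalerA mulVf ?gt_eqF //.
  by rewrite scale1r.
exact/hN.
Qed.

Lemma resolvent_lip l u u' : 0 < l -> l <= resolvent_bound^-1 ->
  `|resolvent N l u - resolvent N l u'| <= 2 * `|u - u'|.
Proof.
move=> l0 lb; have [g e] := resolventP u l0 lb; have [g' e'] := resolventP u' l0 lb.
exact: (gen_dist g g' l0 lb e e').
Qed.

Lemma resolvent_cvg u e : 0 < e -> exists2 d, 0 < d & forall l, 0 < l -> l <= d ->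
  `|resolvent N l u - u| <= e.
Proof.
(* The budget is 2 (e/6 + e/4) + e/6 = e: the factor 2 is the Lipschitz constant of the resolvent,
   e/6 the density error and e/4 the term l |z|. *)
move=> e0; have e6 : 0 < e / 6 by rewrite divr_gt0.
have [y [z [g yu]]] := gen_dense u e6.
have z1 : 0 < `|z| + 1 by rewrite ltr_wpDl.
exists (Num.min resolvent_bound^-1 (e / 4 / (`|z| + 1))).
  by rewrite lt_min invr_gt0 resolvent_bound_gt0 !divr_gt0.
move=> l l0; rewrite le_min => /andP[lb l2].
have [g' e'] := resolventP u l0 lb.
have d1 := gen_dist g' g l0 lb e' erefl.
rewrite -(subrKA y); apply: le_trans (ler_normD _ _) _.
have d2 : `|u - (y + l *: z)| <= e / 6 + e / 4.
  rewrite opprD addrA; apply: le_trans (ler_normB _ _) _; apply: lerD.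
    by rewrite distrC.
  rewrite normrZ gtr0_norm // mulrC; apply: (@le_trans _ _ ((`|z| + 1) * l)).
    by rewrite ler_wpM2r ?(ltW l0) // lerDl.
  by rewrite mulrC -ler_pdivlMr.
by move: d1 d2 yu; lra.
Qed.

Lemma yosida_continuous l : 0 < l -> l <= resolvent_bound^-1 -> continuous (yosida N l).
Proof.
move=> l0 lb u; rewrite /yosida; apply: cvgZr; apply: cvgB; first exact: cvg_id.
apply/cvgrPdist_le => e e0; near=> x.
apply: le_trans (resolvent_lip _ _ l0 lb) _; rewrite mulrC -ler_pdivlMr //.
near: x; apply: cvgr_dist_le; last by rewrite divr_gt0.
exact: cvg_id.
Unshelve. all: by end_near. Qed.

End resolvent_existence.

(** * The obstacle on a mesh *)

Section mesh.
Context (R : realType) (V : normedModType R) (L : hilbert_lattice V).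
Variables (w : R) (Q : R -> {linear V -> V}) (hQ : growth_semigroup w Q).
Variables (T : R).
Hypotheses (w0 : 0 < w) (T0 : 0 < T).
Hypothesis Qpos : forall t u, 0 <= t -> ge0 L u -> ge0 L (Q t u).
Local Notation M := (sgM w T).
Implicit Types (a b h t l tau : R) (u v z : V).

Lemma norm_pos_lip u v : `| `|pos L u| - `|pos L v| | <= `|u - v|.
Proof.
have H x y : `|pos L x| <= `|pos L y| + `|x - y|.
  by have := norm_posD L y (x - y); rewrite addrC subrK.
rewrite ler_norml; have := H u v; have := H v u; rewrite (distrC v u).
by move=> h1 h2; apply/andP; split; lra.
Qed.

Lemma norm_pos_continuous : continuous (fun u => `|pos L u|).
Proof.
move=> u; apply/cvgrPdist_le => e e0; near=> v.
apply: le_trans (norm_pos_lip _ _) _; near: v.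
by apply: cvgr_dist_le => //; exact: cvg_id.
Unshelve. all: by end_near. Qed.

Lemma rint_cells tau n f : 0 <= tau -> rintegrable 0 (n%:R * tau) f ->
  \sum_(k < n) rint (k%:R * tau) (k.+1%:R * tau) f = rint 0 (n%:R * tau) f.
Proof.
move=> t0; elim: n => [_|n IH fi]; first by rewrite big_ord0 mul0r rint_point.
have nn : n%:R * tau <= n.+1%:R * tau by rewrite ler_wpM2r // ler_nat.
have n0 : 0 <= n%:R * tau by rewrite mulr_ge0.
rewrite big_ord_recr /= IH; last exact: rintegrableS fi.
by rewrite -rint_split.
Qed.

Lemma uniform_small n (P : nat -> R -> Prop) :
  (forall k, (k < n)%N -> exists2 d, 0 < d & forall l, 0 < l -> l <= d -> P k l) ->
  exists2 d, 0 < d & forall l, 0 < l -> l <= d -> forall k, (k < n)%N -> P k l.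
Proof.
elim: n => [_|n IH H]; first by exists 1.
have [d d0 hd] := IH (fun k kn => H k (ltnW kn)).
have [d' d'0 hd'] := H n (ltnSn n).
exists (Num.min d d'); first by rewrite lt_min d0.
move=> l l0; rewrite le_min => /andP[l1 l2] k; rewrite ltnS leq_eqVlt => /predU1P[->|kn].
  exact: hd'.
exact: hd.
Qed.

Variable N : set (V * V).
Hypothesis hN : forall u z, N (u, z) <-> gen Q u z.
Variables (g : R -> V) (Lg C l0 : R).
Hypothesis gLip : forall s t, 0 <= s -> s <= t -> t <= T -> `|g t - g s| <= Lg * (t - s).
Hypothesis l00 : 0 < l0.
Hypothesis gY : forall l, 0 < l -> l <= l0 ->
  (\int[@lebesgue_measure R]_(t in `[0%R, T]) (`|pos L (yosida N l (g t))| ^+ 2)%:E <= C%:E)%E.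

Let Lg0 : 0 <= Lg.
Proof.
have := gLip (lexx 0) (ltW T0) (lexx T); rewrite subr0 => /(le_trans (normr_ge0 _)).
by rewrite pmulr_lge0.
Qed.

(** The integral bound is uniform in l, so l may depend on the mesh. For any s of a cell, both g at
    the ends of the cell and v, the resolvent of g s, agree up to O(tau), so the jump is compared
    with (v - Q_tau v)^+ and bounded by tau (M |(N_l g s)^+| + A). Squaring and averaging over s
    turns the sum over the cells into the integral of |(N_l g)^+|^2. *)
Lemma mesh_sum : exists2 K, 0 <= K & forall n, (0 < n)%N ->
  \sum_(k < n) `|pos L (g (k.+1%:R * (T / n%:R)) -
    Q (T / n%:R) (g (k%:R * (T / n%:R))))| ^+ 2 <= K * (T / n%:R).
Proof.
have M0 := sgM_gt0 w T; have rb := resolvent_bound_gt0 w0 T0.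
pose A := (1 + M) * (4 * Lg + 1).
pose K := 2 * (M ^+ 2 * Num.max C 0 + A ^+ 2 * T).
have C0 : 0 <= Num.max C 0 by rewrite le_max lexx orbT.
have K0 : 0 <= K.
  by rewrite /K mulr_ge0 // addr_ge0 // mulr_ge0 ?sqr_ge0 // ltW.
exists K => // n n0; set tau := T / n%:R.
have nR : 0 < n%:R :> R by rewrite ltr0n.
have tau0 : 0 < tau by rewrite divr_gt0.
have nT : n%:R * tau = T by rewrite /tau mulrC divfK // gt_eqF.
have tauT : tau <= T by rewrite /tau ler_pdivrMr // ler_peMr ?(ltW T0) // ler1n.
have [d d0 hd] : exists2 d, 0 < d & forall l, 0 < l -> l <= d -> forall k, (k < n)%N ->
    `|resolvent N l (g (k%:R * tau)) - g (k%:R * tau)| <= tau.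
  by apply: uniform_small => k _; exact: (resolvent_cvg L hQ w0 T0 hN).
(* The three bounds on l secure the approximation within tau at the nodes, the integral hypothesis,
   and the existence of the resolvent. *)
pose l := Num.min d (Num.min l0 (resolvent_bound w T)^-1).
have lp : 0 < l by rewrite !lt_min d0 l00 invr_gt0.
have ld : l <= d by rewrite ge_min lexx.
have ll0 : l <= l0 by rewrite !ge_min lexx !orbT.
have lb : l <= (resolvent_bound w T)^-1 by rewrite !ge_min lexx !orbT.
pose Y s := `|pos L (yosida N l (g (clamp T s)))|.
have cY : continuous Y.
  move=> s; apply: (@cvg_comp _ _ _ (fun s => g (clamp T s)) (fun u => `|pos L (yosida N l u)|)).
    exact: (modulus_clamp_cont T0 (lipschitz_modulus Lg0 gLip)).
  apply: (@cvg_comp _ _ _ (yosida N l) (fun u => `|pos L u|)).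
    exact: (yosida_continuous L hQ w0 T0 hN lp lb).
  exact: norm_pos_continuous.
have mY2 : measurable_fun setT (fun s => Y s ^+ 2).
  by apply: measurable_funX; exact: continuous_measurable_fun.
have eY : (\int[@lebesgue_measure R]_(t in `[0%R, T]) (Y t ^+ 2)%:E <= C%:E)%E.
  apply: le_trans (gY lp ll0); rewrite le_eqVlt; apply/orP; left; apply/eqP.
  by apply: eq_integral => t; rewrite inE /= in_itv /= => ht; rewrite /Y clamp_id.
have iY : rintegrable 0 T (fun s => Y s ^+ 2).
  apply/integrableP; split; first exact/measurable_EFinP/measurable_funTS.
  apply: le_lt_trans (ltry C); apply: le_trans eY; rewrite le_eqVlt; apply/orP; left; apply/eqP.
  by apply: eq_integral => t _; rewrite gee0_abs // lee_fin sqr_ge0.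
have rY : rint 0 T (fun s => Y s ^+ 2) <= Num.max C 0.
  rewrite le_max -lee_fin /rint /Rintegral fineK ?eY //.
  exact: integrable_fin_num.
set S := fun k => pos L (g (k.+1%:R * tau) - Q tau (g (k%:R * tau))).
have Sk k s : (k < n)%N -> k%:R * tau <= s <= k.+1%:R * tau -> `|S k| <= tau * (M * Y s + A).
  move=> kn /andP[ks sk].
  have k0 : 0 <= k%:R * tau by rewrite mulr_ge0 // ltW.
  have kT : k.+1%:R * tau <= T by rewrite -nT ler_pM2r // ler_nat.
  have k1 : k.+1%:R * tau = k%:R * tau + tau by rewrite -natr1 mulrDl mul1r.
  have s0 := le_trans k0 ks; have sT := le_trans sk kT.
  have kkT : k%:R * tau <= T by exact: le_trans ks sT.
  have [gn ye] := resolventP L hQ w0 T0 hN (g s) lp lb.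
  set v := resolvent N l (g s) in gn ye; set z := yosida N l (g s) in gn ye.
  have YE : Y s = `|pos L z| by rewrite /Y clamp_id // s0.
  have Ls : `|g s - g (k%:R * tau)| <= Lg * tau.
    apply: le_trans (gLip k0 ks sT) _; rewrite ler_wpM2l //; move: sk; rewrite k1; lra.
  have Ls1 : `|g (k.+1%:R * tau) - g s| <= Lg * tau.
    apply: le_trans (gLip s0 sk kT) _; rewrite ler_wpM2l //; move: ks; rewrite k1; lra.
  (* 2 Lg from the Lipschitz constant of the resolvent, 1 from the approximation at the node, Lg
     from g itself; one more Lg in [b1] and [b2] gives 4 Lg + 1. *)
  have vg : `|v - g s| <= (3 * Lg + 1) * tau.
    have -> : v - g s = (v - resolvent N l (g (k%:R * tau))) +
        (resolvent N l (g (k%:R * tau)) - g (k%:R * tau)) - (g s - g (k%:R * tau)).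
      by rewrite !subrKA opprB addrA subrK.
    apply: le_trans (ler_normB _ _) _; apply: le_trans (lerD (ler_normD _ _) (lexx _)) _.
    have h1 := resolvent_lip L hQ w0 T0 hN (g s) (g (k%:R * tau)) lp lb.
    have h2 := hd l lp ld k kn.
    by rewrite -/v in h1; move: h1 h2 Ls; lra.
  have b1 : `|g (k.+1%:R * tau) - v| <= (4 * Lg + 1) * tau.
    rewrite -(subrKA (g s)); apply: le_trans (ler_normD _ _) _.
    by rewrite (distrC _ v); move: vg Ls1; lra.
  have b2 : `|g (k%:R * tau) - v| <= (4 * Lg + 1) * tau.
    rewrite -(subrKA (g s)); apply: le_trans (ler_normD _ _) _.
    by rewrite (distrC (g s) v) (distrC (g (k%:R * tau))); move: vg Ls; lra.
  have -> : S k = pos L ((v - Q tau v) + ((g (k.+1%:R * tau) - v) - Q tau (g (k%:R * tau) - v))).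
    rewrite /S; congr pos; rewrite linearB /=.
    by apply: (dot_inj (L := L)) => x; rewrite !(dotDr, dotBr, dotNr); ring.
  apply: le_trans (norm_posD _ _ _) _.
  have p1 := gen_pos_decay hQ w0 T0 Qpos gn (ltW tau0) tauT.
  have p2 : `|(g (k.+1%:R * tau) - v) - Q tau (g (k%:R * tau) - v)| <= A * tau.
    apply: le_trans (ler_normB _ _) _; rewrite /A mulrDl mul1r mulrDl; apply: lerD => //.
    apply: le_trans (sg_le hQ w0 T0 _ tauT) _; rewrite -mulrA ler_pM2l //.
  by rewrite YE; move: p1 p2; set p := `|pos L z|; lra.
have A0 : 0 <= A by rewrite mulr_ge0 ?addr_ge0 ?mulr_ge0 // ltW.
(* (M Y + A)^2 <= 2 (M^2 Y^2 + A^2) makes the squared jump at most tau (f s) for every s of the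
   cell, hence at most the integral of f over the cell, which has length tau. *)
pose f s := 2 * tau * (M ^+ 2 * Y s ^+ 2 + A ^+ 2).
have fi : rintegrable 0 T f.
  apply: rintegrableZ; apply: rintegrableD; first exact: rintegrableZ.
  exact: rintegrable_const.
apply: (@le_trans _ _ (\sum_(k < n) rint (k%:R * tau) (k.+1%:R * tau) f)).
  apply: ler_sum => k _; have kn := ltn_ord k.
  have kk : k%:R * tau <= k.+1%:R * tau by rewrite ler_pM2r // ler_nat.
  have kT : k.+1%:R * tau <= T by rewrite -nT ler_pM2r // ler_nat.
  have k0 : 0 <= k%:R * tau by rewrite mulr_ge0 // ltW.
  have k1 : k.+1%:R * tau - k%:R * tau = tau by rewrite -mulrBl -natr1 addrAC subrr add0r mul1r.
  suff key : rint (k%:R * tau) (k.+1%:R * tau) (fun _ => `|S k| ^+ 2) <=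
      rint (k%:R * tau) (k.+1%:R * tau) (fun s => tau * f s).
    rewrite rint_const // k1 rintZ in key; last exact: (rintegrableS k0 kT).
    by rewrite -(ler_pM2r tau0) [leRHS]mulrC.
  apply: rint_le; first exact: rintegrable_const.
    exact/rintegrableZ/(rintegrableS k0 kT).
  move=> s hs; have Y0 : 0 <= Y s by exact: normr_ge0.
  apply: (@le_trans _ _ ((tau * (M * Y s + A)) ^+ 2)).
    have h0 : 0 <= tau * (M * Y s + A).
      apply: mulr_ge0; first exact: ltW.
      by apply: addr_ge0 => //; apply: mulr_ge0 => //; exact: ltW.
    rewrite lerXn2r ?nnegrE //; exact: (Sk k s kn hs).
  rewrite exprMn /f.
  have := sqr_ge0 (M * Y s - A); rewrite sqrrB sqrrD exprMn => h.
  have t2 : 0 <= tau ^+ 2 by exact: exprn_ge0 (ltW tau0).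
  have -> : tau * (2 * tau * (M ^+ 2 * Y s ^+ 2 + A ^+ 2)) =
     tau ^+ 2 * (2 * (M ^+ 2 * Y s ^+ 2 + A ^+ 2)) by ring.
  rewrite ler_wpM2l //; move: h; rewrite !mulr2n; lra.
rewrite rint_cells ?(ltW tau0) ?nT // /f rintZ; last first.
  by apply: rintegrableD; [exact: rintegrableZ|exact: rintegrable_const].
rewrite rintD; [|exact: rintegrableZ|exact: rintegrable_const].
rewrite rintZ // rint_const ?(ltW T0) // subr0 /K [leRHS]mulrAC.
have t2 : 0 <= 2 * tau by rewrite mulr_ge0 // ltW.
apply: (ler_wpM2l t2); rewrite lerD2r.
by apply: ler_wpM2l => //; rewrite exprn_ge0 // ltW.
Qed.

End mesh.

(** * W1infty functions are Lipschitz *)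

Section lipschitz.
Context (R : realType) (V : normedModType R).
Local Notation mu := (@lebesgue_measure R).
Variables (a b : R) (g : R -> V).

Lemma Linfty_ge0_bound (g' : R -> V) : bochner_Linfty mu `[a, b] g' ->
  exists2 B : R, 0 <= B & {ae mu, forall x, x \in `[a, b] -> `|g' x| <= B}.
Proof.
move=> [_ [B [N [mN N0 hN]]]]; exists (Num.max B 0); first by rewrite le_max lexx orbT.
exists N; split => // x /= nx; apply: hN => /= h; apply: nx => xab.
by rewrite le_max h.
Qed.

Section cousin.
Variables (B : R) (E O : set R).
Hypothesis B0 : 0 <= B.
Hypothesis dE : forall t, a <= t <= b -> ~ E t -> exists2 d, 0 < d & forall y,
  `|y - t| <= d -> `|g y - g t| <= B * `|y - t|.
Hypotheses (oO : open O) (EO : E `<=` O).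

Local Notation piece := (R * R)%type.

(* [reach u x s]: the increment of g over [u, x] is controlled by B outside the disjoint
   pieces in s, which lie in O *)
Definition reach (u x : R) (s : seq piece) : Prop :=
  [/\ all (fun p => (u <= p.1) && (p.1 <= p.2) && (p.2 <= x)) s,
      pairwise (fun p q => q.2 <= p.1) s,
      ((\sum_(p <- s) (p.2 - p.1))%:E <= mu (O `&` `[u, x]))%E &
      `|g x - g u| <= B * (x - u) + \sum_(p <- s) `|g p.2 - g p.1|].

Let mO : measurable O. Proof. exact: open_measurable. Qed.

Lemma reach_derive u y x s : u <= y -> y <= x -> reach u y s ->
  `|g x - g y| <= B * (x - y) -> reach u x s.
Proof.
move=> uy yx [s1 s2 s3 s4] h; split => //.
- by apply: sub_all s1 => p /andP[-> py] /=; exact: le_trans py yx.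
- apply: le_trans s3 _; apply: le_measure; rewrite ?inE; try exact: measurableI.
  by apply: setIS; apply: subset_itv; rewrite bnd_simp.
- rewrite -(subrKA (g y)); apply: le_trans (ler_normD _ _) _.
  by apply: le_trans (lerD h s4) _; rewrite addrA -mulrDr subrKA.
Qed.

Lemma reach_piece u y x s : u <= y -> y <= x -> reach u y s ->
  `[y, x] `<=` O -> reach u x ((y, x) :: s).
Proof.
move=> uy yx [s1 s2 s3 s4] yxO; split => /=.
- rewrite uy yx lexx /=.
  by apply: sub_all s1 => p /andP[-> py] /=; exact: le_trans py yx.
- by rewrite s2 andbT; apply: sub_all s1 => p /andP[_].
- rewrite big_cons /= addrC EFinD.
  have -> : O `&` `[u, x] = (O `&` `[u, y]) `|` `]y, x]%classic.
    apply/seteqP; split=> z /=; rewrite !in_itv /=.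
      by move=> [Oz /andP[uz zx]]; have [zy|yz] := leP z y; [left; rewrite uz|right].
    move=> [[Oz /andP[uz zy]]|/andP[yz zx]].
      by rewrite uz (le_trans zy).
    split; first by apply: yxO; rewrite /= in_itv /= (ltW yz).
    by rewrite zx (le_trans uy (ltW yz)).
  have -> : (mu ((O `&` `[u, y]) `|` `]y, x]) = mu (O `&` `[u, y]) + mu `]y, x])%E.
    apply: measureU => //; first exact: measurableI.
    apply/seteqP; split=> z //= [[_]]; rewrite !in_itv /= => /andP[_ zy] /andP[yz _].
    by have := lt_le_trans yz zy; rewrite ltxx.
  apply: leeD => //; rewrite lebesgue_measure_itv /=.
  move: yx; rewrite le_eqVlt => /predU1P[->|yx].
    by rewrite lte_fin ltxx subrr.
  by rewrite lte_fin yx EFinB.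
- rewrite big_cons /= -(subrKA (g y)); apply: le_trans (ler_normD _ _) _.
  have : B * (y - u) <= B * (x - u) by rewrite ler_wpM2l // lerD2r.
  by move: s4; lra.
Qed.

Lemma local_step t : a <= t <= b -> exists2 d, 0 < d & forall y x, y <= t -> t <= x ->
  t - y <= d -> x - t <= d -> y = t \/ x = t ->
  `|g x - g y| <= B * (x - y) \/ `[y, x] `<=` O.
Proof.
move=> tab; have [Et|nE] := pselect (E t).
  have /nbhs_ballP[d /= d0 hd] : nbhs t O by apply: open_nbhs_nbhs; split => //; exact: EO.
  exists (d / 2); first by rewrite divr_gt0.
  move=> y x yt tx h1 h2 _; right => z /=; rewrite in_itv /= => /andP[yz zx].
  apply: hd; rewrite /ball /= ltr_norml; apply/andP; split; lra.
have [d d0 hd] := dE tab nE; exists d => // y x yt tx h1 h2 [e|e]; left.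
  by rewrite e in h1 yt *; have := hd x; rewrite ger0_norm ?subr_ge0 //; apply.
have := hd y; rewrite e distrC ger0_norm ?subr_ge0 // => /(_ h1).
by rewrite distrC.
Qed.

(** Continuity argument: by [local_step] the supremum of the reachable points is reached from the
    left, and if it were below v a step to the right would pass it. *)
Lemma reach_all u v : a <= u -> u <= v -> v <= b -> exists s, reach u v s.
Proof.
move=> au uv vb.
pose S := [set x | u <= x <= v /\ exists s, reach u x s].
have Su : S u.
  split; first by rewrite lexx.
  exists [::]; split => //=; first by rewrite big_nil.
  by rewrite !subrr normr0 mulr0 big_nil addr0.
have hS : has_sup S by split; [exists u|exists v => x [/andP[]]].
set c := sup S.
have uc : u <= c by apply: sup_upper_bound.
have cv : c <= v by apply: ge_sup; [exists u|move=> x [/andP[]]].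
have cab : a <= c <= b by rewrite (le_trans au uc) (le_trans cv vb).
have [d d0 hd] := local_step cab.
have Sc : S c.
  have [x Sx cx] := sup_adherent d0 hS.
  have xc : x <= c by apply: sup_upper_bound.
  have [/andP[ux _] [s rs]] := Sx.
  split; first by rewrite uc.
  have cxd : c - x <= d by rewrite lerBlDl -lerBlDr ltW.
  have [h|h] := hd x c xc (lexx c) cxd (eq_ind_r (fun z => z <= d) (ltW d0) (subrr c)) (or_intror erefl).
    by exists s; exact: reach_derive rs h.
  by exists ((x, c) :: s); exact: reach_piece.
have [_ [s rs]] := Sc.
have [cv'|] := eqVneq c v; first by exists s; rewrite -cv'.
move=> cnv; have cltv : c < v by rewrite lt_neqAle cnv.
exfalso; pose x := Num.min v (c + d).
have cx : c < x by rewrite lt_min cltv ltrDl.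
suff : S x by move=> /(sup_upper_bound hS); rewrite -/c leNgt cx.
split; first by rewrite (le_trans uc (ltW cx)) ge_min lexx.
have xd : x - c <= d by rewrite lerBlDl ge_min lexx orbT.
have [h|h] := hd c x (lexx c) (ltW cx) (eq_ind_r (fun z => z <= d) (ltW d0) (subrr c)) xd (or_introl erefl).
  by exists s; exact: (reach_derive uc (ltW cx) rs h).
by exists ((c, x) :: s); exact: (reach_piece uc (ltW cx) rs h).
Qed.

End cousin.

Lemma derive_local (t : R) (l : V) B : is_derive t 1 g l -> `|l| < B ->
  exists2 d, 0 < d & forall y, `|y - t| <= d -> `|g y - g t| <= B * `|y - t|.
Proof.
move=> [dg gl] lB.
have : (h^-1 *: (g (h + t) - g t)) @[h --> 0^'] --> l.
  rewrite -gl; have := dg; rewrite /derivable /derive.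
  by under eq_fun do rewrite /= [_ *: 1]mulr1.
move=> /cvg_norm /(cvgr_lt `|l|) /(_ _ lB) [d /= d0 hd].
exists (d / 2); first by rewrite divr_gt0.
move=> y yt; have [->|ynt] := eqVneq y t; first by rewrite !subrr !normr0 mulr0.
have yt0 : y - t != 0 by rewrite subr_eq0.
have := hd (y - t); rewrite /ball_ /= sub0r normrN.
have ytd : `|y - t| < d.
  by apply: le_lt_trans yt _; rewrite ltr_pdivrMr // ltr_pMr // ltr1n.
move=> /(_ ytd yt0); rewrite subrK normrZ normfV => /ltW.
by rewrite mulrC ler_pdivrMr ?normr_gt0.
Qed.

(** The null set where the derivative fails to exist or to be bounded lies in an open set of measure
    less than the r of absolute continuity. The increments over the pieces inside this set add up to
    less than e; outside them the derivative bound applies. *)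
Lemma W1infty_lipschitz : W1infty a b g -> exists2 K, 0 <= K &
  forall u v, a <= u -> u <= v -> v <= b -> `|g v - g u| <= K * (v - u).
Proof.
move=> [ac [g' /Linfty_ge0_bound[B B0 [N1 [mN1 N10 hN1]]] [N2 [mN2 N20 hN2]]]].
(* The local estimate [derive_local] needs a constant strictly above the norm of the derivative. *)
exists (B + 1); first by rewrite addr_ge0.
pose E := N1 `|` N2.
have mE : measurable E by exact: measurableU.
have E0 : mu E = 0%E by exact: null_set_setU.
move=> u v au uv vb; apply/ler_addgt0Pr => e e0.
have [r r0 hr] := ac e e0.
have Ef : (mu E < +oo)%E by rewrite E0.
have [U [oU EU muU]] := @lebesgue_regularity_outer R E r mE Ef r0.
have dE t : a <= t <= b -> ~ E t -> exists2 d, 0 < d & forall y,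
  `|y - t| <= d -> `|g y - g t| <= (B + 1) * `|y - t|.
  move=> tab nE; have tab' : t \in `[a, b] by rewrite in_itv.
  have gB : `|g' t| <= B.
    by apply: contrapT => h; apply: nE; left; apply: hN1 => /= /(_ tab').
  have dg : is_derive t 1 g (g' t).
    by apply: contrapT => h; apply: nE; right; apply: hN2 => /= /(_ tab').
  by apply: derive_local dg _; rewrite (le_lt_trans gB) // ltrDl.
have B10 : 0 <= B + 1 by rewrite addr_ge0.
have [s [s1 s2 s3 s4]] := reach_all B10 dE oU EU au uv vb.
apply: le_trans s4 _; rewrite lerD2l.
have muUr : (mu (U `&` `[u, v]) < r%:E)%E.
  apply: le_lt_trans muU.
  have mU := open_measurable oU.
  have mUE : measurable (U `\` E) by exact: measurableD.
  have h1 : (mu (U `&` `[u, v]) <= mu ((U `\` E) `|` E))%E.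
    apply: le_measure; rewrite ?inE; [exact: measurableI|exact: measurableU|].
    by move=> x [Ux _]; have [Ex|nEx] := pselect (E x); [right|left].
  have h2 : (mu ((U `\` E) `|` E) <= mu (U `\` E) + mu E)%E by exact: measureU2.
  by apply: le_trans h1 _; rewrite E0 adde0 in h2.
pose F (i : 'I_(size s)) := tnth (in_tuple s) i.
have Fs i : F i \in s by rewrite mem_tnth.
have := hr (size s) (fun i => (F i).1) (fun i => (F i).2).
rewrite -(big_tnth _ _ s xpredT (fun p => `|g p.2 - g p.1|)).
rewrite -(big_tnth _ _ s xpredT (fun p => p.2 - p.1)) => H.
apply/ltW/H.
- move=> i; have /andP[/andP[h1 h2] h3] := allP s1 _ (Fs i).
  by rewrite h2 (le_trans au h1) (le_trans h3 vb).
- apply/trivIsetP => i j _ _ ij.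
  wlog lij : i j ij / (i < j)%N.
    move=> W; have [|ji|ijE] := ltngtP i j; first exact: W.
      by rewrite setIC; apply: W => //; rewrite eq_sym.
    by move: ij; rewrite (ord_inj ijE) eqxx.
  have := pairwiseP (0, 0) s2 i j; rewrite !inE !ltn_ord => /(_ isT isT lij) le.
  have Fe k : F k = nth (0, 0) s k by rewrite /F (tnth_nth (0, 0)).
  apply/seteqP; split=> z //= []; rewrite !in_itv /= !Fe => /andP[iz _] /andP[_ zj].
  by have := lt_trans iz zj; rewrite ltNge le.
- by rewrite -lte_fin; exact: le_lt_trans s3 muUr.
Qed.

End lipschitz.

(** * The scheme *)

Section scheme.
Context (R : realType) (V : normedModType R) (L : hilbert_lattice V).
Variables (w : R) (Q : R -> {linear V -> V}) (hQ : growth_semigroup w Q).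
Variables (T : R).
Hypotheses (w0 : 0 < w) (T0 : 0 < T).
Hypothesis Qpos : forall t u, 0 <= t -> ge0 L u -> ge0 L (Q t u).
Local Notation M := (sgM w T).
Local Notation ge0 := (ge0 L).
Local Notation pos := (pos L).
Local Notation dot := (dot L).
Variable ob : R -> V.
Hypothesis ob0 : ge0 (- ob 0).
Implicit Types (tau : R) (k n m : nat).

(* x + pos (o - x) is the maximum of x and o *)
Fixpoint chi tau k : V := if k is j.+1 then
  let x := Q tau (chi tau j) in x + pos (ob (j.+1%:R * tau) - x) else 0.

Definition inc tau k : V := pos (ob (k.+1%:R * tau) - Q tau (chi tau k)).

Lemma chiS tau k : chi tau k.+1 = Q tau (chi tau k) + inc tau k.
Proof. by []. Qed.

Lemma chi_ge0 tau k : 0 <= tau -> ge0 (chi tau k).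
Proof.
move=> t0; elim: k => [|k IH]; first exact: ge0_0.
by rewrite chiS; apply: ge0D; [exact: Qpos|exact: pos_ge0].
Qed.

Lemma chi_ob tau k : ge0 (chi tau k - ob (k%:R * tau)).
Proof.
case: k => [|k]; first by rewrite mul0r /= sub0r.
rewrite chiS /inc; set o := ob _; set x := Q _ _.
have -> : x + pos (o - x) - o = pos (o - x) - (o - x) by rewrite opprB addrA addrAC addrC addrA.
exact: posB_ge0.
Qed.

(** The scheme lies above the obstacle at time k tau, and positivity carries this through Q_tau, so
    replacing the scheme by the obstacle can only enlarge the jump. *)
Lemma inc_le tau k : 0 <= tau ->
  `|inc tau k| <= `|pos (ob (k.+1%:R * tau) - Q tau (ob (k%:R * tau)))|.
Proof.
move=> t0; apply: norm_pos_le; first exact: pos_ge0.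
set b := ob _ - _; set a := ob _ - _.
rewrite -(subrKA b); apply: ge0D; first exact: posB_ge0.
have -> : b - a = Q tau (chi tau k - ob (k%:R * tau)).
  have -> : Q tau (chi tau k - ob (k%:R * tau)) = Q tau (chi tau k) - Q tau (ob (k%:R * tau)).
    exact: linearB.
  by rewrite /b /a; apply: (dot_inj (L := L)) => x; rewrite !(dotDr, dotBr, dotNr); ring.
by apply: Qpos => //; exact: chi_ob.
Qed.

(** The new value minus the obstacle is the negative part of the quantity whose positive part is the
    jump. *)
Lemma inc_orth tau k : dot (inc tau k) (chi tau k.+1 - ob (k.+1%:R * tau)) = 0.
Proof.
rewrite chiS /inc; set o := ob _; set x := Q _ _.
have -> : x + pos (o - x) - o = pos (o - x) - (o - x) by rewrite opprB addrA addrAC addrC addrA.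
exact: dot_pos.
Qed.

(** By induction two half steps dominate Q_tau (chi tau k), by positivity, and they dominate the
    obstacle at the same time, by [chi_ob]; minimality of the positive part then puts them above the
    full step. *)
Lemma chi_half tau k : 0 <= tau -> ge0 (chi (tau / 2) (2 * k) - chi tau k).
Proof.
move=> t0; have t20 : 0 <= tau / 2 by rewrite divr_ge0.
elim: k => [|k IH]; first by rewrite muln0 subrr; exact: ge0_0.
have -> : (2 * k.+1 = (2 * k).+2)%N by rewrite mulnS add2n.
set x := chi (tau / 2) (2 * k) in IH *.
rewrite (chiS tau) opprD addrA; apply: pos_min.
  rewrite chiS (chiS _ (2 * k)) linearD /= -/x.
  have -> : Q tau (chi tau k) = Q (tau / 2) (Q (tau / 2) (chi tau k)).
    by rewrite -(sgD hQ) // -splitr.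
  set q := Q (tau / 2).
  have -> : q (q x) + q (inc (tau / 2) (2 * k)) + inc (tau / 2) (2 * k).+1 - q (q (chi tau k)) =
      inc (tau / 2) (2 * k).+1 + (q (inc (tau / 2) (2 * k)) + q (q (x - chi tau k))).
    have -> : q (q (x - chi tau k)) = q (q x) - q (q (chi tau k)) by rewrite !linearB.
    move: (q (q x)) (q (q (chi tau k))) (q (inc _ _)) (inc _ _.+1) => a b c e.
    by apply: (dot_inj (L := L)) => y; rewrite !(dotDr, dotBr, dotNr); ring.
  apply: ge0D; first exact: pos_ge0.
  by apply: ge0D; apply: Qpos => //; [exact: pos_ge0|exact: Qpos].
rewrite opprB addrA subrK.
have := chi_ob (tau / 2) (2 * k).+2.
have -> : (2 * k).+2%:R * (tau / 2) = k.+1%:R * tau.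
  have -> : ((2 * k).+2 = 2 * k.+1)%N by rewrite mulnS add2n.
  by rewrite natrM; field.
by [].
Qed.

Lemma chi_flow tau j m : 0 <= tau -> chi tau (j + m) =
  Q (m%:R * tau) (chi tau j) + \sum_(i < m) Q ((m - i.+1)%:R * tau) (inc tau (j + i)).
Proof.
move=> t0; elim: m => [|m IH].
  by rewrite addn0 mul0r big_ord0 addr0 (sg_id hQ).
rewrite addnS chiS IH linearD /= linear_sum /= big_ord_recr /= subnn mul0r (sg_id hQ _ (lexx 0)).
rewrite addrA; congr (_ + _ + _).
  by rewrite -(sgD hQ) ?mulr_ge0 // -natr1 mulrDl mul1r addrC.
apply: eq_bigr => i _; have im := ltn_ord i.
rewrite -(sgD hQ) ?mulr_ge0 //; congr (Q _ _).
by rewrite subSn // -natr1 mulrDl mul1r addrC.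
Qed.

Lemma sum_sqr n (a : nat -> R) : (\sum_(i < n) a i) ^+ 2 <= n%:R * \sum_(i < n) a i ^+ 2.
Proof.
case: n => [|n]; first by rewrite !big_ord0 expr0n mul0r.
set S := \sum_(i < _) a i; set A := \sum_(i < _) _.
have n0 : 0 < n.+1%:R :> R by rewrite ltr0n.
have H c : 2 * c * S <= n.+1%:R * c ^+ 2 + A.
  rewrite /S /A mulr_sumr.
  have -> : n.+1%:R * c ^+ 2 = \sum_(i < n.+1) c ^+ 2.
    by rewrite big_const cardE size_enum_ord iter_addr addr0 mulr_natl.
  rewrite -big_split /=; apply: ler_sum => i _.
  by have := sqr_ge0 (c - a i); rewrite sqrrB -mulr_natl; lra.
have := H (S / n.+1%:R); rewrite -(ler_pM2l n0).
have -> : n.+1%:R * (2 * (S / n.+1%:R) * S) = 2 * S ^+ 2.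
  by field; rewrite gt_eqF.
have -> : n.+1%:R * (n.+1%:R * (S / n.+1%:R) ^+ 2 + A) = S ^+ 2 + n.+1%:R * A.
  by field; rewrite gt_eqF.
lra.
Qed.

Lemma sum_le_sub (a : nat -> R) j m n : (forall i, 0 <= a i) -> (j + m <= n)%N ->
  \sum_(i < m) a (j + i)%N <= \sum_(i < n) a i.
Proof.
move=> a0 jm; rewrite -(big_mkord xpredT (fun i => a (j + i)%N)) -[leRHS](big_mkord xpredT a).
have -> : \sum_(0 <= i < m) a (j + i)%N = \sum_(j <= i < j + m) a i.
  rewrite -{2}[j]add0n big_addn addKn; apply: eq_bigr => i _; by rewrite addnC.
rewrite (@big_cat_nat _ _ _ (j + m) 0 n) //= (@big_cat_nat _ _ _ j 0 (j + m)) ?leq_addr //=.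
by rewrite addrAC lerDr addr_ge0 // sumr_ge0.
Qed.

Variable K : R.
Hypothesis K0 : 0 <= K.
Hypothesis ob_mesh : forall n, (0 < n)%N ->
  \sum_(k < n) `|pos (ob (k.+1%:R * (T / n%:R)) -
    Q (T / n%:R) (ob (k%:R * (T / n%:R))))| ^+ 2 <= K * (T / n%:R).

Section mesh.
Variable n : nat.
Hypothesis n0 : (0 < n)%N.
Let tau := T / n%:R.

Let nR : 0 < n%:R :> R. Proof. by rewrite ltr0n. Qed.

Let tau0 : 0 < tau. Proof. exact: divr_gt0. Qed.

Let nT : n%:R * tau = T. Proof. by rewrite /tau mulrC divfK // gt_eqF. Qed.

Lemma inc_sum : \sum_(k < n) `|inc tau k| ^+ 2 <= K * tau.
Proof.
apply: le_trans (ob_mesh n0); apply: ler_sum => k _.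
by rewrite lerXn2r ?nnegrE //; apply: inc_le; exact: ltW.
Qed.

Lemma inc_sum1 j m : (j + m <= n)%N -> (\sum_(i < m) `|inc tau (j + i)|) ^+ 2 <= K * (m%:R * tau).
Proof.
move=> jm; apply: le_trans (sum_sqr _ (fun i => `|inc tau (j + i)|)) _.
rewrite mulrCA; apply: ler_wpM2l => //; apply: le_trans inc_sum.
exact: (sum_le_sub (a := fun i => `|inc tau i| ^+ 2)).
Qed.

Lemma mesh_le k : (k <= n)%N -> k%:R * tau <= T.
Proof. by move=> kn; rewrite -nT ler_pM2r // ler_nat. Qed.

(** By Cauchy-Schwarz the norms of m consecutive jumps add up to at most sqrt (K m tau): a modulus
    of continuity that does not depend on the mesh. *)
Lemma chi_equicont j m : (j + m <= n)%N ->
  `|chi tau (j + m) - Q (m%:R * tau) (chi tau j)| ^+ 2 <= M ^+ 2 * (K * (m%:R * tau)).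
Proof.
move=> jm; rewrite chi_flow ?(ltW tau0) // addrC addKr.
apply: (@le_trans _ _ ((M * \sum_(i < m) `|inc tau (j + i)|) ^+ 2)).
  rewrite lerXn2r ?nnegrE ?mulr_ge0 ?(ltW (sgM_gt0 _ _)) ?sumr_ge0 //.
  apply: le_trans (ler_norm_sum _ _ _) _; rewrite mulr_sumr; apply: ler_sum => i _.
  apply: (sg_le hQ w0 T0); apply: mesh_le.
  by apply: leq_trans (leq_subr _ _) _; apply: leq_trans jm; exact: leq_addl.
by rewrite exprMn; apply: ler_wpM2l; [exact: sqr_ge0|exact: inc_sum1].
Qed.

Lemma chi_bound k : (k <= n)%N -> `|chi tau k| ^+ 2 <= M ^+ 2 * (K * T).
Proof.
move=> kn; have := @chi_equicont 0%N k kn; rewrite add0n linear0 subr0 => /le_trans; apply.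
by apply: ler_wpM2l; [exact: sqr_ge0|apply: ler_wpM2l => //; exact: mesh_le].
Qed.

(* the density of the increments: tau^-1 inc tau k on the cell ]k tau, (k+1) tau] *)
Definition zstep (s : R) : V :=
  \sum_(k < n) \1_(`]k%:R * tau, k.+1%:R * tau]%classic) s *: (tau^-1 *: inc tau k).

Lemma zstep_cell k s : (k < n)%N -> k%:R * tau < s <= k.+1%:R * tau ->
  zstep s = tau^-1 *: inc tau k.
Proof.
move=> kn /andP[ks sk]; rewrite /zstep (bigD1 (Ordinal kn)) //=.
rewrite indicE mem_set /=; last by rewrite in_itv /= ks sk.
rewrite big1 ?addr0 ?scale1r // => i ik.
rewrite indicE memNset ?scale0r //= in_itv /= => /andP[is' si].
have [lt|lt|e] := ltngtP i k.
- by have := lt_le_trans ks si; rewrite ltr_pM2r // ltr_nat ltnS leqNgt lt.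
- by have := lt_le_trans is' sk; rewrite ltr_pM2r // ltr_nat ltnS leqNgt lt.
- by move: ik; rewrite -val_eqE /= e eqxx.
Qed.

Lemma zstep_ge0 s : ge0 (zstep s).
Proof.
apply: (@ge0_sum _ _ L n (fun k => \1_(`]k%:R * tau, k.+1%:R * tau]%classic) s *: (tau^-1 *: inc tau k))).
move=> k _; apply: ge0Z; first by rewrite indicE; case: (_ \in _).
by apply: ge0Z; [rewrite invr_ge0 ltW|exact: pos_ge0].
Qed.

Lemma zstep_sfun : sfun (zstep : R -> V).
Proof.
rewrite /zstep; elim: n => [|m IH].
  by under eq_fun do rewrite big_ord0; exact: sfun_cst.
under eq_fun do rewrite big_ord_recr /=.
apply: (sfun_comp2 (fun x y : V => x + y)) => //.
rewrite (_ : (fun s => _) = (fun s => (fun b : bool => b%:R *: (tau^-1 *: inc tau m))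
  (s \in (`]m%:R * tau, m.+1%:R * tau]%classic : set R)))).
  by apply: (sfun_comp (fun b : bool => b%:R *: (tau^-1 *: inc tau m))); exact: sfun_mem.
by apply/funext => s; rewrite indicE.
Qed.

Lemma sfun_hL2 (u : R -> V) : sfun u -> hL2 T u.
Proof.
move=> su; split; first exact: sfun_good.
have [B uB] := sfun_bounded su.
apply: (rintegrable_bound (g := fun _ => B ^+ 2)).
- by apply: measurable_funX; apply: good_norm; exact: sfun_good.
- exact: rintegrable_const.
- move=> s _; rewrite ger0_norm ?sqr_ge0 // lerXn2r ?nnegrE //.
  exact: le_trans (uB s).
Qed.

Lemma zstep_hL2 : hL2 T zstep.
Proof. exact/sfun_hL2/zstep_sfun. Qed.

Lemma cells_integral j (f : R -> R) (c : nat -> R) : (j <= n)%N ->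
  rintegrable 0 (j%:R * tau) f ->
  (forall k s, (k < j)%N -> k%:R * tau < s <= k.+1%:R * tau -> f s = c k) ->
  rint 0 (j%:R * tau) f = tau * \sum_(k < j) c k.
Proof.
move=> jn fi fc; rewrite -rint_cells ?(ltW tau0) // mulr_sumr; apply: eq_bigr => k _.
have kk : k%:R * tau <= k.+1%:R * tau by rewrite ler_pM2r // ler_nat.
have kj : k.+1%:R * tau <= j%:R * tau by rewrite ler_pM2r // ler_nat.
have k0 : 0 <= k%:R * tau by rewrite mulr_ge0 // ltW.
rewrite (@rint_eq_oc _ _ _ _ (fun _ => c k)).
- rewrite rint_const // -natr1 mulrDl mul1r; ring.
- exact: (rintegrableS k0 kj).
- exact: rintegrable_const.
- by move=> s; exact: fc.
Qed.

(** The squared jumps give K tau, each cell contributes its length tau, and the density divides by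
    tau^2: the powers of tau cancel. *)
Lemma zstep_L2 : rint 0 T (fun s => `|zstep s| ^+ 2) <= K.
Proof.
have [_ z2] := zstep_hL2; rewrite -nT.
rewrite (@cells_integral n _ (fun k => tau^-2 * `|inc tau k| ^+ 2)) //; last first.
- move=> k s kn hs; rewrite (zstep_cell kn hs) normrZ exprMn.
  by rewrite gtr0_norm ?invr_gt0 // exprVn.
- by rewrite nT.
rewrite -mulr_sumr mulrA.
have -> : tau * tau ^- 2 = tau^-1 by field; rewrite gt_eqF.
by rewrite mulrC ler_pdivrMr // inc_sum.
Qed.

End mesh.
End scheme.

(** * Dyadic refinement of the scheme *)

Section dyadic.
Context (R : realType) (V : normedModType R) (L : hilbert_lattice V).
Variables (w : R) (Q : R -> {linear V -> V}) (hQ : growth_semigroup w Q).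
Variables (T : R).
Hypotheses (w0 : 0 < w) (T0 : 0 < T).
Hypothesis Qpos : forall t u, 0 <= t -> ge0 L u -> ge0 L (Q t u).
Local Notation M := (sgM w T).
Local Notation dot := (dot L).
Variable ob : R -> V.
Hypothesis ob0 : ge0 L (- ob 0).
Variable K : R.
Hypothesis K0 : 0 <= K.
Hypothesis ob_mesh : forall n, (0 < n)%N ->
  \sum_(k < n) `|pos L (ob (k.+1%:R * (T / n%:R)) -
    Q (T / n%:R) (ob (k%:R * (T / n%:R))))| ^+ 2 <= K * (T / n%:R).
Local Notation chi := (chi L Q ob).
Local Notation inc := (inc L Q ob).
Local Notation zstep := (zstep L Q T ob).

(** The mean of the orbit of [u] over the times in [0, b]. *)
Definition avg b u : V := b^-1 *: J Q 0 b (fun _ => u).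

Lemma hL2_cst (u : V) : hL2 T (fun _ : R => u).
Proof. exact/sfun_hL2/sfun_cst. Qed.

Lemma avg_dot b u v : b <= T -> dot v (avg b u) = b^-1 * rint 0 b (fun s => dot v (Q (b - s) u)).
Proof. by move=> bT; rewrite dotZr (J_dot L hQ w0 T0 v (lexx 0) bT (hL2_cst u)). Qed.

Lemma avgD b u v : b <= T -> avg b (u + v) = avg b u + avg b v.
Proof.
by move=> bT; rewrite /avg -scalerDr -(JD L hQ w0 T0 (lexx 0) bT (hL2_cst u) (hL2_cst v)).
Qed.

Lemma avgN b u : b <= T -> avg b (- u) = - avg b u.
Proof.
move=> bT; have := JZ L hQ w0 T0 (-1) (lexx 0) bT (hL2_cst u).
rewrite /avg (_ : (fun _ => -1 *: u) = (fun _ => - u)); last by apply/funext => s; rewrite scaleN1r.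
by move=> ->; rewrite scaleN1r scalerN.
Qed.

Lemma avg0 b : b <= T -> avg b 0 = 0.
Proof. by move=> bT; apply: (@addrI _ (avg b 0)); rewrite -avgD // !addr0. Qed.

Lemma avg_sg r b u : b <= T -> avg b (Q r u) = Q r (avg b u).
Proof.
move=> bT; have -> : Q r (avg b u) = b^-1 *: Q r (J Q 0 b (fun _ => u)) by exact: linearZ.
congr (_ *: _); apply: (dot_inj (L := L)) => v.
rewrite (J_dot L hQ w0 T0 v (lexx 0) bT (hL2_cst _)).
rewrite (J_form L hQ w0 T0 (lexx 0) bT (hL2_cst u) (lin_form_sg hQ w0 r (lin_form_dot L v))).
apply: rint_eq => s /andP[s0 sb]; have [r0|r0] := leP 0 r; last by rewrite !(sg_id hQ _ (ltW r0)).
by rewrite -!(sgD hQ) ?subr_ge0 // addrC.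
Qed.

Lemma avg_norm b u : 0 < b -> b <= T -> `|avg b u| <= M * `|u|.
Proof.
move=> b0 bT; rewrite normrZ gtr0_norm ?invr_gt0 // mulrC ler_pdivrMr //.
apply: le_trans (J_norm L hQ w0 T0 (lexx 0) (ltW b0) bT (hL2_cst u)) _.
by rewrite rint_const ?(ltW b0) // subr0 -mulrA.
Qed.

Lemma avg_small u e : 0 < e -> exists2 d, 0 < d & forall b, 0 < b -> b <= d ->
  `|avg b u - u| <= e.
Proof.
move=> e0; have [d d0 hd] := G_small L hQ w0 T0 (lexx 0) u e0.
exists d => // b b0 bd; have [_] := hd b b0 bd.
have -> : G Q 0 b u = b *: avg b u.
  rewrite /avg scalerA mulfV ?gt_eqF // scale1r /G; congr (J _ _ _ _).
  by apply/funext => s; rewrite mul0r oppr0 expR0 scale1r.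
by rewrite -scalerBr normrZ gtr0_norm // mulrC ler_pM2r.
Qed.

(* Averaging over a cell commutes with Q, so the jumps can be averaged one by one. *)
Lemma J_zstep n j : (0 < n)%N -> (j <= n)%N ->
  J Q 0 (j%:R * (T / n%:R)) (zstep n) = avg (T / n%:R) (chi (T / n%:R) j).
Proof.
move=> n0; have nR : 0 < n%:R :> R by rewrite ltr0n.
set t := T / n%:R; have t0 : 0 < t by exact: divr_gt0.
have tT : t <= T by rewrite /t ler_pdivrMr // ler_peMr ?(ltW T0) // ler1n.
elim: j => [|j IH] jn.
  rewrite avg0 // mul0r; apply: (dot_inj (L := L)) => v.
  by rewrite (J_dot L hQ w0 T0 v (lexx 0) (ltW T0) (zstep_hL2 _ _ _ _ _)) rint_point dot0r.
have jjT : j.+1%:R * t <= T by exact: mesh_le.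
have j0 : 0 <= j%:R * t by rewrite mulr_ge0 // ltW.
have jj : j%:R * t <= j.+1%:R * t by rewrite ler_pM2r // ler_nat.
rewrite (J_split L hQ w0 T0 (lexx 0) j0 jj jjT (zstep_hL2 _ _ _ _ _)) (IH (ltnW jn)).
have djj : j.+1%:R * t - j%:R * t = t by rewrite -natr1 mulrDl mul1r addrAC subrr add0r.
rewrite djj chiS avgD // avg_sg //; congr (_ + _).
apply: (dot_inj (L := L)) => v.
rewrite avg_dot // (J_dot L hQ w0 T0 v j0 jjT (zstep_hL2 _ _ _ _ _)).
have ic : hL2 T (fun _ : R => t^-1 *: inc t j) by exact: hL2_cst.
rewrite (@rint_eq_oc _ _ _ _ (fun s => dot v (Q (j.+1%:R * t - s) (t^-1 *: inc t j)))).
- have {1}-> : j.+1%:R * t = j%:R * t + t by rewrite -natr1 mulrDl mul1r.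
  rewrite rint_shift ?(ltW t0) //; last first.
    move=> s; apply: (@cvg_comp _ _ _ (fun s => Q (j.+1%:R * t - s) (t^-1 *: inc t j)) (dot v)).
      apply: (@cvg_comp _ _ _ (fun s => j.+1%:R * t - s) (fun r => Q r (t^-1 *: inc t j))).
        by apply: cvgB; [exact: cvg_cst|exact: cvg_id].
      exact: (@sg_cvg _ _ _ _ hQ).
    exact: dot_continuous.
  rewrite -rintZ; last exact: (dot_orb_integrable L hQ w0 T0 v (lexx 0) tT (hL2_cst _)).
  apply: rint_eq => s _; rewrite -dotZr -linearZ; congr (dot v (Q _ _)).
  by rewrite -natr1; ring.
- exact: (dot_orb_integrable L hQ w0 T0 v j0 jjT (zstep_hL2 _ _ _ _ _)).
- exact: (dot_orb_integrable L hQ w0 T0 v j0 jjT ic).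
- by move=> s hs; rewrite (zstep_cell L Q T0 ob n0 jn hs).
Qed.

Local Notation tn n := (T / (2 ^ n)%:R).

Let p2 n : 0 < (2 ^ n)%:R :> R. Proof. by rewrite ltr0n expn_gt0. Qed.

Lemma dyadic_gt0 n : 0 < tn n. Proof. exact: divr_gt0. Qed.

Lemma dyadic_shift m p i : (2 ^ p * i)%:R * tn (m + p) = i%:R * tn m.
Proof. by rewrite expnD !natrM; field; rewrite !gt_eqF. Qed.

Lemma dyadic_le m p i : (i <= 2 ^ m)%N -> (2 ^ p * i <= 2 ^ (m + p))%N.
Proof. by move=> im; rewrite expnD mulnC leq_mul2r im orbT. Qed.

Lemma dyadic_small e : 0 < e -> exists n0, forall n, (n0 <= n)%N -> tn n <= e.
Proof.
move=> e0; exists `|Num.ceil (T / e)|%N => n nn.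
rewrite ler_pdivrMr // mulrC -ler_pdivrMr //.
have h1 : T / e <= `|Num.ceil (T / e)|%N%:R.
  have c0 : (0 <= Num.ceil (T / e)) by rewrite -(ler_int R) (le_trans _ (Num.Theory.ceil_ge _)) // divr_ge0 // ltW.
  by apply: le_trans (Num.Theory.ceil_ge _) _; rewrite -[X in X%:~R](gez0_abs c0).
apply: le_trans h1 _; rewrite ler_nat (leq_trans nn) //.
by apply: ltnW; exact: ltn_expl.
Qed.

(** Multiplying the index by 2^p while halving the step p times keeps the time fixed, so [chi_half]
    gives an increasing sequence and [chi_bound] a bound. *)
Lemma chi_cvg m i : (i <= 2 ^ m)%N ->
  exists l : V, chi (tn (m + p)) (2 ^ p * i) @[p --> \oo] --> l.
Proof.
move=> im; have B0 : 0 <= M ^+ 2 * (K * T) by rewrite mulr_ge0 ?sqr_ge0 ?mulr_ge0 // ltW.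
(* [chi_bound] controls the square of the norm; x <= x^2 + 1 turns this into a bound on the norm. *)
apply: (@ge0_incr_cvg _ _ L _ (M ^+ 2 * (K * T) + 1)) => [p|p|p].
- by apply: chi_ge0 => //; exact/ltW/dyadic_gt0.
- have -> : (2 ^ p.+1 * i = 2 * (2 ^ p * i))%N by rewrite expnS mulnA.
  have -> : tn (m + p.+1) = tn (m + p) / 2.
    by rewrite addnS expnS natrM; field; rewrite gt_eqF.
  by apply: (chi_half hQ) => //; apply/ltW/dyadic_gt0.
- have := chi_bound hQ w0 T0 Qpos ob0 K0 ob_mesh (n := 2 ^ (m + p)) _ (dyadic_le p im).
  rewrite expn_gt0 => /(_ isT); set x := `|_|; set y := M ^+ 2 * _.
  have := sqr_ge0 (x - 1); nra.
Qed.

(** By [J_zstep] the integral is a mean over a shrinking interval. Such means are uniformly bounded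
    operators tending strongly to the identity, so they can be applied to the convergent sequence
    chi. *)
Lemma J_zstep_cvg m i l : (i <= 2 ^ m)%N ->
  chi (tn (m + p)) (2 ^ p * i) @[p --> \oo] --> l ->
  forall e, 0 < e -> exists p0, forall p, (p0 <= p)%N ->
    `|J Q 0 (i%:R * tn m) (zstep (2 ^ (m + p))) - l| <= e.
Proof.
move=> im cl e e0; have M0 := sgM_gt0 w T.
have e1 : 0 < e / 2 / M by rewrite !divr_gt0.
have e2 : 0 < e / 2 by rewrite divr_gt0.
have [p1 _ hp1] : \forall p \near \oo, `|l - chi (tn (m + p)) (2 ^ p * i)| <= e / 2 / M.
  by move/cvgrPdist_le : cl; exact.
have [d d0 hd] := avg_small l e2.
have [p2' hp2] := dyadic_small d0.
exists (maxn p1 p2') => p; rewrite geq_max => /andP[pp1 pp2].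
have tT : tn (m + p) <= T by rewrite ler_pdivrMr // ler_peMr ?(ltW T0) // ler1n expn_gt0.
rewrite -(dyadic_shift m p) J_zstep ?expn_gt0 ?dyadic_le //.
set c := chi _ _; rewrite -(subrKA (avg (tn (m + p)) l)) -avgN // -avgD // (splitr e).
apply: le_trans (ler_normD _ _) _; apply: lerD.
  apply: le_trans (avg_norm _ (dyadic_gt0 _) tT) _.
  rewrite mulrC -ler_pdivlMr // distrC; exact: hp1.
apply: hd; first exact: dyadic_gt0.
by apply: hp2; exact: leq_trans pp2 (leq_addl _ _).
Qed.

End dyadic.

(** * Mazur's argument *)

Lemma rint_fin (R : realType) (a b : R) (f : R -> R) : rintegrable a b f ->
  (\int[lebesgue_measure]_(x in `[a, b]) (f x)%:E)%E = (rint a b f)%:E.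
Proof. by move=> fi; rewrite /rint /Rintegral fineK //; exact: integrable_fin_num. Qed.

(* Repeated midpoints give enough convex combinations for Mazur's argument. *)
Inductive midpoints (R : realType) (V : normedModType R) (z : nat -> R -> V) n : (R -> V) -> Prop :=
| midpoints_base m : (n <= m)%N -> midpoints z n (z m)
| midpoints_half u v : midpoints z n u -> midpoints z n v ->
    midpoints z n (fun s => 2^-1 *: (u s + v s)).

Section mazur.
Context (R : realType) (V : normedModType R) (L : hilbert_lattice V).
Variables (T : R).
Hypothesis T0 : 0 < T.
Variables (z : nat -> R -> V) (K : R).
Hypothesis sz : forall n, sfun (z n).
Local Notation q u := (rint 0 T (fun s => `|u s| ^+ 2)).
Hypothesis zK : forall n, q (z n) <= K.
Local Notation midpoints := (midpoints z).

Lemma midpoints_mono m n u : (m <= n)%N -> midpoints n u -> midpoints m u.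
Proof.
move=> mn; elim => [k nk|u1 u2 _ IH1 _ IH2]; last exact: midpoints_half.
by apply: midpoints_base; exact: leq_trans nk.
Qed.

Lemma midpoints_sfun n u : midpoints n u -> sfun u.
Proof.
elim => [k _|u1 u2 _ IH1 _ IH2]; first exact: sz.
exact: (sfun_comp2 (fun x y : V => 2^-1 *: (x + y))).
Qed.

Lemma midpoints_hL2 n u : midpoints n u -> hL2 T u.
Proof. by move=> /midpoints_sfun; exact: sfun_hL2. Qed.

Lemma parallelogram (u v : R -> V) : hL2 T u -> hL2 T v ->
  q (fun s => u s - v s) = 2 * q u + 2 * q v - 4 * q (fun s => 2^-1 *: (u s + v s)).
Proof.
move=> hu hv; have [_ iu] := hu; have [_ iv] := hv.
have [_ im] := hL2Z 2^-1 (hL2D hu hv).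
rewrite -!rintZ // -rintD; [|exact: rintegrableZ|exact: rintegrableZ].
rewrite -rintB; [|by apply: rintegrableD; exact: rintegrableZ|exact: rintegrableZ].
apply: rint_eq => s _; rewrite normrZ exprMn ger0_norm ?invr_ge0 // (normB2 L) (normD2 L).
by field.
Qed.

(** Parallelogram identity: two near-minimisers whose midpoint cannot go below the infimum are
    close. *)
Lemma midpoints_dist n (u v : R -> V) (I d : R) : (forall y, midpoints n y -> I <= q y) ->
  midpoints n u -> midpoints n v -> q u <= I + d -> q v <= I + d ->
  q (fun s => u s - v s) <= 4 * d.
Proof.
move=> hI mu mv qu qv; rewrite parallelogram; [|exact: midpoints_hL2 mu|exact: midpoints_hL2 mv].
by have := hI _ (midpoints_half mu mv); move: qu qv; lra.
Qed.

(** The infimum of the squared norm over midpoints of the tail from n increases with n and is at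
    most K, so it converges; near-minimisers over late tails are then Cauchy by [midpoints_dist]. *)
Lemma midpoints_cauchy : exists2 y : nat -> R -> V, (forall n, midpoints n (y n)) &
  forall m n, (n <= m)%N -> q (fun s => y m s - y n s) <= 8^-1 ^+ n.
Proof.
pose S n := [set r | exists2 u, midpoints n u & r = q u].
have S0 n : S n !=set0 by exists (q (z n)); exists (z n) => //; exact: midpoints_base.
have Slb n : lbound (S n) 0.
  by move=> _ [u _ ->]; apply: rint_ge0 => s _; exact: sqr_ge0.
have Sinf n : has_inf (S n) by split; [exact: S0|exists 0; exact: Slb].
pose I n := inf (S n).
have IS n u : midpoints n u -> I n <= q u.
  by move=> mu; apply: ge_inf; [exists 0; exact: Slb|exists u].
have IK n : I n <= K by apply: le_trans (zK n); apply: IS; exact: midpoints_base.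
have Imono m n : (m <= n)%N -> I m <= I n.
  move=> mn; apply: lb_le_inf => [//|_ [u mu ->]].
  by apply: IS; exact: midpoints_mono mu.
have supI : has_sup (range I).
  by split; [exists (I 0%N); exists 0%N|exists K => _ [n _ <-]].
pose J := sup (range I).
have IJ n : I n <= J by apply: ub_le_sup; [case: supI|exists n].
(* Two such defects, times the 4 of [midpoints_dist], give exactly 8^-n, the rate asked by
   [fast_L2_cvg]. *)
have e0 n : 0 < 8^-1 ^+ n / 8 :> R by rewrite divr_gt0 ?exprn_gt0 ?invr_gt0.
have /choice[N hN] : forall n, exists m, (n <= m)%N /\ J - 8^-1 ^+ n / 8 < I m.
  move=> n.
  have [_ [m _ <-] hm] := sup_adherent (e0 n) supI.
  exists (maxn m n); split; first exact: leq_maxr.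
  by apply: lt_le_trans hm _; apply: Imono; exact: leq_maxl.
have /choice[y hy] : forall n, exists u, midpoints (N n) u /\ q u <= I (N n) + 8^-1 ^+ n / 8.
  move=> n.
  by have [_ [u mu ->] hu] := inf_adherent (e0 n) (Sinf (N n)); exists u; split=> //; exact: ltW.
exists y => [n|m n nm]; first by apply: midpoints_mono (proj1 (hN n)) (proj1 (hy n)).
have emn : 8^-1 ^+ m / 8 <= 8^-1 ^+ n / 8 :> R.
  by rewrite ler_pM2r ?invr_gt0 // ler_wiXn2l // ?invr_ge0 // invf_le1 // ler1n.
pose p := minn (N n) (N m).
have hn := hN n; have hm := hN m; have [yn1 yn2] := hy n; have [ym1 ym2] := hy m.
have Jp : J - 8^-1 ^+ n / 8 < I p.
  rewrite /p /minn; case: ifP => _; first exact: hn.2.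
  by apply: le_lt_trans hm.2; rewrite lerD2l lerN2.
apply: le_trans (@midpoints_dist p _ _ (I p) (2 * (8^-1 ^+ n / 8)) (IS p) _ _ _ _) _.
- by apply: midpoints_mono ym1; exact: geq_minr.
- by apply: midpoints_mono yn1; exact: geq_minl.
- by have := IJ (N m); move: ym2 emn Jp; lra.
- by have := IJ (N n); move: yn2 Jp; lra.
- by rewrite mulrA mulrA -mulrA; lra.
Qed.

(** In the last clause c is 0 or 1, according to whether the pointwise limit was cut off at s. It
    passes positivity from the midpoints to u at every s. *)
Lemma mazur : exists u : R -> V, exists y : nat -> R -> V,
  [/\ hL2 T u, forall n, midpoints n (y n),
      forall n, q (fun s => y n s - u s) <= 8^-1 ^+ n &
      forall s, exists2 c : R, 0 <= c & c *: y n s @[n --> \oo] --> u s].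
Proof.
have [y ym yd] := midpoints_cauchy.
have sy n : sfun (y n) by exact: midpoints_sfun (ym n).
have hy n : hL2 T (y n) by exact: sfun_hL2.
have mD : measurable (`[0, T]%classic : set R) by exact: measurable_itv.
have myy (v : nat -> R -> V) : (forall n, sfun (v n)) -> forall m n,
    measurable_fun setT (fun s => `|v m s - v n s|).
  by move=> sv m n; apply: good_norm; apply: goodB; exact: sfun_good.
have yI m n : (\int[lebesgue_measure]_(s in `[0%R, T]) (`|y m s - y n s| ^+ 2)%:E)%E =
    (q (fun s => y m s - y n s))%:E.
  by apply: rint_fin; have [] := hL2B (hy m) (hy n).
have [N [mN N0 [u hu]]] : exists N : set R, [/\ measurable N, lebesgue_measure N = 0%E
    & exists u : R -> V, forall s, \1_(`[0%R, T]%classic `\` N) s *: y n s @[n --> \oo] --> u s].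
  have cpl := @hilbert_complete _ _ L.
  apply: (@fast_L2_cvg _ _ R lebesgue_measure _ mD V cpl y) => [m n|n].
    exact: measurable_funS (myy y sy m n).
  by rewrite yI lee_fin yd.
set A := `[0%R, T]%classic `\` N in hu.
have mA : measurable A by exact: measurableD.
pose Y n s := \1_A s *: y n s.
have sY n : sfun (Y n).
  apply: (sfun_comp2 (fun (b : bool) (x : V) => b%:R *: x)) (sfun_mem mA) (sy n).
have gu : good u by exists Y.
have YI m n : (n <= m)%N ->
    (\int[lebesgue_measure]_(s in `[0%R, T]) (`|Y m s - Y n s| ^+ 2)%:E <= (8^-1 ^+ n)%:E)%E.
  move=> nm; apply: (@le_trans _ _ (\int[lebesgue_measure]_(s in `[0%R, T]) (`|y m s - y n s| ^+ 2)%:E)%E).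
    apply: ge0_le_integral_any => s _; rewrite ?lee_fin ?sqr_ge0 //.
    rewrite /Y -scalerBr normrZ exprMn ler_piMl ?sqr_ge0 // indicE.
    by case: (_ \in _); rewrite ?normr1 ?normr0 ?expr1n ?expr0n.
  by rewrite yI lee_fin yd.
have uY n : (\int[lebesgue_measure]_(s in `[0%R, T]) (`|u s - Y n s| ^+ 2)%:E <= (8^-1 ^+ n)%:E)%E.
  apply: (@fatou_L2 _ _ R lebesgue_measure _ mD V Y) => [m k|s _|m nm]; last exact: YI.
    exact: measurable_funS (myy Y sY m k).
  exact: hu.
have guY n : good (fun s => u s - Y n s) by apply: goodB => //; exact: sfun_good.
have huY n : hL2 T (fun s => u s - Y n s).
  split=> //; apply/integrableP; split.
    apply/measurable_EFinP; apply: measurable_funS (measurable_funX 2 (good_norm (guY n))) => //.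
  under eq_integral do rewrite /= ger0_norm ?sqr_ge0 //.
  exact: le_lt_trans (uY n) (ltry _).
have hu2 : hL2 T u.
  have := hL2D (huY 0%N) (sfun_hL2 T (sY 0%N)).
  by rewrite (_ : (fun s => _) = u) //; apply/funext => s; rewrite subrK.
exists u, y; split => // [n|s]; last by exists (\1_A s) => //; rewrite indicE; case: (_ \in _).
have [gn ui] := hL2B (hy n) hu2.
rewrite -lee_fin -(rint_fin ui).
have -> : (\int[lebesgue_measure]_(s in `[0%R, T]) (`|y n s - u s| ^+ 2)%:E =
    \int[lebesgue_measure]_(s in `[0%R, T]) (`|u s - Y n s| ^+ 2)%:E)%E.
  apply: ge0_ae_eq_integral_any => //.
  - apply/measurable_EFinP; apply: measurable_funS (measurable_funX 2 (good_norm (guY n))) => //.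
  - exists N; split => // s /= hs; apply: contrapT => nNs; apply: hs => Ds.
    by rewrite /Y indicE mem_set // scale1r distrC.
exact: uY.
Qed.

End mazur.

(** * Passage to the limit *)

Lemma bounded_uniformly (P : nat -> nat -> Prop) n :
  (forall i, (i <= n)%N -> exists p0, forall p, (p0 <= p)%N -> P i p) ->
  exists p0, forall p, (p0 <= p)%N -> forall i, (i <= n)%N -> P i p.
Proof.
elim: n => [|n IH] H.
  by have [p0 hp] := H 0%N isT; exists p0 => p pp [] // _; exact: hp.
have [p1 h1] := IH (fun i hi => H i (leqW hi)); have [p2 h2] := H n.+1 (leqnn _).
exists (maxn p1 p2) => p; rewrite geq_max => /andP[pp1 pp2] i.
by rewrite leq_eqVlt => /predU1P[->|]; [exact: h2|rewrite ltnS => hi; exact: h1].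
Qed.

Lemma sqr_le_small (R : realType) (x c t e : R) : 0 <= c -> 0 <= t -> 0 < e -> 0 <= x ->
  t <= e ^+ 2 / (c + 1) -> x ^+ 2 <= c * t -> x <= e.
Proof.
move=> c0 t0 e0 x0; have c1 : 0 < c + 1 by rewrite ltr_wpDl.
rewrite ler_pdivlMr // => ht hx; rewrite -(@ler_pXn2r _ 2) ?nnegrE ?(ltW e0) //.
by apply: le_trans hx _; apply: le_trans ht; rewrite mulrC ler_wpM2l // lerDl.
Qed.

Section limit.
Context (R : realType) (V : normedModType R) (L : hilbert_lattice V).
Variables (w : R) (Q : R -> {linear V -> V}) (hQ : growth_semigroup w Q).
Variables (T : R).
Hypotheses (w0 : 0 < w) (T0 : 0 < T).
Hypothesis Qpos : forall t u, 0 <= t -> ge0 L u -> ge0 L (Q t u).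
Local Notation M := (sgM w T).
Local Notation dot := (dot L).

Lemma modulusB (f h : R -> V) : modulus T f -> modulus T h -> modulus T (fun t => f t - h t).
Proof.
move=> mf mh e e0; have e2 : 0 < e / 2 by rewrite divr_gt0.
have [d1 d10 h1] := mf _ e2; have [d2 d20 h2] := mh _ e2.
exists (Num.min d1 d2); first by rewrite lt_min d10.
move=> a b a0 ab bT; rewrite le_min => /andP[ba1 ba2].
have -> : f b - h b - (f a - h a) = (f b - f a) - (h b - h a).
  by apply: (dot_inj (L := L)) => x; rewrite !(dotBr, dotNr); ring.
by rewrite (splitr e); apply: le_trans (ler_normB _ _) _; apply: lerD; [exact: h1|exact: h2].
Qed.

Variable ob : R -> V.
Hypothesis ob0 : ge0 L (- ob 0).
Hypothesis obM : modulus T ob.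
Variable K : R.
Hypothesis K0 : 0 <= K.
Hypothesis ob_mesh : forall n, (0 < n)%N ->
  \sum_(k < n) `|pos L (ob (k.+1%:R * (T / n%:R)) -
    Q (T / n%:R) (ob (k%:R * (T / n%:R))))| ^+ 2 <= K * (T / n%:R).
Local Notation chi := (chi L Q ob).
Local Notation inc := (inc L Q ob).
Local Notation z n := (zstep L Q T ob (2 ^ n)).
Local Notation tn n := (T / (2 ^ n)%:R).

Variables (u : R -> V) (y : nat -> R -> V).
Hypothesis hu : hL2 T u.
Hypothesis ymid : forall n, midpoints (fun n => z n) n (y n).
Hypothesis yu : forall n, rint 0 T (fun s => `|y n s - u s| ^+ 2) <= 8^-1 ^+ n.

Let zs n : sfun (z n : R -> V). Proof. exact: zstep_sfun. Qed.

Let hz n : hL2 T (z n). Proof. exact: zstep_hL2. Qed.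

Let midL2 n v : midpoints (fun n => z n) n v -> hL2 T v.
Proof. by apply: midpoints_hL2 => k; exact: zs. Qed.

Let E t := J Q 0 t u.

(** [J] is linear and balls are convex. *)
Lemma midpoints_J t l e n v : 0 <= t -> t <= T ->
  (forall m, (n <= m)%N -> `|J Q 0 t (z m) - l| <= e) ->
  midpoints (fun n => z n) n v -> `|J Q 0 t v - l| <= e.
Proof.
move=> t0 tT H; elim => [m nm|v1 v2 m1 IH1 m2 IH2]; first exact: H.
have h1 := midL2 m1; have h2 := midL2 m2.
rewrite (JZ L hQ w0 T0 2^-1 (lexx 0) tT (hL2D h1 h2)) (JD L hQ w0 T0 (lexx 0) tT h1 h2).
set x1 := J _ _ _ _ in IH1 *; set x2 := J _ _ _ _ in IH2 *; clearbody x1 x2.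
have -> : 2^-1 *: (x1 + x2) - l = 2^-1 *: ((x1 - l) + (x2 - l)).
  by apply: (dot_inj (L := L)) => x; rewrite !(dotBr, dotNr, dotZr, dotDr); field.
rewrite normrZ ger0_norm ?invr_ge0 // mulrC ler_pdivrMr // mulr_natr mulr2n.
by apply: le_trans (ler_normD _ _) _; exact: lerD.
Qed.

(** The limit l of the scheme is also the limit of [J] along the densities, hence along their
    midpoints y n; as y n tends to u in L^2, [J_sqr] identifies it with the integral driven by u. *)
Lemma chi_cvg_J m i : (i <= 2 ^ m)%N ->
  chi (tn (m + p)) (2 ^ p * i) @[p --> \oo] --> E (i%:R * tn m).
Proof.
move=> im; have [l cl] := chi_cvg hQ w0 T0 Qpos ob0 K0 ob_mesh im.
have t0 : 0 <= i%:R * tn m by rewrite mulr_ge0 // ltW ?dyadic_gt0.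
have tT : i%:R * tn m <= T by apply: mesh_le => //; rewrite expn_gt0.
suff -> : E (i%:R * tn m) = l by [].
apply/eqP; rewrite -subr_eq0 -normr_le0; apply/ler_addgt0Pl => e e0; rewrite addr0.
have e2 : 0 < e / 2 by rewrite divr_gt0.
have [p0 hp0] := J_zstep_cvg hQ w0 T0 im cl e2.
have M0 := sgM_gt0 w T.
pose c := M ^+ 2 * T; have c0 : 0 <= c by rewrite mulr_ge0 ?sqr_ge0 // ltW.
have c1 : 0 < c + 1 by rewrite ltr_wpDl.
have [n1 hn1] : exists n1, forall n, (n1 <= n)%N -> 2^-1 ^+ n <= (e / 2) ^+ 2 / (c + 1).
  by apply: half_pow_small; rewrite divr_gt0 ?exprn_gt0.
pose n := maxn (m + p0) n1.
rewrite -(subrKA (J Q 0 (i%:R * tn m) (y n))) (splitr e).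
apply: le_trans (ler_normD _ _) _; apply: lerD; last first.
  apply: (midpoints_J t0 tT _ (ymid n)) => k nk.
  have mk : (m + p0 <= k)%N by apply: leq_trans nk; exact: leq_maxl.
  have -> : k = (m + (k - m))%N by rewrite subnKC // (leq_trans _ mk) ?leq_addr.
  by apply: hp0; rewrite leq_subRL // (leq_trans _ mk) ?leq_addr.
have hy := midL2 (ymid n); rewrite distrC -(JB L hQ w0 T0 (lexx 0) tT hy hu).
have hh := hL2B hy hu.
apply: (@sqr_le_small _ _ c (2^-1 ^+ n) _ c0) => //.
- by apply: hn1; exact: leq_maxr.
apply: le_trans (J_sqr L hQ w0 T0 (lexx 0) t0 tT hh) _.
rewrite subr0; apply: ler_pM.
- by rewrite mulr_ge0 // sqr_ge0.
- by apply: rint_ge0 => s _; exact: sqr_ge0.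
- by rewrite ler_pM2l ?exprn_gt0.
apply: le_trans (rint_mono (lexx 0) t0 tT (proj2 hh) (fun s => sqr_ge0 _)) _.
apply: le_trans (yu n) _; rewrite lerXn2r ?nnegrE ?invr_ge0 // lef_pV2 ?posrE // ler_nat //.
Qed.

(** Convergence at the finitely many nodes of one coarse mesh is uniform; between those nodes
    [chi_equicont] controls the scheme and [J_sqr] the limit, both by the coarse step alone. *)
Lemma chi_uniform e : 0 < e -> exists n0, forall n, (n0 <= n)%N ->
  forall k, (k <= 2 ^ n)%N -> `|chi (tn n) k - E (k%:R * tn n)| <= e.
Proof.
move=> e0; have M0 := sgM_gt0 w T.
have e3 : 0 < e / 3 by rewrite divr_gt0.
pose B := rint 0 T (fun s => `|u s| ^+ 2).
have B0 : 0 <= B by apply: rint_ge0 => s _; exact: sqr_ge0.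
have c1 : 0 <= M ^+ 2 * K by rewrite mulr_ge0 ?sqr_ge0.
have c2 : 0 <= M ^+ 2 * B by rewrite mulr_ge0 ?sqr_ge0.
pose d := Num.min ((e / 3) ^+ 2 / (M ^+ 2 * K + 1)) ((e / 3) ^+ 2 / (M ^+ 2 * B + 1)).
have d0 : 0 < d by rewrite lt_min !divr_gt0 ?exprn_gt0 // ltr_wpDl.
have [m /(_ m (leqnn _)) hm] := dyadic_small T0 d0.
move: hm; rewrite le_min => /andP[hm1 hm2].
have e4 : 0 < e / 3 / M by rewrite divr_gt0.
have [p0 hp0] : exists p0, forall p, (p0 <= p)%N -> forall i, (i <= 2 ^ m)%N ->
    `|chi (tn (m + p)) (2 ^ p * i) - E (i%:R * tn m)| <= e / 3 / M.
  apply: (@bounded_uniformly (fun i p => `|chi (tn (m + p)) (2 ^ p * i) - E (i%:R * tn m)| <= e / 3 / M)) => i im.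
  have /cvgrPdist_le /(_ _ e4)[p0 _ h] := chi_cvg_J im.
  by exists p0 => p pp; rewrite distrC; exact: h.
exists (m + p0)%N => n mn k kn.
have [p pE] : exists p, n = (m + p)%N by exists (n - m)%N; rewrite subnKC // (leq_trans _ mn) ?leq_addr.
have pp : (p0 <= p)%N by move: mn; rewrite pE leq_add2l.
subst n; clear mn.
have p2 : (0 < 2 ^ p)%N by rewrite expn_gt0.
(* The fine node k is r fine steps after the coarse node i, and r fine steps are shorter than one
   coarse step. *)
pose i := (k %/ 2 ^ p)%N; pose r := (k %% 2 ^ p)%N.
have kE : k = (2 ^ p * i + r)%N by rewrite mulnC -divn_eq.
have im : (i <= 2 ^ m)%N.
  by rewrite -(leq_pmul2l p2) (leq_trans _ (leq_trans kn _)) // ?kE ?leq_addr // expnD mulnC.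
have n20 : (0 < 2 ^ (m + p))%N by rewrite expn_gt0.
have t0 := dyadic_gt0 T0 (m + p); have tm0 := dyadic_gt0 T0 m.
have rt : r%:R * tn (m + p) <= tn m.
  have := dyadic_shift T m p 1; rewrite muln1 mul1r => <-.
  by rewrite ler_pM2r // ler_nat ltnW // ltn_pmod.
have r0 : 0 <= r%:R * tn (m + p) by rewrite mulr_ge0 // ltW.
have kt : k%:R * tn (m + p) = i%:R * tn m + r%:R * tn (m + p).
  by rewrite {1}kE natrD mulrDl dyadic_shift.
have i0 : 0 <= i%:R * tn m by rewrite mulr_ge0 // ltW.
have kT : i%:R * tn m + r%:R * tn (m + p) <= T by rewrite -kt; exact: mesh_le.
have rT : r%:R * tn (m + p) <= T by apply: le_trans kT; rewrite lerDr.
rewrite kt; set a := i%:R * tn m in i0 kT *; set b := r%:R * tn (m + p) in rt r0 kT rT kt *.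
have hE : E (a + b) = Q b (E a) + J Q a (a + b) u.
  rewrite /E (J_split L hQ w0 T0 (lexx 0) i0 _ kT hu) ?lerDl //.
  by have -> : a + b - a = b by ring.
have h1 : `|chi (tn (m + p)) k - Q b (chi (tn (m + p)) (2 ^ p * i))| <= e / 3.
  apply: (@sqr_le_small _ _ (M ^+ 2 * K) (tn m) _ c1 (ltW tm0)) => //.
  rewrite {1}kE; apply: le_trans (chi_equicont hQ w0 T0 Qpos ob0 ob_mesh n20 _) _.
    by rewrite -kE.
  by rewrite mulrA ler_wpM2l.
have h2 : `|J Q a (a + b) u| <= e / 3.
  apply: (@sqr_le_small _ _ (M ^+ 2 * B) (tn m) _ c2 (ltW tm0)) => //.
  have aab : a <= a + b by rewrite lerDl.
  apply: le_trans (J_sqr L hQ w0 T0 i0 aab kT hu) _.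
  have -> : a + b - a = b by rewrite addrC addKr.
  rewrite mulrAC; apply: ler_pM => //.
  - by rewrite mulr_ge0 ?sqr_ge0 //; apply: rint_ge0 => s _; exact: sqr_ge0.
  - apply: ler_wpM2l; first exact: sqr_ge0.
    exact: (rint_mono i0 aab kT (proj2 hu) (fun s => sqr_ge0 _)).
have h3 : `|Q b (chi (tn (m + p)) (2 ^ p * i)) - Q b (E a)| <= e / 3.
  have -> : Q b (chi (tn (m + p)) (2 ^ p * i)) - Q b (E a) = Q b (chi (tn (m + p)) (2 ^ p * i) - E a).
    by rewrite linearB.
  apply: le_trans (sg_le hQ w0 T0 _ rT) _; rewrite mulrC -ler_pdivlMr //.
  exact: hp0.
rewrite hE; set x := chi _ k in h1 *; set x1 := Q b _ in h1 h3 *; set x2 := Q b _ in h3 *; set x3 := J _ _ _ _ in h2 *.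
have -> : x - (x2 + x3) = (x - x1) + (x1 - x2) - x3.
  by apply: (dot_inj (L := L)) => v; rewrite !(dotBr, dotNr, dotDr); ring.
apply: le_trans (ler_normB _ _) _; apply: le_trans (lerD (ler_normD _ _) (lexx _)) _.
by move: h1 h2 h3; lra.
Qed.

Lemma trajJ v t : traj Q 0 v t = J Q 0 t v.
Proof. by rewrite /traj linear0 add0r. Qed.

Lemma modulus_J : modulus T E.
Proof.
move=> e e0; have [d d0 hd] := traj_modulus L hQ w0 T0 0 hu e0.
by exists d => // a b a0 ab bT ba; have := hd a b a0 ab bT ba; rewrite !trajJ.
Qed.

Let H t := E t - ob t.

Let HM : modulus T H. Proof. by apply: modulusB; [exact: modulus_J|exact: obM]. Qed.

Let Hc : continuous (fun t => H (clamp T t)). Proof. exact: modulus_clamp_cont. Qed.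

(** At a dyadic time the scheme is above the obstacle on all finer meshes, so the limit is too; an
    arbitrary t is approached from the left by dyadic times, and H is continuous. *)
Lemma obstacle_below t : 0 <= t -> t <= T -> ge0 L (H t).
Proof.
move=> t0 tT; pose k n := Num.truncn (t / tn n).
have tn0 n := dyadic_gt0 T0 n.
have kt n : (k n)%:R * tn n <= t < (k n).+1%:R * tn n.
  have /andP[h1 h2] := Num.Theory.truncn_itv (divr_ge0 t0 (ltW (tn0 n))).
  by rewrite -ler_pdivlMr // -ltr_pdivrMr // h1.
have kn n : (k n <= 2 ^ n)%N.
  have /andP[h _] := kt n; rewrite -(ler_nat R) -(ler_pM2r (tn0 n)).
  by apply: le_trans h _; apply: le_trans tT _; rewrite mulrC divfK // gt_eqF // ltr0n expn_gt0.
have kc : (k n)%:R * tn n @[n --> \oo] --> t.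
  apply/cvgrPdist_le => e e0; have [n0 h0] := dyadic_small T0 e0.
  exists n0 => // n /= nn; have /andP[h1 h2] := kt n.
  rewrite ger0_norm ?subr_ge0 //; apply: le_trans (h0 n nn).
  by move: h2; rewrite -natr1 mulrDl mul1r; lra.
have := @cvg_comp _ _ _ (fun n => (k n)%:R * tn n) (fun t => H (clamp T t)) _ _ _ kc (@Hc t).
rewrite clamp_id ?t0 //; apply: ge0_cvg => n /=.
have knT : 0 <= (k n)%:R * tn n <= T.
  by rewrite mulr_ge0 ?(ltW (tn0 n)) //=; apply: mesh_le => //; rewrite expn_gt0.
rewrite clamp_id //.
have := chi_cvg_J (kn n) => cc.
have : chi (tn (n + p)) (2 ^ p * k n) - ob ((k n)%:R * tn n) @[p --> \oo] --> H ((k n)%:R * tn n).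
  by apply: cvgB => //; exact: cvg_cst.
apply: ge0_cvg => p; rewrite -(dyadic_shift T n p (k n)).
exact: chi_ob.
Qed.

(** On a cell the density is a multiple of a jump, orthogonal to the scheme minus the obstacle at
    the right end ([inc_orth]). Replacing this vector by H s costs e/2 for the uniform convergence
    and e/2 for the modulus of H. *)
Lemma zstep_defect e : 0 < e -> exists n0, forall n, (n0 <= n)%N ->
  forall s, 0 <= s -> s <= T -> dot (z n s) (H s) <= e * `|z n s|.
Proof.
move=> e0; have e2 : 0 < e / 2 by rewrite divr_gt0.
have [n1 h1] := chi_uniform e2; have [d d0 hd] := HM e2.
have [n2 h2] := dyadic_small T0 d0.
exists (maxn n1 n2) => n; rewrite geq_max => /andP[nn1 nn2] s.
have n20 : (0 < 2 ^ n)%N by rewrite expn_gt0.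
have t0 := dyadic_gt0 T0 n.
(* No left-open cell contains 0, so the density vanishes there. *)
rewrite le_eqVlt => /predU1P[<- _|s0 sT].
  rewrite (_ : z n 0 = 0) ?dot0l ?normr0 ?mulr0 // /zstep big1 // => i _.
  by rewrite indicE memNset ?scale0r //= in_itv /= ltNge mulr_ge0 // ltW.
have [k hk hs] : exists2 k, (k < 2 ^ n)%N & k%:R * tn n < s <= k.+1%:R * tn n.
  have c0 : 0 < s / tn n by exact: divr_gt0.
  have := ceil_itv (s / tn n); have : 0 < Num.ceil (s / tn n) by rewrite ceil_gt0.
  case: (Num.ceil _) => // -[//|k] _ /andP[l1 l2].
  have ks : k%:R * tn n < s by rewrite -ltr_pdivlMr // (le_lt_trans _ l1) // -addn1 PoszD addrK.
  exists k; last by rewrite ks /= -ler_pdivrMr.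
  rewrite -(ltr_nat R) -(ltr_pM2r t0); apply: lt_le_trans ks _; apply: le_trans sT _.
  by rewrite mulrC divfK // gt_eqF // ltr0n.
have k1T : k.+1%:R * tn n <= T by exact: mesh_le.
have /andP[ks sk] := hs.
rewrite (zstep_cell L Q T0 ob n20 hk hs) dotZl normrZ gtr0_norm ?invr_gt0 //.
rewrite mulrCA ler_pM2l ?invr_gt0 //.
set t := k.+1%:R * tn n in sk k1T *; set x := inc _ _.
have -> : dot x (H s) = dot x (H s - H t) + dot x (E t - chi (tn n) k.+1).
  have := inc_orth L Q ob (tn n) k; rewrite -/x -/t /H !dotBr.
  lra.
rewrite (mulrC e) (splitr e) mulrDr; apply: lerD.
  apply: le_trans (cauchy_schwarz _ _ _) _; rewrite ler_wpM2l // distrC.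
  apply: hd => //; first exact: ltW.
  apply: le_trans (h2 n nn2); move: ks; rewrite /t -natr1 mulrDl mul1r.
  lra.
apply: le_trans (cauchy_schwarz _ _ _) _; rewrite ler_wpM2l // distrC.
exact: h1.
Qed.

End limit.

(** * Complementarity in the limit *)

Section complementarity.
Context (R : realType) (V : normedModType R) (L : hilbert_lattice V).
Variables (T : R).
Hypothesis T0 : 0 < T.
Local Notation dot := (dot L).
Variables (z : nat -> R -> V) (K : R).
Hypothesis zs : forall n, sfun (z n).
Hypothesis zK : forall n, rint 0 T (fun s => `|z n s| ^+ 2) <= K.
Variables (u : R -> V) (y : nat -> R -> V).
Hypothesis hu : hL2 T u.
Hypothesis ymid : forall n, midpoints z n (y n).
Hypothesis yu : forall n, rint 0 T (fun s => `|y n s - u s| ^+ 2) <= 8^-1 ^+ n.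
Variable H : R -> V.
Hypothesis Hc : continuous H.
Hypothesis zH : forall e, 0 < e -> exists n0, forall n, (n0 <= n)%N ->
  forall s, 0 <= s -> s <= T -> dot (z n s) (H s) <= e * `|z n s|.

Lemma continuous_good : good (H : R -> V).
Proof.
apply: (@good_comp _ _ _ (GRing.regular R) V H id) => //.
by apply: measurable_good; exact: measurable_id.
Qed.

Lemma continuous_bounded : exists2 B, 0 <= B & forall s, 0 <= s -> s <= T -> `|H s| <= B.
Proof.
have cN : continuous (fun s => `|H s|) by move=> s; apply: cvg_norm; exact: Hc.
have [c cT mc] := @EVT_max R (fun s => `|H s|) 0 T (ltW T0) (continuous_subspaceT cN).
by exists `|H c| => // s s0 sT; apply: mc; rewrite in_itv /= s0.
Qed.

Lemma dot_integrable v : hL2 T v -> rintegrable 0 T (fun s => dot (v s) (H s)).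
Proof.
move=> hv; have [B B0 hB] := continuous_bounded.
apply: (rintegrable_bound (g := fun s => B * `|v s|)).
- by apply: good_dot; [exact: hL2_good hv|exact: continuous_good].
- by apply: rintegrableZ; exact: hL2_L1.
- move=> s /andP[s0 sT]; apply: le_trans (dot_le_norm _ _ _) _.
  by rewrite mulrC ler_wpM2r // hB.
Qed.

Lemma midpoints_dot n e v :
  (forall m, (n <= m)%N -> rint 0 T (fun s => dot (z m s) (H s)) <= e) ->
  midpoints z n v -> rint 0 T (fun s => dot (v s) (H s)) <= e.
Proof.
move=> he; elim => [m nm|v1 v2 m1 IH1 m2 IH2]; first exact: he.
have h1 := midpoints_hL2 T zs m1; have h2 := midpoints_hL2 T zs m2.
have i1 := dot_integrable h1; have i2 := dot_integrable h2.
rewrite (rint_eq (g := fun s => 2^-1 * (dot (v1 s) (H s) + dot (v2 s) (H s)))); last first.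
  by move=> s _; rewrite dotZl dotDl.
by rewrite rintZ ?rintD //; [move: IH1 IH2; lra|exact: rintegrableD].
Qed.

(** The bound on the defect passes to midpoints by linearity, and then to u because H is bounded and
    y n tends to u strongly. *)
Lemma limit_dot_le0 : rint 0 T (fun s => dot (u s) (H s)) <= 0.
Proof.
apply/ler_addgt0Pl => e e0; rewrite addr0.
have [B B0 hB] := continuous_bounded.
have K0 : 0 <= K by apply: le_trans (zK 0); apply: rint_ge0 => s _; exact: sqr_ge0.
(* |z| <= 1 + |z|^2 bounds the L^1 norm of the densities by T + K. *)
have TK : 0 < 2 * (T + K) by rewrite mulr_gt0 // ltr_wpDr.
have [n0 h0] := zH (divr_gt0 e0 TK).
have e1 : 0 < (e / 2 / (B + 1)) ^+ 2 / T.
  by rewrite divr_gt0 ?exprn_gt0 ?divr_gt0 // ltr_wpDl.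
have [n1 h1] := half_pow_small e1.
pose n := maxn n0 n1.
have hyn := midpoints_hL2 T zs (ymid n); have hd := hL2B hyn hu.
have ihd := hL2_L1 hd.
have d1 : rint 0 T (fun s => dot (y n s) (H s)) <= e / 2.
  apply: (midpoints_dot _ (ymid n)) => m nm.
  have hz := sfun_hL2 T (zs m); have i1 := hL2_L1 hz.
  apply: (@le_trans _ _ (rint 0 T (fun s => e / (2 * (T + K)) * (1 + `|z m s| ^+ 2)))).
    apply: rint_le; first exact: dot_integrable.
      by apply: rintegrableZ; apply: rintegrableD; [exact: rintegrable_const|exact: (proj2 hz)].
    move=> s /andP[s0 sT]; apply: le_trans (h0 m _ s s0 sT) _.
      by apply: leq_trans nm; exact: leq_maxl.
    rewrite ler_wpM2l ?(ltW (divr_gt0 _ _)) //.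
    by have := sqr_ge0 (`|z m s| - 1); have := normr_ge0 (z m s); nra.
  rewrite rintZ; last by apply: rintegrableD; [exact: rintegrable_const|exact: (proj2 hz)].
  rewrite rintD; [|exact: rintegrable_const|exact: (proj2 hz)].
  rewrite rint_const ?(ltW T0) // mul1r subr0.
  apply: (@le_trans _ _ (e / (2 * (T + K)) * (T + K))).
    by rewrite ler_pM2l ?divr_gt0 // lerD2l.
  by rewrite le_eqVlt; apply/orP; left; apply/eqP; field; rewrite gt_eqF // ltr_wpDr.
have d2 : rint 0 T (fun s => `|y n s - u s|) <= e / 2 / (B + 1).
  have x0 : 0 <= e / 2 / (B + 1) by rewrite ltW // !divr_gt0 // ltr_wpDl.
  rewrite -(@ler_pXn2r _ 2) ?nnegrE //; last by apply: rint_ge0.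
  apply: le_trans (rint_cauchy_schwarz (ltW T0) (fun s => normr_ge0 _) ihd (proj2 hd)) _.
  rewrite subr0 mulrC -ler_pdivlMr //; apply: le_trans (yu n) _.
  apply: le_trans (h1 n _); last exact: leq_maxr.
  by rewrite lerXn2r ?nnegrE ?invr_ge0 // lef_pV2 ?posrE // ler_nat.
have -> : rint 0 T (fun s => dot (u s) (H s)) =
    rint 0 T (fun s => dot (y n s) (H s)) - rint 0 T (fun s => dot (y n s - u s) (H s)).
  rewrite -rintB; [|exact: dot_integrable..].
  by apply: rint_eq => s _; rewrite dotBl subKr.
have d3 : - rint 0 T (fun s => dot (y n s - u s) (H s)) <= B * rint 0 T (fun s => `|y n s - u s|).
  rewrite -mulN1r -rintZ; last exact: dot_integrable.
  rewrite -rintZ //; apply: rint_le; [apply: rintegrableZ; exact: dot_integrable|exact: rintegrableZ|].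
  move=> s /andP[s0 sT]; rewrite mulN1r -dotNl; apply: le_trans (cauchy_schwarz _ _ _) _.
  by rewrite normrN mulrC ler_wpM2r // hB.
have d4 : B * rint 0 T (fun s => `|y n s - u s|) <= e / 2.
  apply: (@le_trans _ _ ((B + 1) * (e / 2 / (B + 1)))).
    by apply: ler_pM => //; [apply: rint_ge0|rewrite lerDl].
  by rewrite mulrC divfK // gt_eqF // ltr_wpDl.
by rewrite (splitr e); move: d1 d3 d4; lra.
Qed.

(** The integrand is nonnegative and its integral is at most 0. *)
Lemma complementarity : (forall s, 0 <= s <= T -> 0 <= dot (u s) (H s)) ->
  {ae @lebesgue_measure R, forall s, 0 <= s <= T -> dot (u s) (H s) = 0}.
Proof.
move=> uH; have iu := dot_integrable hu.
have i0 : rint 0 T (fun s => dot (u s) (H s)) = 0.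
  by apply/eqP; rewrite eq_le limit_dot_le0; apply: rint_ge0.
have mD : measurable (`[0, T]%classic : set R) by exact: measurable_itv.
have mu : measurable_fun (`[0, T]%classic : set R) (fun s => (dot (u s) (H s))%:E).
  by have /integrableP[] := iu.
have := (ae_eq_integral_abs lebesgue_measure mD mu).1.
have -> : (\int[lebesgue_measure]_(x in `[0%R, T]) `|(dot (u x) (H x))%:E| = 0)%E.
  have <- : (rint 0 T (fun s => dot (u s) (H s)))%:E = 0%E by rewrite i0.
  rewrite -(rint_fin iu); apply: eq_integral => s.
  by rewrite inE /= in_itv /= => hs; rewrite ger0_norm // uH.
move=> /(_ erefl) ae0.
apply: (@ae_imply _ (fun s => `[0, T]%classic s -> (dot (u s) (H s))%:E = cst 0%E s) _ ae0) => s.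
by rewrite /= in_itv /= => hs /hs [].
Qed.

End complementarity.

(** * Solution of the obstacle problem in a Hilbert lattice *)

Section obstacle.
Context (R : realType) (V : normedModType R) (L : hilbert_lattice V).
Variables (w : R) (Q : R -> {linear V -> V}) (hQ : growth_semigroup w Q).
Variables (T : R).
Hypotheses (w0 : 0 < w) (T0 : 0 < T).
Hypothesis Qpos : forall t u, 0 <= t -> ge0 L u -> ge0 L (Q t u).
Local Notation M := (sgM w T).
Local Notation dot := (dot L).

Lemma obstacle_zero_start (ob : R -> V) (K : R) : ge0 L (- ob 0) -> modulus T ob -> 0 <= K ->
  (forall n, (0 < n)%N -> \sum_(k < n) `|pos L (ob (k.+1%:R * (T / n%:R)) -
    Q (T / n%:R) (ob (k%:R * (T / n%:R))))| ^+ 2 <= K * (T / n%:R)) ->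
  exists u : R -> V, [/\ hL2 T u, forall s, ge0 L (u s),
    forall t, 0 <= t <= T -> ge0 L (J Q 0 t u - ob t) &
    {ae @lebesgue_measure R, forall s, 0 <= s <= T -> dot (u s) (J Q 0 s u - ob s) = 0}].
Proof.
move=> ob0 obM K0 ob_mesh.
pose z n := zstep L Q T ob (2 ^ n).
have zs n : sfun (z n) by exact: zstep_sfun.
have zK n : rint 0 T (fun s => `|z n s| ^+ 2) <= K.
  by apply: (zstep_L2 T0 Qpos ob0 ob_mesh); rewrite expn_gt0.
have [u [y [hu ymid yu uy]]] := mazur L zs zK.
have u0 s : ge0 L (u s).
  have [c c0 cy] := uy s; apply: ge0_cvg cy => n; apply: ge0Z => //.
  elim: (ymid n) => [m _|v1 v2 _ h1 _ h2]; first by apply: zstep_ge0; rewrite ?expn_gt0.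
  by apply: ge0Z; rewrite ?invr_ge0 //; exact: ge0D.
have ub t : 0 <= t <= T -> ge0 L (J Q 0 t u - ob t).
  move=> /andP[t0 tT].
  exact: (obstacle_below hQ w0 T0 Qpos ob0 obM K0 ob_mesh hu ymid yu t0 tT).
exists u; split => //.
pose H s := J Q 0 (clamp T s) u - ob (clamp T s).
have Hc : continuous H.
  apply: (@modulus_clamp_cont _ _ _ T0 (fun s => J Q 0 s u - ob s)).
  exact: (modulusB L (modulus_J L hQ w0 T0 hu) obM).
have zH e : 0 < e -> exists n0, forall n, (n0 <= n)%N ->
    forall s, 0 <= s -> s <= T -> dot (z n s) (H s) <= e * `|z n s|.
  move=> e0; have [n0 h0] := zstep_defect hQ w0 T0 Qpos ob0 obM K0 ob_mesh hu ymid yu e0.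
  by exists n0 => n nn s s0 sT; rewrite /H clamp_id ?s0 //; exact: h0.
have uH s : 0 <= s <= T -> 0 <= dot (u s) (H s).
  by move=> hs; rewrite /H clamp_id //; apply: dot_ge0 => //; exact: ub.
have := complementarity T0 zs zK hu ymid yu Hc zH uH.
move=> h; apply: (@ae_imply _ _ _ h) => s hs hsT.
by have := hs hsT; rewrite /H clamp_id.
Qed.

(** Subtracting the free evolution changes the jump of g over a cell by J f over that cell; [J_sqr]
    bounds its square by M^2 tau times the integral of |f|^2 there. This is the origin of the
    constant 2 K + 2 M^2 B. *)
Lemma obstacle_problem (g f : R -> V) (u0 : V) (K : R) : hL2 T f -> ge0 L (u0 - g 0) ->
  modulus T g -> 0 <= K ->
  (forall n, (0 < n)%N -> \sum_(k < n) `|pos L (g (k.+1%:R * (T / n%:R)) -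
    Q (T / n%:R) (g (k%:R * (T / n%:R))))| ^+ 2 <= K * (T / n%:R)) ->
  exists u : R -> V, [/\ hL2 T u, forall s, ge0 L (u s),
    forall t, 0 <= t <= T -> ge0 L (traj Q u0 (fun s => f s + u s) t - g t) &
    {ae @lebesgue_measure R, forall s, 0 <= s <= T ->
      dot (u s) (traj Q u0 (fun s => f s + u s) s - g s) = 0}].
Proof.
move=> hf g0 gM K0 g_mesh.
pose ob t := g t - traj Q u0 f t.
pose B := rint 0 T (fun s => `|f s| ^+ 2).
have B0 : 0 <= B by apply: rint_ge0 => s _; exact: sqr_ge0.
have tM : modulus T (traj Q u0 f) by move=> e e0; exact: (traj_modulus L hQ w0 T0 u0 hf e0).
have ob0 : ge0 L (- ob 0).
  suff -> : - ob 0 = u0 - g 0 by [].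
  have -> : ob 0 = g 0 - (Q 0 u0 + J Q 0 0 f) by [].
  rewrite (sg_id hQ) // (_ : J Q 0 0 f = 0) ?addr0 ?opprB //.
  apply: (dot_inj (L := L)) => v.
  by rewrite (J_dot L hQ w0 T0 v (lexx 0) (ltW T0) hf) rint_point dot0r.
have obM : modulus T ob by exact: (modulusB L gM tM).
have ob_mesh n : (0 < n)%N -> \sum_(k < n) `|pos L (ob (k.+1%:R * (T / n%:R)) -
    Q (T / n%:R) (ob (k%:R * (T / n%:R))))| ^+ 2 <= (2 * K + 2 * (M ^+ 2 * B)) * (T / n%:R).
  move=> n0; have nR : 0 < n%:R :> R by rewrite ltr0n.
  have nT : n%:R * (T / n%:R) = T by rewrite mulrC divfK // gt_eqF.
  have := g_mesh n n0; have : 0 < T / n%:R by exact: divr_gt0.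
  have : forall k, (k <= n)%N -> k%:R * (T / n%:R) <= T by exact: mesh_le.
  move: (T / n%:R) nT => t nT kT t0 gm.
  apply: (@le_trans _ _ (\sum_(k < n) (2 * `|pos L (g (k.+1%:R * t) - Q t (g (k%:R * t)))| ^+ 2 +
      2 * (M ^+ 2 * t * rint (k%:R * t) (k.+1%:R * t) (fun s => `|f s| ^+ 2))))).
    apply: ler_sum => k _.
    have k0 : 0 <= k%:R * t by rewrite mulr_ge0 // ltW.
    have kk : k%:R * t <= k.+1%:R * t by rewrite ler_pM2r // ler_nat.
    have k1T : k.+1%:R * t <= T by apply: kT; exact: ltn_ord.
    have dk : k.+1%:R * t - k%:R * t = t by rewrite -natr1; ring.
    have := J_sqr L hQ w0 T0 k0 kk k1T hf; rewrite dk.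
    have -> : ob (k.+1%:R * t) - Q t (ob (k%:R * t)) =
        (g (k.+1%:R * t) - Q t (g (k%:R * t))) - J Q (k%:R * t) (k.+1%:R * t) f.
      rewrite /ob (traj_flow L hQ w0 T0 u0 k0 kk k1T hf) dk.
      have -> : Q t (g (k%:R * t) - traj Q u0 f (k%:R * t)) =
        Q t (g (k%:R * t)) - Q t (traj Q u0 f (k%:R * t)) by rewrite linearB.
      move: (Q t _) (Q t _) (J _ _ _ _) (g _) => a b c d.
      by apply: (dot_inj (L := L)) => x; rewrite !(dotBr, dotNr, dotDr); ring.
    move: (J _ _ _ _) (_ - Q t _) => a b ha.
    have := norm_posD L b (- a); rewrite normrN.
    have := normr_ge0 (pos L (b - a)); have := normr_ge0 a; have := normr_ge0 (pos L b).
    move: ha; move: (rint _ _ _) => r.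
    move: (`|a|) (`|pos L b|) (`|pos L (b - a)|) => x1 x2 x3 h1 h2 h3 h4 h5.
    apply: (@le_trans _ _ (2 * x2 ^+ 2 + 2 * x1 ^+ 2)); last by lra.
    have : x3 ^+ 2 <= (x2 + x1) ^+ 2 by rewrite lerXn2r ?nnegrE ?addr_ge0.
    by have := sqr_ge0 (x2 - x1); rewrite sqrrB sqrrD; lra.
  rewrite [leRHS]mulrDl big_split /= -!mulr_sumr; apply: lerD.
    by rewrite -mulrA ler_pM2l.
  have fi : rintegrable 0 (n%:R * t) (fun s => `|f s| ^+ 2) by rewrite nT; exact: (proj2 hf).
  by rewrite (rint_cells (ltW t0) fi) nT -!mulrA (mulrC t).
have K1 : 0 <= 2 * K + 2 * (M ^+ 2 * B).
  by rewrite addr_ge0 // mulr_ge0 // mulr_ge0 // sqr_ge0.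
have [u [hu u0' ub ud]] := obstacle_zero_start ob0 obM K1 ob_mesh.
have E t : 0 <= t <= T -> traj Q u0 (fun s => f s + u s) t - g t = J Q 0 t u - ob t.
  move=> /andP[t0 tT]; rewrite /ob /traj (JD L hQ w0 T0 (lexx 0) tT hf hu).
  move: (Q t u0) (J Q 0 t f) (J Q 0 t u) (g t) => a b c d.
  by apply: (dot_inj (L := L)) => x; rewrite !(dotBr, dotNr, dotDr); ring.
exists u; split => // [t ht|]; first by rewrite E //; exact: ub.
apply: (@ae_imply _ _ _ ud) => s hs hsT.
by rewrite E // hs.
Qed.

End obstacle.

(** * Translation to L2(mu) *)

Section data.
Context (R : realType) (V : normedModType R) (L : hilbert_lattice V).
Variable T : R.
Hypothesis T0 : 0 < T.
Local Notation leb := (@lebesgue_measure R).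

(** Setting the approximants to 0 off the set of convergence makes them converge everywhere. *)
Lemma strongly_measurable_good (f : R -> V) : strongly_measurable leb `[0, T] f ->
  exists2 F : R -> V, good F & {ae leb, forall s, 0 <= s <= T -> f s = F s}.
Proof.
move=> [s [ss [N [mN N0 hN]]]]; pose A := `[0, T]%classic `\` N.
have mA : measurable A by apply: measurableD => //; exact: measurable_itv.
exists (fun x => if x \in A then f x else 0).
  exists (fun n x => if x \in A then s n x else 0); split => [n|x].
    split.
      apply: (@sub_finite_set _ _ ((range (s n)) `|` [set 0])).
        by move=> _ [x _ <-] /=; case: ifP => _; [left; exists x|right].
      by rewrite finite_setU; split; [exact: fimfunP|exact: finite_set1].
    move=> y.
    have -> : (fun x => if x \in A then s n x else 0) @^-1` [set y] =
        (A `&` (`[0, T]%classic `&` s n @^-1` [set y])) `|` (~` A `&` [set x : R | 0 = y]).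
      apply/seteqP; split => x /=; case: ifPn; rewrite ?notin_setE ?in_setE => hx.
      - by move=> <-; left; split => //; split => //; case: hx.
      - by move=> <-; right.
      - by case=> [[_ [_ //]]|[]].
      - by case=> [[]|[_ ->]].
    apply: measurableU; first by apply: measurableI => //; have [] := ss n y.
    apply: measurableI; first exact: measurableC.
    have [->|y0] := eqVneq y 0; first by rewrite (_ : [set _ | _] = setT) //; apply/seteqP.
    rewrite (_ : [set _ | _] = set0) //; apply/seteqP; split => // x /= e.
    by rewrite e eqxx in y0.
  case: ifPn; rewrite ?notin_setE ?in_setE => hx; last exact: cvg_cst.
  apply: contrapT => h; case: hx => xD; apply; apply: hN => /=.
  by move=> /(_ xD); apply: h.
exists N; split => // x /= h; apply: contrapT => xN; apply: h => xT.
by rewrite mem_set //; split => //=; rewrite in_itv.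
Qed.

Lemma bochner_L2_rep (f : R -> V) : bochner_L2 leb `[0, T] f ->
  exists2 F : R -> V, hL2 T F & {ae leb, forall s, 0 <= s <= T -> f s = F s}.
Proof.
move=> [/strongly_measurable_good[F gF fF] f2]; exists F => //; split => //.
have mD : measurable (`[0, T]%classic : set R) by exact: measurable_itv.
have mF : measurable_fun (`[0, T]%classic : set R) (fun s => (`|F s| ^+ 2)%:E).
  by apply/measurable_EFinP; apply: measurable_funS (measurable_funX 2 (good_norm gF)).
apply/integrableP; split => //.
under eq_integral do rewrite /= ger0_norm ?sqr_ge0 //.
apply: le_lt_trans f2; rewrite le_eqVlt; apply/orP; left; apply/eqP/esym.
apply: ge0_ae_eq_integral_any => //.
apply: (@ae_imply _ _ _ fF) => s h; rewrite /= in_itv /= => hs.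
by rewrite h.
Qed.

Lemma hL2_bochner_L2 (F : R -> V) : hL2 T F -> bochner_L2 leb `[0, T] F.
Proof.
move=> [[t [st tF]] F2]; split; last first.
  have /integrableP[_] := F2; apply: le_lt_trans.
  by apply: ge0_le_integral_any => s _ /=; rewrite ?lee_fin ?sqr_ge0 // ger0_norm ?sqr_ge0.
have uP n : t n \in fimfun by rewrite inE; case: (st n).
exists (fun n => fimfun_Sub (uP n)); split => [n y|]; last first.
  apply: aeW => x _; apply: cvg_trans (tF x); apply: near_eq_cvg.
  by apply: nearW => n; rewrite fimfun_valP.
have mDy : measurable (`[0, T]%classic `&` fimfun_Sub (uP n) @^-1` [set y]).
  by apply: measurableI; [exact: measurable_itv|rewrite fimfun_valP; case: (st n)].
split=> // _; apply: le_lt_trans (itv_finite 0 T).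
by apply: le_measure; rewrite ?inE //; exact: subIsetl.
Qed.

(** Cauchy-Schwarz; [energy_bound] sees the source only through its L^1 norm. *)
Lemma L2norm_rint (f F : R -> V) : hL2 T F -> {ae leb, forall s, 0 <= s <= T -> f s = F s} ->
  rint 0 T (fun s => `|F s|) <= Num.sqrt T * L2norm leb `[0, T] f.
Proof.
move=> hF fF; have [gF F2] := hF.
have -> : L2norm leb `[0, T] f = Num.sqrt (rint 0 T (fun s => `|F s| ^+ 2)).
  rewrite /L2norm /rint /Rintegral; congr (Num.sqrt (fine _)).
  apply: ge0_ae_eq_integral_any => //.
  - by have /integrableP[] := F2.
  - apply: (@ae_imply _ _ _ fF) => s h; rewrite /= in_itv /= => hs.
    by rewrite h.
rewrite -sqrtrM ?(ltW T0) // -[leLHS]ger0_norm; last by apply: rint_ge0.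
rewrite -sqrtr_sqr ler_wsqrtr //.
apply: le_trans (rint_cauchy_schwarz (ltW T0) (fun s => normr_ge0 _) (hL2_L1 hF) F2) _.
by rewrite subr0.
Qed.

Variables (P : R -> {linear V -> V}) (omega : R).
Hypothesis P_sg : C0_semigroup P.
Hypothesis P_bound : forall t u, 0 <= t -> `|P t u| <= expR (omega * t) * `|u|.
(** A larger growth rate is still admissible, and a positive one makes e^(wt) nondecreasing in t. *)
Let w := Num.max omega 1.
Let w0 : 0 < w. Proof. by rewrite lt_max ltr01 orbT. Qed.

(** P is arbitrary at negative times, where it is replaced by the identity P 0. *)
Definition sgext (t : R) : {linear V -> V} := P (Num.max t 0).

Lemma sgext_ge0 t : 0 <= t -> sgext t = P t.
Proof. by move=> t0; rewrite /sgext max_l. Qed.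

(** Two-sided continuity comes from right continuity at 0 through P_b u - P_a u = P_a (P_(b-a) u -
    u), with a bound on P_a that is uniform near t. *)
Lemma sgext_growth : growth_semigroup w sgext.
Proof.
have [_ P0 PD Pc] := P_sg.
have ew t : 0 <= t -> expR (omega * t) <= expR (w * t).
  by move=> t0; rewrite ler_expR ler_wpM2r // le_max lexx.
have bound t u : 0 <= t -> `|P t u| <= expR (w * t) * `|u|.
  move=> t0; apply: le_trans (P_bound u t0) _; rewrite ler_wpM2r //; exact: ew.
split => [t u t0|s t u s0 t0|t u t0|u t].
- by rewrite /sgext max_r // P0.
- by rewrite !sgext_ge0 ?addr_ge0 // PD.
- by rewrite sgext_ge0 // bound.
apply/cvgrPdist_le => e e0.
have c0 : 0 < expR (w * (`|t| + 1)) by exact: expR_gt0.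
have e1 : 0 < e / expR (w * (`|t| + 1)) by rewrite divr_gt0.
have /cvgrPdist_le /(_ _ e1) := Pc u.
rewrite near_withinE => -[d /= d0 hd].
have step a b : 0 <= a -> a <= b -> a <= `|t| + 1 -> b - a < d -> `|P b u - P a u| <= e.
  move=> a0; rewrite le_eqVlt => /predU1P[-> _ _|ab at1 abd]; first by rewrite subrr normr0 ltW.
  have -> : P b u - P a u = P a (P (b - a) u - u).
    have -> : P b u = P a (P (b - a) u).
      by rewrite -PD ?subr_ge0 ?(ltW ab) //; congr (P _ u); rewrite addrC subrK.
    by rewrite linearB.
  apply: le_trans (bound _ _ a0) _.
  apply: (@le_trans _ _ (expR (w * (`|t| + 1)) * (e / expR (w * (`|t| + 1))))).
    apply: ler_pM; [exact: expR_ge0|exact: normr_ge0|by rewrite ler_expR ler_pM2l|].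
    rewrite distrC; apply: hd; last by rewrite subr_gt0.
    by rewrite /= sub0r normrN gtr0_norm // subr_gt0.
  by rewrite mulrC divfK // gt_eqF.
exists (Num.min d 1); first by rewrite /= lt_min d0 ltr01.
move=> s; rewrite /= lt_min => /andP[std st1]; rewrite /sgext.
have tt := ler_norm t.
have st2 : s <= `|t| + 1 by move: st1; rewrite ltr_distlC => /andP[_]; lra.
have st3 : `|Num.max t 0 - Num.max s 0| <= `|t - s|.
  case: (leP t 0) => ht; case: (leP s 0) => hs; rewrite ?subrr ?normr0 //.
  - by rewrite sub0r normrN gtr0_norm // distrC ger0_norm; lra.
  - by rewrite subr0 !gtr0_norm; lra.
have mt : Num.max t 0 <= `|t| + 1 by rewrite ge_max addr_ge0 // andbT; lra.
have ms : Num.max s 0 <= `|t| + 1 by rewrite ge_max addr_ge0 // andbT.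
have [ab|/ltW ab] := leP (Num.max s 0) (Num.max t 0).
  apply: step => //; first by rewrite le_max lexx orbT.
  by apply: le_lt_trans std; apply: le_trans st3; exact: ler_norm.
rewrite distrC; apply: step => //; first by rewrite le_max lexx orbT.
by apply: le_lt_trans std; apply: le_trans st3; rewrite distrC; exact: ler_norm.
Qed.

Lemma gen_sgext v z : generator P (v, - z) <-> gen sgext v z.
Proof.
rewrite genE /generator /=.
have e : {near 0^'+, (fun h => h^-1 *: (P h v - v)) =1 (fun h => h^-1 *: (sgext h v - v))}.
  by near=> h; rewrite sgext_ge0.
split; apply: cvg_trans; apply: near_eq_cvg; first exact: e.
by apply: filterS e => h ->.
Unshelve. all: by end_near.
Qed.

Lemma J_bochner (f F : R -> V) t : hL2 T F -> {ae leb, forall s, 0 <= s <= T -> f s = F s} ->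
  0 <= t <= T ->
  bochner_integral leb `[0, t] (fun s => P (t - s) (f s)) = J sgext 0 t F.
Proof.
move=> hF fF /andP[t0 tT]; apply: (dot_inj (L := L)) => v.
rewrite (J_dot L sgext_growth w0 T0 v (lexx 0) tT hF).
apply: (@bochner_integral_form _ _ _ leb `[0, t]%classic _ _ V L _
  (fun s => sgext (t - s) (F s))) => //.
- exact: itv_finite.
- by apply: (orb_good_sub sgext_growth w0); exact: hL2_good hF.
- exact: (orb_integrable sgext_growth w0 T0 (lexx 0) tT hF).
- apply: (@ae_imply _ _ _ fF) => s h; rewrite /= in_itv /= => /andP[s0 st].
  by rewrite sgext_ge0 ?subr_ge0 // h // s0 (le_trans st).
- exact: lin_form_dot.
Qed.

End data.

(** * Mild solutions in L2(mu) *)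

Section mild.
Context d (X : measurableType d) (R : realType) (mu : {measure set X -> \bar R}).
Local Notation V := (LspaceType2 mu).
Local Notation L := (L2_hilbert_lattice mu).
Local Notation leb := (@lebesgue_measure R).
Local Notation dot := (dot L).
Variable T : R.
Hypothesis T0 : 0 < T.
Variables (P : R -> {linear V -> V}) (omega : R).
Hypothesis P_sg : C0_semigroup P.
Hypothesis P_bound : forall t u, 0 <= t -> `|P t u| <= expR (omega * t) * `|u|.
Local Notation w := (Num.max omega 1).
Local Notation Q := (sgext P).
Implicit Types (g f : R -> V).

Let w0 : 0 < w. Proof. by rewrite lt_max ltr01 orbT. Qed.

Let hQ : growth_semigroup w Q. Proof. exact: sgext_growth. Qed.

Lemma normal_coneP (h phi z : V) : normal_cone h phi z <->
  forall psi, Lle h psi -> 0 <= dot z (phi - psi).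
Proof. by []. Qed.

(** Each of the two functions is an admissible test function in the normal cone at the other. *)
Lemma normal_cone_monotone (h phi phi' z z' : V) : Lle h phi -> Lle h phi' ->
  normal_cone h phi z -> normal_cone h phi' z' -> 0 <= dot (phi - phi') (z - z').
Proof.
move=> hp hp' /normal_coneP /(_ _ hp') h1 /normal_coneP /(_ _ hp).
move: h1; rewrite (dotC L (phi - phi')) !(dotBl, dotBr); lra.
Qed.

(** By orthogonality dot (- z) (phi - psi) = dot z (psi - h), a pairing of two elements of the
    cone. *)
Lemma normal_cone_orth (h phi z : V) : ge0 L z -> dot z (phi - h) = 0 -> normal_cone h phi (- z).
Proof.
move=> z0 zo; apply/normal_coneP => psi hpsi.
have : 0 <= dot z (psi - h) by apply: dot_ge0 => //; exact/L2ge0B.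
by move: zo; rewrite dotNl !dotBr; lra.
Qed.

Lemma mild_traj g f (phi0 : V) (phi F : R -> V) : hL2 T F -> {ae leb, forall s, 0 <= s <= T -> f s = F s} ->
  mild_solution P T g f phi0 phi -> exists E : R -> V, [/\ hL2 T E,
    {ae leb, forall s, 0 <= s <= T -> Lle (g s) (phi s) /\ normal_cone (g s) (phi s) (E s)} &
    forall t, 0 <= t <= T -> phi t = traj Q phi0 (fun s => F s - E s) t].
Proof.
move=> hF fF [_ pg [eta [eta2 etaN etaE]]].
have [E hE eE] := bochner_L2_rep eta2; exists E; split => //.
  apply: (@ae_imply _ _ _ (ae_and (ae_and pg etaN) eE)) => s [[h1 h2] h3] hs.
  have hs' : s \in `[0, T] by rewrite in_itv.
  by split; [exact: h1|rewrite -h3 //; exact: h2].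
move=> t ht; have ht' : t \in `[0, T] by rewrite in_itv.
have /andP[t0 tT] := ht.
have := etaE t ht'.
rewrite (J_bochner L T0 P_sg P_bound hF fF ht) (J_bochner L T0 P_sg P_bound hE eE ht).
have jb := JB L hQ w0 T0 (lexx 0) tT hF hE.
have se := sgext_ge0 P t0.
by move=> e; rewrite /traj se jb addrA -e addrK.
Qed.

(** The difference is a trajectory driven by (F - F') - (E - E'); monotonicity of the normal cone is
    the sign condition that [energy_bound] asks of E - E'. *)
Lemma mild_lipschitz g f f' (phi0 phi0' : V) (phi phi' : R -> V) :
  bochner_L2 leb `[0, T] f -> bochner_L2 leb `[0, T] f' ->
  mild_solution P T g f phi0 phi -> mild_solution P T g f' phi0' phi' ->
  forall t, 0 <= t <= T -> `|phi t - phi' t| <= sgM w T *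
    (`|phi0 - phi0'| + 2 * (Num.sqrt T * L2norm leb `[0, T] (fun s => f s - f' s))).
Proof.
move=> /bochner_L2_rep[F hF fF] /bochner_L2_rep[F' hF' fF'] s1 s2.
have [E [hE Ec Et]] := mild_traj hF fF s1; have [E' [hE' Ec' Et']] := mild_traj hF' fF' s2.
pose h s := (F s - F' s) - (E s - E' s).
have hk := hL2B hF hF'; have he := hL2B hE hE'; have hh : hL2 T h := hL2B hk he.
have dE t : 0 <= t <= T -> phi t - phi' t = traj Q (phi0 - phi0') h t.
  move=> ht; have /andP[t0 tT] := ht; rewrite Et // Et' // /traj.
  have -> : J Q 0 t h = J Q 0 t (fun s => F s - E s) - J Q 0 t (fun s => F' s - E' s).
    rewrite -(JB L hQ w0 T0 (lexx 0) tT (hL2B hF hE) (hL2B hF' hE')).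
    congr (J _ _ _ _); apply/funext => s; rewrite /h.
    by apply: (dot_inj (L := L)) => x; rewrite !(dotBr, dotNr); ring.
  have -> : Q t (phi0 - phi0') = Q t phi0 - Q t phi0' by rewrite linearB.
  move: (Q t _) (Q t _) (J _ _ _ _) (J _ _ _ _) => a b c e.
  by apply: (dot_inj (L := L)) => x; rewrite !(dotBr, dotNr, dotDr); ring.
have mono : {ae leb, forall s, 0 <= s <= T -> 0 <= dot (traj Q (phi0 - phi0') h s) (E s - E' s)}.
  apply: (@ae_imply _ _ _ (ae_and Ec Ec')) => s [h1 h2] hs; rewrite -dE //.
  have [p1 p2] := h1 hs; have [p3 p4] := h2 hs.
  exact: normal_cone_monotone p1 p3 p2 p4.
move=> t ht; rewrite dE //.
apply: le_trans (energy_bound hQ w0 T0 hh hk he (fun s => erefl) mono ht) _.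
rewrite ler_pM2l ?sgM_gt0 // lerD2l ler_pM2l //.
apply: L2norm_rint => //.
by apply: (@ae_imply _ _ _ (ae_and fF fF')) => s [h1 h2] hs; rewrite h1 // h2.
Qed.

Hypothesis P_pos : forall t, 0 <= t -> positivity_preserving (P t).
Variable N : set (V * V).
Hypothesis N_gen : forall u z, N (u, z) <-> generator P (u, - z).
Variables (g : R -> V) (C : R).
Hypothesis g_W : W1infty 0 T g.
Hypothesis g_yosida : forall l : R, 0 < l -> (0 < omega -> l < omega^-1) ->
  (\int[leb]_(t in `[0%R, T]) (`|Lspace_pos (yosida N l (g t))| ^+ 2)%:E <= C%:E)%E.

Lemma mild_exists f (phi0 : V) : Lle (g 0) phi0 -> bochner_L2 leb `[0, T] f ->
  exists phi, mild_solution P T g f phi0 phi.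
Proof.
move=> g0 /bochner_L2_rep[F hF fF].
have Qpos t u : 0 <= t -> ge0 L u -> ge0 L (Q t u).
  by move=> t0 /L2ge0_Lle u0; apply/L2ge0_Lle; rewrite (sgext_ge0 P t0); exact: P_pos.
have hN u z : N (u, z) <-> gen Q u z.
  by split => [/N_gen/gen_sgext|/gen_sgext/N_gen].
have [Lg Lg0 gLip] := W1infty_lipschitz g_W.
have gM : modulus T g by exact: lipschitz_modulus gLip.
(* 1 / (2 w) is strictly below 1 / omega when omega is positive, so the Yosida bound holds up to
   this value included. *)
have l0 : 0 < (w * 2)^-1 by rewrite invr_gt0 mulr_gt0.
have gY l : 0 < l -> l <= (w * 2)^-1 ->
    (\int[leb]_(t in `[0%R, T]) (`|pos L (yosida N l (g t))| ^+ 2)%:E <= C%:E)%E.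
  move=> lp ll; apply: g_yosida => // o0; apply: le_lt_trans ll _.
  rewrite ltf_pV2 ?posrE ?mulr_gt0 //; apply: (@le_lt_trans _ _ w); first by rewrite le_max lexx.
  by rewrite ltr_pMr // ltr1n.
have [K K0 mesh] := mesh_sum hQ w0 T0 Qpos hN gLip l0 gY.
have g0' : ge0 L (phi0 - g 0) by exact/L2ge0B.
have [u [hu u0 ub ud]] := obstacle_problem hQ w0 T0 Qpos hF g0' gM K0 mesh.
set h := fun s => F s + u s in ub ud.
have hh : hL2 T h by exact: hL2D.
have cE t : 0 <= t <= T -> traj Q phi0 h (clamp T t) = traj Q phi0 h t.
  by move=> ht; rewrite clamp_id.
(* The clamp yields continuity on the whole line, hence within [0, T]. *)
exists (fun t => traj Q phi0 h (clamp T t)); split.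
- exact/continuous_subspaceT/(traj_clamp_cont L hQ w0 T0 hh).
- apply: aeW => t; rewrite in_itv /= => ht; rewrite /obstacle_set /= cE //.
  exact/L2ge0B/ub.
exists (fun s => - u s); split; first exact/hL2_bochner_L2/hL2N.
- apply: (@ae_imply _ _ _ ud) => s hs; rewrite in_itv /= => hsT; rewrite cE //.
  by apply: normal_cone_orth => //; exact: hs.
move=> t ht'; have ht : 0 <= t <= T by move: ht'; rewrite in_itv.
have /andP[t0 tT] := ht; have se := sgext_ge0 P t0; have ce := cE t ht.
have jf := J_bochner L T0 P_sg P_bound hF fF ht.
have ju := J_bochner L T0 P_sg P_bound (hL2N hu) (aeW _ (fun s _ => erefl)) ht.
have jd := JD L hQ w0 T0 (lexx 0) tT hF hu.
have jn : J Q 0 t (fun s => - u s) = - J Q 0 t u.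
  have := JZ L hQ w0 T0 (-1) (lexx 0) tT hu.
  by rewrite scaleN1r => <-; congr (J _ _ _ _); apply/funext => s; rewrite scaleN1r.
rewrite jf ju jn ce /traj jd se.
move: (P t phi0) (J Q 0 t F) (J Q 0 t u) => a b c.
by apply: (dot_inj (L := L)) => x; rewrite !(dotNr, dotDr); ring.
Qed.

End mild.

Theorem theorem2p8 (R : realType)
  (H : completeNormedModType R) (ip : {dot H for idfun})
  (ip_norm : forall x : H, ip x x = `|x| ^+ 2)
  (mu : probability (g_sigma_algebraType (@open H)) R)
  (T : R) (T_gt0 : 0 < T)
  (P : R -> {linear LspaceType2 mu -> LspaceType2 mu})
  (P_sg : C0_semigroup P)
  (N : set (LspaceType2 mu * LspaceType2 mu))
  (N_gen : forall u w, N (u, w) <-> generator P (u, - w))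
  (omega : R)
  (P_bound : forall t u, 0 <= t -> `|P t u| <= expR (omega * t) * `|u|)
  (P_pos : forall t, 0 <= t -> positivity_preserving (P t))
  (g : R -> LspaceType2 mu) (g_W : W1infty 0 T g)
  (C : R)
  (g_yosida : forall l : R, 0 < l -> (0 < omega -> l < omega^-1) ->
    (\int[lebesgue_measure]_(t in `[0%R, T])
       (`|Lspace_pos (yosida N l (g t))| ^+ 2)%:E <= C%:E)%E) :
  (forall (phi0 : LspaceType2 mu) (f : R -> LspaceType2 mu),
     Lle (g 0) phi0 -> bochner_L2 lebesgue_measure `[0, T] f ->
     exists2 phi : R -> LspaceType2 mu, mild_solution P T g f phi0 phi &
       forall phi', mild_solution P T g f phi0 phi' ->
         {in `[0, T], phi' =1 phi}) /\
  (exists K : R, forall (phi0 phi0' : LspaceType2 mu)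
       (f f' phi phi' : R -> LspaceType2 mu),
     Lle (g 0) phi0 -> Lle (g 0) phi0' ->
     bochner_L2 lebesgue_measure `[0, T] f ->
     bochner_L2 lebesgue_measure `[0, T] f' ->
     mild_solution P T g f phi0 phi -> mild_solution P T g f' phi0' phi' ->
     {in `[0, T], forall t, `|phi t - phi' t| <=
       K * (`|phi0 - phi0'| +
            L2norm lebesgue_measure `[0, T] (fun s => f s - f' s))}).
Proof.
pose w := Num.max omega 1.
have lip := mild_lipschitz T_gt0 P_sg P_bound.
split => [phi0 f g0 f2|].
  have [phi hphi] := mild_exists T_gt0 P_sg P_bound P_pos N_gen g_W g_yosida g0 f2.
  exists phi => // phi' hphi' t; rewrite in_itv /= => ht.
  apply/eqP; rewrite -subr_eq0 -normr_le0.
  have := lip g f f phi0 phi0 phi' phi f2 f2 hphi' hphi t ht.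
  suff -> : L2norm lebesgue_measure `[0, T] (fun s => f s - f s) = 0.
    by rewrite subrr normr0 mulr0 mulr0 addr0 mulr0.
  rewrite /L2norm (_ : \int[_]_(_ in _) _ = 0) ?sqrtr0 //.
  rewrite /Rintegral integral0_eq // => s _.
  by rewrite subrr normr0 expr0n.
(* a + 2 sqrt T n <= (1 + 2 sqrt T) (a + n) for nonnegative a and n. *)
exists (sgM w T * (1 + 2 * Num.sqrt T)).
move=> phi0 phi0' f f' phi phi' _ _ f2 f2' h h' t; rewrite in_itv /= => ht.
apply: le_trans (lip g f f' phi0 phi0' phi phi' f2 f2' h h' t ht) _.
rewrite -/w -mulrA ler_pM2l ?sgM_gt0 //.
set n := L2norm _ _ _; have n0 : 0 <= n by exact: sqrtr_ge0.
have s0 : 0 <= Num.sqrt T by exact: sqrtr_ge0.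
have a0 := normr_ge0 (phi0 - phi0').
by have := mulr_ge0 s0 a0; clearbody n; nra.
Qed.
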